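(* Let $\nu>0$, $R>0$, $\mu>0$, let $N$ be a positive integer, and let $v_0,\tilde v_0\in H_0^1(0,1)$, $U_0,\tilde U_0\in\mathbb{R}$. Let $[v,U]$ be the strong solution of $$\begin{cases}\partial_t v-Uv-\nu\partial_x^2v+2v\,\partial_xv=0, & x\in(0,1),\ t>0,\\ U'(t)-R+\nu U(t)=-\int_0^1v^2\,dx, & t>0,\\ v|_{x=0}=v|_{x=1}=0,\quad U(0)=U_0,\quad v|_{t=0}=v_0,\end{cases}$$ and let $[\tilde v,\tilde U]$ be the strong solution of the feedback system $$\begin{cases}\partial_t\tilde v=\tilde U\tilde v+\nu\partial_x^2\tilde v-2\tilde v\,\partial_x\tilde v-\mu\sum_{k=1}^N(\tilde v-v,w_k)w_k, & x\in(0,1),\ t>0,\\ \tilde U'(t)=R-\nu\tilde U(t)-\|\tilde v(t)\|^2, & t>0,\\ \tilde v|_{x=0}=\tilde v|_{x=1}=0,\quad \tilde U(0)=\tilde U_0,\quad \tilde v|_{t=0}=\tilde v_0.\end{cases}$$ Suppose that $$\mu-Q_0\ge0,\qquad \lambda_{N+1}^{-1}Q_0\le\frac{\nu}{4},$$ where $$Q_0:=\frac{4c_0^2}{\nu}M_4+\Big(\frac{4c_0^2}{\nu}+\frac1{2\nu}\Big)M_2+\sqrt{M_3}$$ and $c_0,M_2,M_3,M_4$ are the constants described in the context. Then $$\|\partial_x\tilde v(t)-\partial_xv(t)\|^2+|\tilde U(t)-U(t)|^2\to0\quad\text{as }t\to\infty$$ with an exponential rate; that is, there exist $t_0>0$,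 $C\ge0$ and $\alpha>0$ such that $\|\partial_x\tilde v(t)-\partial_xv(t)\|^2+|\tilde U(t)-U(t)|^2\le Ce^{-\alpha t}$ for all $t\ge t_0$.
   Context: $(\cdot,\cdot)$ and $\|\cdot\|$ are the inner product and norm of $L^2(0,1)$. $w_1,w_2,\dots$ are the eigenfunctions, orthonormal in $L^2(0,1)$, of $-\frac{d^2}{dx^2}$ on $(0,1)$ with homogeneous Dirichlet boundary conditions, corresponding to the eigenvalues $\lambda_1<\lambda_2<\cdots$. A strong solution of the first (uncontrolled) system is a pair $[v,U]$ such that for every $T>0$: $v\in L^\infty(0,T;H_0^1(0,1))\cap L^2(0,T;H^2(0,1))$, $U\in C^1(0,T)$, the equation for $v$ holds in the $L^2$ sense, the equation for $U$ holds, and the initial conditions are attained. A strong solution of the feedback system is defined in the same way. Both problems have unique strong solutions. Constants. $c_0>0$ is a constant in the Sobolev inequality $\|\phi\|_{L^\infty(0,1)}\le c_0\|\partial_x\phi\|$ for all $\phi\in H_0^1(0,1)$. Set $d_0=d_1=\nu\min\{1,2\lambda_1\}$, $$M_1:=\frac{2R^2}{\nu d_0},\qquad M_3:=\frac{2R^2}{\nu d_1}+\frac{\mu}{d_1}M_1;$$ for all sufficiently large $t$ one has $\|v(t)\|^2+|U(t)|^2\le M_1$ and $\|\tilde v(t)\|^2+|\tilde U(t)|^2\le M_3$. $M_2>0$ (depending only on $\nu,R$) is a constant such that for every strong solution $[v,U]$ of the uncontrolled system there is $T_2>0$ with $\|\partial_xv(t)\|^2\le M_2$ for all $t\ge T_2$.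 $M_4>0$ (depending only on $\nu,R,\mu$, not on $N$ or the initial data) is a constant such that for every strong solution $[\tilde v,\tilde U]$ of the feedback system there is $T_4>0$ with $\|\partial_x\tilde v(t)\|^2\le M_4$ for all $t\ge T_4$. *)

(* Defs.v *)
From HB Require Import structures.
From mathcomp Require Import all_boot all_order all_algebra.
From mathcomp Require Import all_classical all_reals all_analysis.
Set Implicit Arguments.
Unset Strict Implicit.
Unset Printing Implicit Defensive.
Import Order.TTheory GRing.Theory Num.Theory.
Import numFieldNormedType.Exports.
Local Open Scope classical_set_scope.
Local Open Scope ring_scope.

(* Functions on (0,1) are total functions R -> R of which only the values on
   ]0,1[ matter; functions of time and space are curried, v t x. *)

Section Sobolev.
Variable R : realType.
Local Notation leb := (@lebesgue_measure R).
Local Notation I01 := (`]0%R, 1%R[%classic : set R).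
Local Notation Q T := (`]0%R, T[%classic `*` I01 : set (R * R)).
Implicit Types (f g phi : R -> R) (v : R -> R -> R).

Definition L2 f : Prop :=
  measurable_fun I01 f /\ (\int[leb]_(x in I01) ((f x) ^+ 2)%:E < +oo)%E.

Definition ip f g : R := \int[leb]_(x in I01) (f x * g x).

Definition l2norm f : R := Num.sqrt (ip f f).

(* C^1 functions with compact support in ]a,b[. Testing weak derivatives with
   C^1 instead of C^oo functions, and closing C^1_c to get H^1_0, are the
   conventions of Brezis' textbook; they give the same spaces. *)
Definition test_fun (a b : R) phi : Prop :=
  [/\ forall x, derivable phi x 1,
      continuous (derive1 phi) &
      exists c d : R, [/\ a < c, d < b & forall x, x \notin `[c, d] -> phi x = 0]].

Definition weak_deriv f g : Prop := forall phi, test_fun 0 1 phi ->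
  \int[leb]_(x in I01) (f x * derive1 phi x) = - \int[leb]_(x in I01) (g x * phi x).

Definition H1 f : Prop := L2 f /\ exists g, L2 g /\ weak_deriv f g.

(* A representative of the weak derivative of f in L^2(0,1); it is the junk
   value 0 when f is not in H^1(0,1). *)
Definition dx f : R -> R := xget (cst 0) [set g | L2 g /\ weak_deriv f g].

Definition H2 f : Prop := H1 f /\ H1 (dx f).

Definition H01 f : Prop := H1 f /\
  forall e : R, 0 < e -> exists phi, [/\ test_fun 0 1 phi,
    l2norm (f \- phi) < e & l2norm (dx f \- derive1 phi) < e].

(* w 0 and lam 0 are irrelevant: the numbering starts at 1. *)
Definition dirichlet_eigenfun (l : R) (f : R -> R) : Prop :=
  [/\ H2 f, H01 f, 0 < l2norm f &
      {ae leb, forall x, x \in `]0, 1[ -> - dx (dx f) x = l * f x}].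

Record dirichlet_spectrum (lam : nat -> R) (w : nat -> R -> R) : Prop := {
  ds_eigen : forall k, (0 < k)%N -> dirichlet_eigenfun (lam k) (w k) ;
  ds_orthonormal : forall j k, (0 < j)%N -> (0 < k)%N ->
    ip (w j) (w k) = (j == k)%:R ;
  ds_increasing : forall j k, (0 < j)%N -> (j < k)%N -> lam j < lam k ;
  ds_all : forall (l : R) f, dirichlet_eigenfun l f ->
    exists2 k, (0 < k)%N & lam k = l }.

(* L^2(0,T;L^2(0,1)), identified with L^2((0,T) x (0,1)). *)
Definition L2L2 (T : R) v : Prop :=
  measurable_fun (Q T) (fun p : R * R => v p.1 p.2) /\
  (\int[leb \x leb]_(p in Q T) ((v p.1 p.2) ^+ 2)%:E < +oo)%E.

(* [dx] chooses a representative separately at each time, so [dx (v t) x] need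
   not be jointly measurable in (t,x); only its classes in L^2(0,1) matter. *)
Definition L2L2_class (T : R) v : Prop := exists V, L2L2 T V /\
  {ae leb, forall t, t \in `]0, T[ ->
    {ae leb, forall x, x \in `]0, 1[ -> v t x = V t x}}.

Definition L2H2 (T : R) v : Prop :=
  [/\ L2L2 T v,
      {ae leb, forall t, t \in `]0, T[ -> H2 (v t)},
      L2L2_class T (fun t => dx (v t)) &
      L2L2_class T (fun t => dx (dx (v t)))].

(* Measurability into H^1_0 is expressed by the first two clauses (on a bounded
   interval, L^oo in time is contained in L^2 in time). *)
Definition LinfH01 (T : R) v : Prop :=
  [/\ L2L2 T v,
      L2L2_class T (fun t => dx (v t)),
      forall t, 0 < t < T -> H01 (v t) &
      exists K : R, {ae leb, forall t, t \in `]0, T[ -> l2norm (dx (v t)) <= K}].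

(* g is the time derivative of v in L^2(0,T;L^2(0,1)): for every scalar test
   function th, the L^2(0,1)-valued integrals over (0,T) of v th' and of - g th
   agree. *)
Definition time_deriv (T : R) v (g : R -> R -> R) : Prop :=
  L2L2 T g /\ forall th, test_fun 0 T th ->
    {ae leb, forall x, x \in `]0, 1[ ->
      \int[leb]_(t in `]0, T[) (v t x * derive1 th t) =
      - \int[leb]_(t in `]0, T[) (g t x * th t)}.

Definition continuousL2 v : Prop :=
  (forall t, 0 <= t -> L2 (v t)) /\
  forall t, 0 <= t ->
    l2norm (v s \- v t) @[s --> within [set s : R | 0 <= s] (nbhs t)] --> (0 : R).

(* Strong solutions of
     v_t = U v + nu v_xx - 2 v v_x + F,   U' = r - nu U - ||v||^2,
   v = 0 at x = 0, 1 (contained in H^1_0), v(0) = v0, U(0) = U0.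
   As v_t is in L^2(0,T;L^2), the solution has a representative which is
   continuous from [0,+oo[ to L^2(0,1), and it takes its values in H^1_0; v is
   this representative, so that v(0) and v(t) make sense for each single t. *)
Record strong_solution (nu r : R) (F : R -> R -> R) (v0 : R -> R) (U0 : R)
    (v : R -> R -> R) (U : R -> R) : Prop := {
  ss_LinfH01 : forall T, 0 < T -> LinfH01 T v ;
  ss_L2H2 : forall T, 0 < T -> L2H2 T v ;
  ss_continuous : continuousL2 v ;
  ss_eqv : forall T, 0 < T -> exists2 vt, time_deriv T v vt &
    {ae leb, forall t, t \in `]0, T[ -> {ae leb, forall x, x \in `]0, 1[ ->
      vt t x = U t * v t x + nu * dx (dx (v t)) x
               - 2 * v t x * dx (v t) x + F t x}} ;
  ss_v0 : {ae leb, forall x, x \in `]0, 1[ -> v 0 x = v0 x} ;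
  ss_U_derivable : forall t, 0 < t -> derivable U t 1 ;
  ss_U_C1 : forall t, 0 < t -> {for t, continuous (derive1 U)} ;
  ss_eqU : forall t, 0 < t -> derive1 U t = r - nu * U t - l2norm (v t) ^+ 2 ;
  ss_U_continuous : {within [set t : R | 0 <= t], continuous U} ;
  ss_U0 : U 0 = U0 }.

Definition uncontrolled_solution (nu r : R) (v0 : R -> R) (U0 : R)
    (v : R -> R -> R) (U : R -> R) : Prop :=
  strong_solution nu r (fun _ _ => 0) v0 U0 v U.

Definition feedback_solution (nu r mu : R) (N : nat) (w : nat -> R -> R)
    (v : R -> R -> R) (v0' : R -> R) (U0' : R)
    (v' : R -> R -> R) (U' : R -> R) : Prop :=
  strong_solution nu r
    (fun t x => - mu * \sum_(1 <= k < N.+1) ip (v' t \- v t) (w k) * w k x)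
    v0' U0' v' U'.

(* ||phi||_{L^oo} <= c0 ||phi'||, with the essential supremum written out. *)
Definition sobolev_constant (c0 : R) : Prop := 0 < c0 /\
  forall phi, H01 phi ->
    {ae leb, forall x, x \in `]0, 1[ -> `|phi x| <= c0 * l2norm (dx phi)}.

Definition M1 (nu r lam1 : R) : R :=
  let d0 := nu * Num.min 1 (2 * lam1) in 2 * r ^+ 2 / (nu * d0).

Definition M3 (nu r mu lam1 : R) : R :=
  let d1 := nu * Num.min 1 (2 * lam1) in
  2 * r ^+ 2 / (nu * d1) + mu / d1 * M1 nu r lam1.

Definition M2_bound (nu r M2 : R) : Prop := 0 < M2 /\
  forall (v0 : R -> R) U0 v U, H01 v0 -> uncontrolled_solution nu r v0 U0 v U ->
    exists2 T2 : R, 0 < T2 &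
      forall t, T2 <= t -> l2norm (dx (v t)) ^+ 2 <= M2.

(* M4 is uniform in the number N of controlled modes and in all initial data. *)
Definition M4_bound (nu r mu : R) (w : nat -> R -> R) (M4 : R) : Prop := 0 < M4 /\
  forall N (v0 : R -> R) U0 v U (v0' : R -> R) U0' v' U',
    (0 < N)%N -> H01 v0 -> H01 v0' ->
    uncontrolled_solution nu r v0 U0 v U ->
    feedback_solution nu r mu N w v v0' U0' v' U' ->
    exists2 T4 : R, 0 < T4 &
      forall t, T4 <= t -> l2norm (dx (v' t)) ^+ 2 <= M4.

Definition Q0 (nu r mu lam1 c0 M2 M4 : R) : R :=
  4 * c0 ^+ 2 / nu * M4 + (4 * c0 ^+ 2 / nu + 1 / (2 * nu)) * M2
  + Num.sqrt (M3 nu r mu lam1).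

End Sobolev.

(* Main.v *)
Require Import Defs.
From mathcomp Require Import all_boot all_order all_algebra.
From mathcomp Require Import all_classical all_reals all_analysis.
From mathcomp Require Import measurable_realfun ring lra.
Import Order.TTheory GRing.Theory Num.Theory.
Import numFieldNormedType.Exports.
Local Open Scope classical_set_scope.
Local Open Scope ring_scope.

(** Let [z = vt - v] and [Z = Ut - U]. Testing the equation of [z] with [- z'']
    and the equation of [Z] with [Z] gives, with [P] the projection on the first
    [N] eigenfunctions,

    [1/2 d/dt (|z'|^2 + Z^2) = Ut |z'|^2 - Z (v, z'') - nu |z''|^2
      + 2 (vt z' + z v', z'') - mu |P z'|^2 - nu Z^2 - Z (|vt|^2 - |v|^2)].

    For large times [|vt'|^2 <= M4], [|v'|^2 <= M2] and [Ut <= sqrt M3], so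
    Young's inequality and the Sobolev inequality leave
    [Q0 |z'|^2 - mu |P z'|^2] and a part of the dissipation. The low modes of
    [Q0 |z'|^2] are absorbed by the feedback because [Q0 <= mu]; the high modes
    are at most [Q0 |z''|^2 / lambda_(N+1) <= nu/4 |z''|^2] and are absorbed by
    the viscosity. What remains is an exponential differential inequality.

    A strong solution does not allow [|z'|^2] to be differentiated directly.
    Its Fourier coefficients, however, satisfy integral equations at all times
    ([coefficient_evolution]), and the argument above is carried out for the
    energy of the first [M] modes, the test function being the truncation of
    [- z'']. The linear terms are diagonal, so truncation costs nothing there;
    the remaining terms see the whole of [z'], whose excess over the truncation
    is at most [|z''|^2 / lambda_(M+1)] ([energy_tail], [energy_rate]). This
    error is integrable in time and disappears as [M] grows
    ([error_energy_step]), which suffices for the decay of all truncated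
    energies ([truncated_decay]); the full norm is then their supremum
    ([H01_pair_complete]). The bound on [Ut] comes from [Ut' <= r - nu Ut]
    ([linear_ode_upper], [sqrt_M3_gt]).

    The eigenfunctions are given only by their defining properties, and they are
    shown to be the sines ([spectrum_projection]). This needs the completeness
    of the sines, which is obtained without Fourier series: by Picone's identity
    a function vanishing at the points [j / (M+1)] satisfies the Poincare
    inequality with the constant [((M+1) pi)^2] ([poincare_zeros]), and sums of
    [M] sines can interpolate any values at these points
    ([sine_interpolation]). Subtracting such an interpolant from an arbitrary
    function yields the spectral gap inequality ([spectral_gap]), which contains
    completeness as well as the estimates for high modes. *)

Set Implicit Arguments.
Unset Strict Implicit.
Unset Printing Implicit Defensive.

(** * The Hilbert space structure of square integrable functions *)

Section SquareIntegrable.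
Variable R : realType.
Local Notation leb := (@lebesgue_measure R).
Local Notation I01 := (`]0%R, 1%R[%classic : set R).
Implicit Types (f g h : R -> R) (a c K : R).

Let mI : measurable I01. Proof. exact: measurable_itv. Qed.

Lemma aeS (P Q : R -> Prop) : (forall x, P x -> Q x) ->
  {ae leb, forall x, P x} -> {ae leb, forall x, Q x}.
Proof.
by move=> PQ; apply: filterS => //; exact: (ae_filter_ringOfSetsType leb).
Qed.

Lemma aeS2 (P1 P2 Q : R -> Prop) : (forall x, P1 x -> P2 x -> Q x) ->
  {ae leb, forall x, P1 x} -> {ae leb, forall x, P2 x} -> {ae leb, forall x, Q x}.
Proof.
by move=> PQ; apply: filterS2 => //; exact: (ae_filter_ringOfSetsType leb).
Qed.

Lemma ae_all (P : R -> Prop) : (forall x, P x) -> {ae leb, forall x, P x}.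
Proof.
by move=> PP; apply: filterE => //; exact: (ae_filter_ringOfSetsType leb).
Qed.

Lemma eq_cvg_seq (u v : nat -> R) (l : R) : (forall n, u n = v n) ->
  v n @[n --> \oo] --> l -> u n @[n --> \oo] --> l.
Proof. by move=> /funext ->. Qed.

Lemma integrable_measurable_fun (D : set R) f :
  leb.-integrable D (EFin \o f) -> measurable_fun D f.
Proof. by move=> /integrableP[/measurable_EFinP]. Qed.

Lemma integrable_add (D : set R) f g : measurable D ->
  leb.-integrable D (EFin \o f) -> leb.-integrable D (EFin \o g) ->
  leb.-integrable D (EFin \o (fun x => f x + g x)).
Proof. by move=> mD fi gi; apply: (integrableD _ fi gi). Qed.

Lemma integrable_scale (D : set R) c f : measurable D ->
  leb.-integrable D (EFin \o f) -> leb.-integrable D (EFin \o (fun x => c * f x)).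
Proof. by move=> mD fi; apply: (integrableZl _ c fi). Qed.

Lemma Rint_mulr (D : set R) c f : measurable D -> leb.-integrable D (EFin \o f) ->
  \int[leb]_(x in D) (f x * c) = \int[leb]_(x in D) f x * c.
Proof. by move=> mD fi; rewrite RintegralZr. Qed.

Lemma Rint_mull (D : set R) c f : measurable D -> leb.-integrable D (EFin \o f) ->
  \int[leb]_(x in D) (c * f x) = c * \int[leb]_(x in D) f x.
Proof. by move=> mD fi; rewrite RintegralZl. Qed.

Lemma integrable_sub (D : set R) f g : measurable D ->
  leb.-integrable D (EFin \o f) -> leb.-integrable D (EFin \o g) ->
  leb.-integrable D (EFin \o (fun x => f x - g x)).
Proof. by move=> mD fi gi; apply: (integrableB _ fi gi). Qed.

Lemma Rint_add (D : set R) (f g : R -> R) : measurable D ->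
  leb.-integrable D (EFin \o f) -> leb.-integrable D (EFin \o g) ->
  \int[leb]_(x in D) (f x + g x) = \int[leb]_(x in D) f x + \int[leb]_(x in D) g x.
Proof. by move=> mD fi gi; apply: RintegralD. Qed.

Lemma Rint_sub (D : set R) (f g : R -> R) : measurable D ->
  leb.-integrable D (EFin \o f) -> leb.-integrable D (EFin \o g) ->
  \int[leb]_(x in D) (f x - g x) = \int[leb]_(x in D) f x - \int[leb]_(x in D) g x.
Proof. by move=> mD fi gi; apply: RintegralB. Qed.

Lemma integrable_subset (A B : set R) (f : R -> R) : measurable A -> measurable B ->
  A `<=` B -> leb.-integrable B (EFin \o f) -> leb.-integrable A (EFin \o f).
Proof. by move=> mA mB AB; apply: integrableS. Qed.

Lemma Rintegral_subset_le (A B : set R) (f : R -> R) : measurable A -> measurable B ->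
  A `<=` B -> (forall x, 0 <= f x) -> leb.-integrable B (EFin \o f) ->
  \int[leb]_(x in A) f x <= \int[leb]_(x in B) f x.
Proof.
move=> mA mB AB f0 fi; have fA := integrable_subset mA mB AB fi.
apply: fine_le.
- exact: integrable_fin_num fA.
- exact: integrable_fin_num fi.
- apply: ge0_subset_integral => //; first by case/integrableP: fi.
  by move=> x _; rewrite lee_fin.
Qed.

Lemma le_integrable_fun (D : set R) f g : measurable D -> measurable_fun D f ->
  (forall x, D x -> `|f x| <= g x) ->
  leb.-integrable D (EFin \o g) -> leb.-integrable D (EFin \o f).
Proof.
move=> mD mf fg ig; apply: le_integrable ig => //.
  exact/measurable_EFinP.
move=> x Dx; rewrite !abse_EFin lee_fin (le_trans (fg _ Dx))// ler_norm//.
Qed.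

Lemma integrable_bddM (D : set R) f g K : measurable D ->
  leb.-integrable D (EFin \o f) -> measurable_fun D g ->
  (forall x, D x -> `|g x| <= K) -> leb.-integrable D (EFin \o (fun x => f x * g x)).
Proof.
move=> mD fi mg gK; have mf := integrable_measurable_fun fi.
have iK : leb.-integrable D (EFin \o (fun x => K * `|f x|)).
  by apply: integrable_scale => //; exact: (integrable_norm fi).
apply: (le_integrable_fun mD _ _ iK); first exact: measurable_funM.
by move=> x Dx; rewrite normrM mulrC ler_wpM2r// gK.
Qed.

Lemma integrable_cst a b c : leb.-integrable `]a, b[ (EFin \o cst c).
Proof.
apply: measurable_bounded_integrable => //.
- suff : (leb `]a, b[%classic < +oo)%E by [].
  by rewrite lebesgue_measure_itv /=; case: ifP => // _; rewrite ltry.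
- by exists `|c|; split => // x cx y _ /=; exact: ltW.
Qed.

Lemma L2_integrable_sqr f : L2 f -> leb.-integrable I01 (EFin \o (fun x => f x ^+ 2)).
Proof.
move=> [mf fi]; apply/integrableP; split.
  by apply/measurable_EFinP; exact: measurable_funX.
suff <- : (\int[leb]_(x in I01) (f x ^+ 2)%:E =
           \int[leb]_(x in I01) `|(f x ^+ 2)%:E|)%E by [].
by apply: eq_integral => x _; rewrite /= ger0_norm ?sqr_ge0.
Qed.

Lemma L2_from_integrable f : measurable_fun I01 f ->
  leb.-integrable I01 (EFin \o (fun x => f x ^+ 2)) -> L2 f.
Proof.
move=> mf /integrableP[_ fi]; split => //.
suff -> : (\int[leb]_(x in I01) (f x ^+ 2)%:E =
           \int[leb]_(x in I01) `|(f x ^+ 2)%:E|)%E by [].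
by apply: eq_integral => x _; rewrite /= ger0_norm ?sqr_ge0.
Qed.

Lemma L2_measurable f : L2 f -> measurable_fun I01 f.
Proof. by case. Qed.
Hint Resolve L2_measurable : core.

Lemma L2_integrableM f g : L2 f -> L2 g ->
  leb.-integrable I01 (EFin \o (fun x => f x * g x)).
Proof.
move=> Lf Lg.
apply: (@le_integrable_fun _ _ (fun x => f x ^+ 2 + g x ^+ 2)) => //.
- by apply: measurable_funM; exact: L2_measurable.
- by move=> x _; rewrite normrM -(real_normK (num_real (f x)))
    -(real_normK (num_real (g x))); nra.
- by apply: integrable_add => //; exact: L2_integrable_sqr.
Qed.

Lemma L2D f g : L2 f -> L2 g -> L2 (f \+ g).
Proof.
move=> Lf Lg; have mfg : measurable_fun I01 (f \+ g).
  by apply: measurable_funD; exact: L2_measurable.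
apply: L2_from_integrable => //.
apply: (@le_integrable_fun _ _ (fun x => 2 * f x ^+ 2 + 2 * g x ^+ 2)) => //.
- by apply: measurable_funX.
- move=> x _ /=; rewrite ger0_norm ?sqr_ge0// -subr_ge0.
  by rewrite (_ : _ - _ = (f x - g x) ^+ 2) ?sqr_ge0//; ring.
- by apply: integrable_add => //; apply: integrable_scale => //; exact: L2_integrable_sqr.
Qed.

Lemma L2Z c f : L2 f -> L2 (fun x => c * f x).
Proof.
move=> Lf; have mf := L2_measurable Lf.
have mcf : measurable_fun I01 (fun x => c * f x) by apply: measurable_funM.
apply: L2_from_integrable => //.
have := @integrableZl _ _ _ leb _ mI (c ^+ 2) _ (L2_integrable_sqr Lf).
by apply: eq_integrable => // x _ /=; rewrite -EFinM exprMn.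
Qed.

Lemma L2N f : L2 f -> L2 (\- f).
Proof. by move/(L2Z (-1)); under eq_fun do rewrite mulN1r. Qed.

Lemma L2B f g : L2 f -> L2 g -> L2 (f \- g).
Proof. by move=> Lf /L2N Lg; exact: (L2D Lf Lg). Qed.

Lemma L2_0 : L2 (fun _ : R => 0).
Proof.
apply: L2_from_integrable => //.
by rewrite (_ : (fun _ => _) = cst 0) ?expr0n//; exact: integrable_cst.
Qed.

Lemma L2_sum (I : Type) (s : seq I) (F : I -> R -> R) :
  (forall i, L2 (F i)) -> L2 (fun x => \sum_(i <- s) F i x).
Proof.
move=> LF; elim: s => [|i s IH].
  by under eq_fun do rewrite big_nil; exact: L2_0.
by under eq_fun do rewrite big_cons; exact: L2D.
Qed.

Lemma L2_bounded f K : measurable_fun I01 f ->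
  (forall x, I01 x -> `|f x| <= K) -> L2 f.
Proof.
move=> mf fK; apply: L2_from_integrable => //.
apply: (@le_integrable_fun _ _ (cst (K ^+ 2))) => //.
- exact: measurable_funX.
- by move=> x Ix /=; rewrite normrX lerXn2r ?nnegrE// ?fK// (le_trans _ (fK _ Ix)).
- exact: integrable_cst.
Qed.

Lemma ae_integrable (D : set R) f g : measurable D ->
  measurable_fun D f -> {ae leb, forall x, D x -> f x = g x} ->
  leb.-integrable D (EFin \o g) -> leb.-integrable D (EFin \o f).
Proof.
move=> mD mf fg /integrableP[mg gi]; apply/integrableP; split.
  exact/measurable_EFinP.
suff -> : (\int[leb]_(x in D) `|(f x)%:E| = \int[leb]_(x in D) `|(g x)%:E|)%E by [].
apply: ae_eq_integral => //.
- by apply: measurableT_comp => //; exact/measurable_EFinP.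
- exact: measurableT_comp.
- by apply: aeS fg => x fg Dx /=; rewrite fg.
Qed.

Lemma ae_eq_Rintegral (D : set R) f g : measurable D ->
  measurable_fun D f -> measurable_fun D g ->
  {ae leb, forall x, D x -> f x = g x} ->
  \int[leb]_(x in D) f x = \int[leb]_(x in D) g x.
Proof.
move=> mD mf mg fg; congr fine; apply: ae_eq_integral => //.
- exact/measurable_EFinP.
- exact/measurable_EFinP.
- by apply: aeS fg => x fg Dx /=; rewrite fg.
Qed.

(** The smaller function is replaced by its minimum with the larger one, which
    changes it on a null set only. *)
Lemma ae_le_Rintegral (D : set R) f g : measurable D ->
  leb.-integrable D (EFin \o f) -> leb.-integrable D (EFin \o g) ->
  {ae leb, forall x, D x -> f x <= g x} ->
  \int[leb]_(x in D) f x <= \int[leb]_(x in D) g x.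
Proof.
move=> mD fi gi fg.
have mf : measurable_fun D f by exact: integrable_measurable_fun.
have mg : measurable_fun D g by exact: integrable_measurable_fun.
have mm : measurable_fun D (fun x => Num.min (f x) (g x)).
  exact: measurable_minr.
have fm : {ae leb, forall x, D x -> f x = Num.min (f x) (g x)}.
  by apply: aeS fg => x + Dx => /(_ Dx) fgx; rewrite min_l.
rewrite (ae_eq_Rintegral mD mf mm fm).
apply: le_Rintegral => //.
- apply: (ae_integrable mD mm _ fi).
  by apply: aeS fm => x + Dx => /(_ Dx).
- by move=> x Dx; rewrite ge_min lexx orbT.
Qed.

Lemma ipC f g : ip f g = ip g f.
Proof. by apply: eq_Rintegral => x _; rewrite mulrC. Qed.

Lemma ipDl f g h : L2 f -> L2 g -> L2 h -> ip (f \+ g) h = ip f h + ip g h.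
Proof.
move=> Lf Lg Lh; rewrite /ip -RintegralD//; try exact: L2_integrableM.
by apply: eq_Rintegral => x _ /=; rewrite mulrDl.
Qed.

Lemma ipZl c f h : L2 f -> L2 h -> ip (fun x => c * f x) h = c * ip f h.
Proof.
move=> Lf Lh; rewrite /ip -RintegralZl//; last exact: L2_integrableM.
by apply: eq_Rintegral => x _ /=; rewrite mulrA.
Qed.

Lemma ipNl f h : L2 f -> L2 h -> ip (\- f) h = - ip f h.
Proof.
move=> Lf Lh; rewrite -mulN1r -ipZl//.
by apply: eq_Rintegral => x _ /=; rewrite mulN1r.
Qed.

Lemma ipBl f g h : L2 f -> L2 g -> L2 h -> ip (f \- g) h = ip f h - ip g h.
Proof. by move=> Lf Lg Lh; rewrite ipDl ?ipNl//; exact: L2N. Qed.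

Lemma ipDr f g h : L2 f -> L2 g -> L2 h -> ip h (f \+ g) = ip h f + ip h g.
Proof. by move=> *; rewrite ipC ipDl// !(ipC h). Qed.

Lemma ipZr c f h : L2 f -> L2 h -> ip h (fun x => c * f x) = c * ip h f.
Proof. by move=> *; rewrite ipC ipZl// (ipC h). Qed.

Lemma ipBr f g h : L2 f -> L2 g -> L2 h -> ip h (f \- g) = ip h f - ip h g.
Proof. by move=> *; rewrite ipC ipBl// !(ipC h). Qed.

Lemma ip0l h : ip (fun=> 0) h = 0.
Proof.
by rewrite /ip; under eq_Rintegral do rewrite mul0r; rewrite Rintegral_cst ?mul0r.
Qed.

Lemma ip_suml (I : Type) (s : seq I) (F : I -> R -> R) h :
  (forall i, L2 (F i)) -> L2 h ->
  ip (fun x => \sum_(i <- s) F i x) h = \sum_(i <- s) ip (F i) h.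
Proof.
move=> LF Lh; elim: s => [|i s IH].
  by rewrite big_nil; under eq_fun do rewrite big_nil; exact: ip0l.
rewrite big_cons -IH -ipDl//; last exact: L2_sum.
by congr ip; apply/funext => x; rewrite big_cons.
Qed.

Lemma ip_sumr (I : Type) (s : seq I) (F : I -> R -> R) h :
  (forall i, L2 (F i)) -> L2 h ->
  ip h (fun x => \sum_(i <- s) F i x) = \sum_(i <- s) ip h (F i).
Proof.
by move=> LF Lh; rewrite ipC ip_suml//; apply: eq_bigr => i _; rewrite ipC.
Qed.

Lemma ip_ge0 f : 0 <= ip f f.
Proof. by apply: Rintegral_ge0 => x _; rewrite -expr2 sqr_ge0. Qed.

Lemma l2norm_ge0 f : 0 <= l2norm f.
Proof. exact: sqrtr_ge0. Qed.

Lemma l2norm_sqr f : l2norm f ^+ 2 = ip f f.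
Proof. by rewrite sqr_sqrtr// ip_ge0. Qed.

Lemma le_sqrt_of_sqr (x c : R) : 0 <= x -> x ^+ 2 <= c -> x <= Num.sqrt c.
Proof.
move=> x0 xc; rewrite -(ger0_norm x0) -sqrtr_sqr ler_sqrt//.
exact: le_trans (sqr_ge0 x) xc.
Qed.

Lemma le_of_sqr (x y : R) : 0 <= y -> x ^+ 2 <= y ^+ 2 -> x <= y.
Proof.
move=> y0 xy; have [x0|/ltW x0] := leP 0 x; last exact: le_trans x0 y0.
by rewrite -(ger0_norm y0) -sqrtr_sqr; exact: le_sqrt_of_sqr.
Qed.

Lemma ip_eq_ae f f' g : L2 f -> L2 f' -> L2 g ->
  {ae leb, forall x, x \in `]0, 1[ -> f x = f' x} -> ip f g = ip f' g.
Proof.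
move=> Lf Lf' Lg ff'; apply: ae_eq_Rintegral => //.
- by apply: measurable_funM; exact: L2_measurable.
- by apply: measurable_funM; exact: L2_measurable.
- by apply: aeS ff' => x + Ix => ->.
Qed.

Lemma l2norm_eq_ae f f' : L2 f -> L2 f' ->
  {ae leb, forall x, x \in `]0, 1[ -> f x = f' x} -> l2norm f = l2norm f'.
Proof.
move=> Lf Lf' ff'; congr Num.sqrt.
by rewrite (ip_eq_ae Lf Lf' Lf ff') ipC (ip_eq_ae Lf Lf' Lf' ff').
Qed.

Lemma ip_sqrD f g : L2 f -> L2 g ->
  ip (f \+ g) (f \+ g) = ip f f + 2 * ip f g + ip g g.
Proof.
move=> Lf Lg; rewrite ipDl ?ipDr//; try exact: L2D.
by rewrite (ipC g f); ring.
Qed.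

Lemma ip_sqrZ c f : L2 f -> ip (fun x => c * f x) (fun x => c * f x) = c ^+ 2 * ip f f.
Proof. by move=> Lf; rewrite ipZl ?ipZr//; [ring|exact: L2Z]. Qed.

Lemma ip_sqrB_le (f g : R -> R) : L2 f -> L2 g ->
  ip (f \- g) (f \- g) <= 2 * (ip f f + ip g g).
Proof.
move=> Lf Lg; have LB := L2B Lf Lg; have LD := L2D Lf Lg.
have := ip_ge0 (f \+ g); rewrite ip_sqrD// (ipBl Lf Lg LB) (ipBr Lf Lg Lf) (ipBr Lf Lg Lg).
rewrite (ipC g f); move: (ip f f) (ip g g) (ip f g) => x y w; lra.
Qed.

(** The polynomial [c |-> |f + c g|^2] is nonnegative at its minimum. *)
Lemma ip_CS_sqr f g : L2 f -> L2 g -> ip f g ^+ 2 <= ip f f * ip g g.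
Proof.
move=> Lf Lg.
have q c : 0 <= ip f f + 2 * c * ip f g + c ^+ 2 * ip g g.
  have := ip_ge0 (f \+ (fun x => c * g x)).
  rewrite ip_sqrD//; last exact: L2Z.
  by rewrite ip_sqrZ// ipZr// mulrA.
have [g0|g0] := eqVneq (ip g g) 0.
  rewrite g0 mulr0; rewrite g0 in q.
  have [->|fg0] := eqVneq (ip f g) 0; first by rewrite expr0n.
  (* the quadratic polynomial degenerates to an affine one, which takes the
     value -1 at this point *)
  have := q (- (ip f f + 1) / (2 * ip f g)).
  suff -> : 2 * (- (ip f f + 1) / (2 * ip f g)) * ip f g = - (ip f f + 1) by lra.
  by field.
have gp : 0 < ip g g by rewrite lt_neqAle eq_sym g0 ip_ge0.
have := q (- ip f g / ip g g).
have -> : ip f f + 2 * (- ip f g / ip g g) * ip f g +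
    (- ip f g / ip g g) ^+ 2 * ip g g = ip f f - ip f g ^+ 2 / ip g g by field.
by rewrite subr_ge0 ler_pdivrMr.
Qed.

Lemma ip_CS f g : L2 f -> L2 g -> `|ip f g| <= l2norm f * l2norm g.
Proof.
move=> Lf Lg; rewrite -(@ler_pXn2r _ 2)// ?nnegrE ?mulr_ge0 ?l2norm_ge0//.
by rewrite real_normK ?num_real// exprMn !l2norm_sqr ip_CS_sqr.
Qed.

Lemma ip_le f g : L2 f -> L2 g -> ip f g <= l2norm f * l2norm g.
Proof. by move=> Lf Lg; rewrite (le_trans _ (ip_CS Lf Lg))// ler_norm. Qed.

Lemma l2normD f g : L2 f -> L2 g -> l2norm (f \+ g) <= l2norm f + l2norm g.
Proof.
move=> Lf Lg; rewrite -(@ler_pXn2r _ 2)// ?nnegrE ?addr_ge0 ?l2norm_ge0//.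
rewrite l2norm_sqr ip_sqrD// sqrrD !l2norm_sqr.
by have := ip_le Lf Lg; lra.
Qed.

Lemma l2normZ c f : L2 f -> l2norm (fun x => c * f x) = `|c| * l2norm f.
Proof.
by move=> Lf; rewrite /l2norm ip_sqrZ// sqrtrM ?sqr_ge0// sqrtr_sqr.
Qed.

Lemma l2normN f : L2 f -> l2norm (\- f) = l2norm f.
Proof.
move=> Lf; rewrite -[RHS]mul1r -(normr1 R) -(normrN 1) -l2normZ//.
by congr l2norm; apply/funext => x /=; rewrite mulN1r.
Qed.

Lemma l2normB f g : L2 f -> L2 g -> l2norm (f \- g) <= l2norm f + l2norm g.
Proof. by move=> Lf Lg; rewrite -(l2normN Lg) l2normD//; exact: L2N. Qed.

Lemma l2norm_subC f g : l2norm (f \- g) = l2norm (g \- f).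
Proof. by congr Num.sqrt; apply: eq_Rintegral => x _ /=; ring. Qed.

Lemma l2norm_le_dist f g : L2 f -> L2 g -> l2norm f <= l2norm g + l2norm (f \- g).
Proof.
move=> Lf Lg; have := l2normD Lg (L2B Lf Lg).
by congr (l2norm _ <= _); apply/funext => x /=; ring.
Qed.

Lemma l2norm_eq0_ae f : L2 f -> l2norm f = 0 ->
  {ae leb, forall x, x \in `]0, 1[ -> f x = 0}.
Proof.
move=> Lf f0.
have ff0 : ip f f = 0 by rewrite -l2norm_sqr f0 expr0n.
have mf2 : measurable_fun I01 (fun x => (f x ^+ 2)%:E).
  by apply/measurable_EFinP; apply: measurable_funX; exact: L2_measurable.
have /(ae_eq_integral_abs leb mI mf2) : (\int[leb]_(x in I01) `|(f x ^+ 2)%:E| = 0)%E.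
  have fin : (\int[leb]_(x in I01) (f x ^+ 2)%:E)%E \is a fin_num.
    by apply: integrable_fin_num => //; exact: L2_integrable_sqr.
  transitivity (\int[leb]_(x in I01) (f x ^+ 2)%:E)%E.
    by apply: eq_integral => x _; rewrite /= ger0_norm ?sqr_ge0.
  have e : fine (\int[leb]_(x in I01) (f x ^+ 2)%:E)%E = ip f f.
    by apply: eq_Rintegral => x _; rewrite expr2.
  by rewrite -(fineK fin) e ff0.
apply: aeS => x fx Ix; have /= [] := fx Ix.
by move/eqP; rewrite sqrf_eq0 => /eqP.
Qed.

Lemma L2_ae_boundedM f g K : measurable_fun I01 f ->
  {ae leb, forall x, x \in `]0, 1[ -> `|f x| <= K} -> L2 g ->
  L2 (fun x => f x * g x) /\ (0 <= K -> l2norm (fun x => f x * g x) <= K * l2norm g).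
Proof.
move=> mf fK Lg; have mg := L2_measurable Lg.
have mfg : measurable_fun I01 (fun x => f x * g x) by exact: measurable_funM.
have ae : {ae leb, forall x, x \in `]0, 1[ -> (f x * g x) ^+ 2 <= K ^+ 2 * g x ^+ 2}.
  apply: aeS fK => x + Ix => /(_ Ix) fK.
  rewrite exprMn ler_wpM2r ?sqr_ge0// -(real_normK (num_real (f x))).
  by rewrite lerXn2r ?nnegrE// (le_trans _ fK).
have iKg : leb.-integrable I01 (EFin \o (fun x => K ^+ 2 * g x ^+ 2)).
  by apply: integrable_scale => //; exact: L2_integrable_sqr.
have Lfg : L2 (fun x => f x * g x).
  apply: L2_from_integrable => //.
  apply: (@ae_integrable _ _
    (fun x => Num.min ((f x * g x) ^+ 2) (K ^+ 2 * g x ^+ 2))) => //.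
  - exact: measurable_funX.
  - by apply: aeS ae => x + Ix => /(_ Ix) h; rewrite min_l.
  - apply: (le_integrable_fun mI _ _ iKg).
      apply: measurable_minr; first exact: measurable_funX.
      by apply: measurable_funM => //; exact: measurable_funX.
    move=> x _; rewrite ger0_norm ?ge_min ?lexx ?orbT//.
    by rewrite le_min sqr_ge0 mulr_ge0 ?sqr_ge0.
split=> // K0; rewrite -(@ler_pXn2r _ 2)// ?nnegrE ?mulr_ge0 ?l2norm_ge0//.
rewrite exprMn !l2norm_sqr /ip -RintegralZl//; last exact: L2_integrableM.
have iM := L2_integrableM.
apply: ae_le_Rintegral; [by []|exact: iM| |].
  by apply: (@integrable_scale _ _ (fun x => g x * g x)) => //; exact: iM.
by apply: aeS ae => x + Ix => /(_ Ix); rewrite !expr2.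
Qed.

Lemma Rdominated_cvg (D : set R) (f_ : nat -> R -> R) f g : measurable D ->
  (forall n, measurable_fun D (f_ n)) -> measurable_fun D f ->
  (forall x, D x -> f_ n x @[n --> \oo] --> f x) ->
  leb.-integrable D (EFin \o g) -> (forall n x, D x -> `|f_ n x| <= g x) ->
  \int[leb]_(x in D) f_ n x @[n --> \oo] --> \int[leb]_(x in D) f x.
Proof.
move=> mD mf_ mf cf gi fg.
have [|||||if_ _] := @dominated_convergence _ _ _ leb _ mD (fun n x => (f_ n x)%:E)
    (EFin \o f) (EFin \o g).
- by move=> n; apply/measurable_EFinP; exact: mf_.
- exact/measurable_EFinP.
- apply: (@ae_all (fun x => D x -> (f_ n x)%:E @[n --> \oo] --> (f x)%:E)) => x Dx.
  by apply: cvg_EFin; [exact: nearW|exact: cf].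
- by [].
- apply: (@ae_all (fun x => forall n, D x -> (`|(f_ n x)%:E| <= (g x)%:E)%E)) => x n Dx.
  by rewrite lee_fin fg.
move=> cv; apply: fine_cvg; rewrite fineK//.
by apply: integrable_fin_num => //.
Qed.

Lemma l2norm_cvg0_bounded (h_ : nat -> R -> R) K :
  (forall n, measurable_fun I01 (h_ n)) ->
  (forall n x, I01 x -> `|h_ n x| <= K) ->
  (forall x, I01 x -> h_ n x @[n --> \oo] --> (0 : R)) ->
  l2norm (h_ n) @[n --> \oo] --> (0 : R).
Proof.
move=> mh hK h0.
rewrite -(@sqrtr0 R).
apply: (@cvg_comp _ _ _ (fun n => ip (h_ n) (h_ n)) Num.sqrt _ (nbhs (0 : R)));
  last exact: sqrt_continuous.
have -> : 0 = \int[leb]_(x in I01) (0 : R) by rewrite Rintegral_cst ?mul0r.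
apply: (@Rdominated_cvg _ _ _ (fun=> K ^+ 2)) => //.
- by move=> n; apply: measurable_funM.
- by move=> x Ix; rewrite -(mulr0 0); apply: cvgM; exact: h0.
- exact: integrable_cst.
- move=> n x Ix; rewrite normrM -expr2 lerXn2r ?nnegrE// ?hK//.
  by rewrite (le_trans _ (hK n _ Ix)).
Qed.

Lemma ip_cvgl (f_ : nat -> R -> R) f h : (forall n, L2 (f_ n)) -> L2 f -> L2 h ->
  l2norm (f \- f_ n) @[n --> \oo] --> (0 : R) ->
  ip (f_ n) h @[n --> \oo] --> ip f h.
Proof.
move=> Lf_ Lf Lh cv; apply/cvgrPdist_le => e e0.
have d0 : 0 < e / (l2norm h + 1).
  by rewrite divr_gt0// ltr_pwDr// l2norm_ge0.
move/cvgrPdist_le : cv => /(_ _ d0); apply: filterS => n.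
rewrite distrC subr0 ger0_norm ?l2norm_ge0// => hn.
rewrite -ipBl//; apply: (le_trans (ip_CS (L2B Lf (Lf_ n)) Lh)).
have hh := l2norm_ge0 h.
rewrite -(@ler_pM2r _ (l2norm h + 1)) in hn; last by lra.
rewrite divfK in hn; last by apply: lt0r_neq0; lra.
by have := l2norm_ge0 (f \- f_ n); nra.
Qed.

Lemma ip_sqr_cvg (f_ : nat -> R -> R) f : (forall n, L2 (f_ n)) -> L2 f ->
  l2norm (f \- f_ n) @[n --> \oo] --> (0 : R) ->
  ip (f_ n) (f_ n) @[n --> \oo] --> ip f f.
Proof.
move=> Lf_ Lf cv.
have c1 := ip_cvgl Lf_ Lf Lf cv.
apply: (@eq_cvg_seq _ (fun n => l2norm (f \- f_ n) * l2norm (f \- f_ n) -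
    (ip f f - (ip (f_ n) f + ip (f_ n) f)))).
  move=> n; rewrite -expr2 l2norm_sqr ipBl ?ipBr//; last exact: L2B.
  by rewrite (ipC f (f_ n)) /=; ring.
rewrite [X in _ --> X](_ : _ = 0 * 0 - (ip f f - (ip f f + ip f f))); last by ring.
apply: cvgB; first exact: cvgM.
by apply: cvgB; [exact: cvg_cst|exact: cvgD].
Qed.

End SquareIntegrable.

(** * Continuously differentiable functions and cutoffs *)

Section ContinuouslyDifferentiable.
Variable R : realType.
Local Notation leb := (@lebesgue_measure R).
Implicit Types (f g h F G : R -> R) (a b c : R).

(** The derivative is kept as an explicit function, so that derivatives are
    computed by composing closure lemmas. *)
Definition C1 F f : Prop := (forall x : R, is_derive x (1 : R) F (f x)) /\ continuous f.

Lemma C1_derivable F f : C1 F f -> forall x, derivable F x 1.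
Proof. by move=> [dF _] x; exact: (@ex_derive _ _ _ _ _ _ _ (dF x)). Qed.

Lemma C1_derive1 F f : C1 F f -> derive1 F = f.
Proof.
by move=> [dF _]; apply/funext => x; rewrite derive1E (@derive_val _ _ _ _ _ _ _ (dF x)).
Qed.

Lemma C1_from_derivable F : (forall x, derivable F x 1) -> continuous (derive1 F) ->
  C1 F (derive1 F).
Proof.
by move=> dF cF; split => // x; apply: DeriveDef; [exact: dF|rewrite derive1E].
Qed.

Lemma C1_continuous F f : C1 F f -> continuous F.
Proof. move=> CF x; apply: differentiable_continuous; apply/derivable1_diffP.
exact: (C1_derivable CF). Qed.

Lemma C1_cst c : C1 (fun=> c) (fun=> 0).
Proof. by split=> [x|]; [exact: is_derive_cst|exact: cst_continuous]. Qed.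

Lemma C1D F f G g : C1 F f -> C1 G g -> C1 (fun x => F x + G x) (fun x => f x + g x).
Proof.
move=> [dF cf] [dG cg]; split=> [x|x]; first exact: (is_deriveD (dF x) (dG x)).
by apply: cvgD; [exact: cf|exact: cg].
Qed.

Lemma C1M F f G g : C1 F f -> C1 G g ->
  C1 (fun x => F x * G x) (fun x => f x * G x + F x * g x).
Proof.
move=> CF CG; have [dF cf] := CF; have [dG cg] := CG; split=> [x|x].
  apply: (is_derive_eq (is_deriveM (dF x) (dG x))).
  by rewrite addrC; congr (_ + _); exact: mulrC.
by apply: cvgD; apply: cvgM; by [exact: cf|exact: cg|exact: (C1_continuous CF)|
  exact: (C1_continuous CG)].
Qed.

Lemma C1Z c F f : C1 F f -> C1 (fun x => c * F x) (fun x => c * f x).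
Proof.
move=> CF; have := C1M (C1_cst c) CF.
by congr C1; apply/funext => x; rewrite mul0r add0r.
Qed.

Lemma C1B F f G g : C1 F f -> C1 G g -> C1 (fun x => F x - G x) (fun x => f x - g x).
Proof.
move=> CF /(C1Z (-1)) CG; have := C1D CF CG.
by congr C1; apply/funext => x; rewrite mulN1r.
Qed.

Lemma C1_sum (I : Type) (s : seq I) (F f : I -> R -> R) :
  (forall i, C1 (F i) (f i)) ->
  C1 (fun x => \sum_(i <- s) F i x) (fun x => \sum_(i <- s) f i x).
Proof.
move=> CF; elim: s => [|i s IH].
  have := C1_cst 0; by congr C1; apply/funext => x; rewrite big_nil.
have := C1D (CF i) IH; by congr C1; apply/funext => x; rewrite big_cons.
Qed.

Lemma C1_affine a b : C1 (fun x => a * x + b) (fun=> a).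
Proof.
have Cid : C1 (fun x => x) (fun=> 1).
  by split=> [x|]; [exact: is_derive_id|exact: cst_continuous].
have := C1D (C1Z a Cid) (C1_cst b).
by congr C1; apply/funext => x; rewrite mulr1 addr0.
Qed.

Lemma C1_comp F f G g : C1 F f -> C1 G g -> C1 (fun x => F (G x)) (fun x => f (G x) * g x).
Proof.
move=> CF CG; have [dF cf] := CF; have [dG cg] := CG; split=> [x|x].
  exact: (is_derive1_comp (dF (G x)) (dG x)).
apply: cvgM; last exact: cg.
by apply: (@continuous_comp _ _ _ G f); [exact: (C1_continuous CG)|exact: cf].
Qed.

Lemma continuous_integrable_itv f a b : continuous f ->
  leb.-integrable `[a, b] (EFin \o f).
Proof.
move=> cf; apply: continuous_compact_integrable; first exact: segment_compact.
exact: continuous_subspaceT.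
Qed.

Lemma continuous_integrable_itvoo f a b : continuous f ->
  leb.-integrable `]a, b[ (EFin \o f).
Proof.
move=> cf; apply: (integrableS _ _ _ (continuous_integrable_itv a b cf)) => //.
exact: subset_itv_oo_cc.
Qed.

Lemma Rintegral_itvoo_cc f a b : leb.-integrable `[a, b] (EFin \o f) ->
  \int[leb]_(x in `]a, b[) f x = \int[leb]_(x in `[a, b]) f x.
Proof.
move=> fi; rewrite -Rintegral_itv_obnd_cbnd.
- rewrite Rintegral_itv_bndo_bndc//.
  by apply: (integrableS _ _ _ fi) => //; exact: subset_itv_oo_cc.
- apply: (integrableS _ _ _ fi) => //; exact: subset_itv_oc_cc.
Qed.

Lemma C1_FTC F f a b : a <= b -> C1 F f ->
  \int[leb]_(x in `]a, b[) f x = F b - F a.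
Proof.
rewrite le_eqVlt => /predU1P[<- _|ab CF].
  by rewrite subrr set_itvoo0// Rintegral_set0.
rewrite Rintegral_itvoo_cc; last by apply: continuous_integrable_itv; case: CF.
rewrite /Rintegral (@continuous_FTC2 _ f F)//.
- by apply: continuous_subspaceT; case: CF.
- split; first by move=> x _; exact: (C1_derivable CF).
  + by apply: cvg_at_right_filter; exact: (C1_continuous CF).
  + by apply: cvg_at_left_filter; exact: (C1_continuous CF).
- by move=> x _; rewrite (C1_derive1 CF).
Qed.

Lemma Rintegral_itvoo_cst (a b c : R) : a <= b ->
  \int[leb]_(x in `]a, b[) c = c * (b - a).
Proof.
move=> ab; rewrite (C1_FTC ab (C1_affine c 0)); ring.
Qed.

Lemma continuousM_fun f g : continuous f -> continuous g -> continuous (fun x => f x * g x).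
Proof. by move=> cf cg x; apply: cvgM; [exact: cf|exact: cg]. Qed.

Lemma C1_IBP F f G g a b : a <= b -> C1 F f -> C1 G g ->
  \int[leb]_(x in `]a, b[) (F x * g x) =
  F b * G b - F a * G a - \int[leb]_(x in `]a, b[) (f x * G x).
Proof.
move=> ab CF CG; apply/eqP; rewrite -subr_eq0 opprB addrA subr_eq0; apply/eqP.
have cF := C1_continuous CF; have cG := C1_continuous CG.
have [_ cf] := CF; have [_ cg] := CG.
rewrite -(C1_FTC ab (C1M CF CG)) RintegralD//; first by rewrite addrC.
- by apply: continuous_integrable_itvoo; exact: continuousM_fun.
- by apply: continuous_integrable_itvoo; exact: continuousM_fun.
Qed.

Lemma continuous_measurable f (D : set R) : measurable D -> continuous f -> measurable_fun D f.
Proof.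
by move=> mD /continuous_measurable_fun mf; apply: measurable_funS mf.
Qed.

Lemma continuous_bounded f a b : continuous f ->
  exists2 K : R, 0 <= K & forall x, a <= x <= b -> `|f x| <= K.
Proof.
move=> cf; have [ba|ab] := ltP b a.
  by exists 0 => // x /andP[ax xb]; lra.
have cn : {within `[a, b], continuous (fun x => `|f x|)}.
  apply: continuous_subspaceT => x.
  by apply: cvg_norm; exact: cf.
have [c _ cmax] := EVT_max ab cn.
by exists `|f c| => // x xab; apply: cmax; rewrite in_itv/=.
Qed.

Lemma continuous_L2 f : continuous f -> L2 f.
Proof.
move=> cf; have [K _ fK] := @continuous_bounded _ 0 1 cf.
apply: (@L2_bounded _ _ K); first exact: continuous_measurable.
by move=> x /=; rewrite in_itv/= => /andP[x0 x1]; apply: fK; rewrite !ltW.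
Qed.

Lemma test_fun_C1 a b phi : test_fun a b phi -> C1 phi (derive1 phi).
Proof. by case=> dphi cphi _; exact: C1_from_derivable. Qed.

Lemma test_fun_out a b phi x : test_fun a b phi -> (x <= a \/ b <= x) -> phi x = 0.
Proof.
move=> [_ _ [c [d [ac db phi0]]]] xab; apply: phi0.
by rewrite in_itv/=; apply/negP => /andP[? ?]; lra.
Qed.

Lemma test_fun_L2 a b phi : test_fun a b phi -> L2 phi.
Proof. by move=> /test_fun_C1 CF; apply: continuous_L2; exact: (C1_continuous CF). Qed.

Lemma test_fun_derive_L2 a b phi : test_fun a b phi -> L2 (derive1 phi).
Proof. by move=> /test_fun_C1 [_ ?]; exact: continuous_L2. Qed.

Lemma C1_weak_deriv F f : C1 F f -> weak_deriv F f.
Proof.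
move=> CF phi tphi; rewrite (C1_IBP ler01 CF (test_fun_C1 tphi)).
rewrite !(test_fun_out tphi) ?mulr0 ?subr0 ?sub0r//; [by left|by right].
Qed.

(** Differentiability of splines at their knots, where the rules for sums and
    products do not apply. *)
Lemma is_derive_quadratic F x d C :
  (forall e, `|F (x + e) - F x - e * d| <= C * e ^+ 2) -> is_derive x (1 : R) F d.
Proof.
move=> Fq.
have C0 : 0 <= C by have := Fq 1; rewrite expr1n mulr1; apply: le_trans.
have cv : h^-1 *: ((F \o shift x) (h *: 1) - F x) @[h --> 0^'] --> d.
  apply/cvgrPdist_le => e e0; near=> h.
  have h0 : h != 0 by near: h; exact: nbhs_dnbhs_neq.
  have hd : `|h| < e / (C + 1).
    near: h; apply: dnbhs0_lt; rewrite divr_gt0//; lra.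
  have hp : 0 < `|h| by rewrite normr_gt0.
  rewrite /= [h *: 1]mulr1 (addrC h x) [_ *: _](_ : _ = h^-1 * (F (x + h) - F x))//.
  have -> : d - h^-1 * (F (x + h) - F x) = - (h^-1 * (F (x + h) - F x - h * d)).
    by field.
  rewrite normrN normrM normfV mulrC ler_pdivrMr//.
  apply: (le_trans (Fq h)); rewrite -(real_normK (num_real h)) expr2 mulrA ler_pM2r//.
  rewrite ltr_pdivlMr in hd; last by lra.
  by nra.
apply: DeriveDef; first by apply/cvg_ex; exists d.
by apply/cvg_lim => //; exact: Rhausdorff.
Unshelve. all: by end_near. Qed.

Definition pos_sqr (x : R) : R := Num.max 0 x ^+ 2.

Lemma pos_sqr_C1 : C1 pos_sqr (fun x => 2 * Num.max 0 x).
Proof.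
split=> [x|].
  apply: (@is_derive_quadratic _ _ _ 1) => e; rewrite /pos_sqr mul1r ler_norml.
  by case: (lerP 0 (x + e)) => h1; case: (lerP 0 x) => h2; apply/andP; split; nra.
move=> x; apply: cvgM; first exact: cvg_cst.
by apply: (@continuous_max R R (fun=> 0) id); [exact: cvg_cst|exact: cvg_id].
Qed.

(** A quadratic spline rising from 0 to 1 on [0,1]. *)
Definition ramp (x : R) : R := 2 * pos_sqr x - 4 * pos_sqr (x - 1/2) + 2 * pos_sqr (x - 1).
Definition dramp (x : R) : R :=
  4 * Num.max 0 x - 8 * Num.max 0 (x - 1/2) + 4 * Num.max 0 (x - 1).

Lemma ramp_C1 : C1 ramp dramp.
Proof.
have sh c : C1 (fun x => pos_sqr (x - c)) (fun x => 2 * Num.max 0 (x - c)).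
  have := C1_comp pos_sqr_C1 (C1_affine 1 (- c)).
  by congr C1; apply/funext => x; rewrite mul1r ?mulr1.
have := C1D (C1B (C1Z 2 pos_sqr_C1) (C1Z 4 (sh (1/2)))) (C1Z 2 (sh 1)).
by congr C1; apply/funext => x; rewrite /dramp; ring.
Qed.

Ltac ramp_cases x := rewrite /ramp /dramp /pos_sqr;
  case: (lerP 0 x) => ?; case: (lerP 0 (x - 1/2)) => ?; case: (lerP 0 (x - 1)) => ?.

Lemma ramp_le0 x : x <= 0 -> ramp x = 0.
Proof.
by move=> x0; rewrite /ramp /pos_sqr !max_l; [ring|lra|lra|lra].
Qed.

Lemma ramp_ge1 x : 1 <= x -> ramp x = 1.
Proof.
by move=> x0; rewrite /ramp /pos_sqr !max_r; [field|lra|lra|lra].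
Qed.

Lemma dramp_le0 x : x <= 0 -> dramp x = 0.
Proof. by move=> x0; rewrite /dramp !max_l; [ring|lra|lra|lra]. Qed.

Lemma dramp_ge1 x : 1 <= x -> dramp x = 0.
Proof. by move=> x0; rewrite /dramp !max_r; [field|lra|lra|lra]. Qed.

Lemma dramp_ge0 x : 0 <= dramp x.
Proof. by ramp_cases x; lra. Qed.

Lemma dramp_le2 x : dramp x <= 2.
Proof. by ramp_cases x; lra. Qed.

Lemma ramp_ge0 x : 0 <= ramp x.
Proof. by ramp_cases x; nra. Qed.

Lemma ramp_le1 x : ramp x <= 1.
Proof. by ramp_cases x; nra. Qed.

Definition ramp_at (c d x : R) : R := ramp ((x - c) / d).
Definition dramp_at (c d x : R) : R := dramp ((x - c) / d) / d.

Lemma ramp_at_C1 c d : C1 (ramp_at c d) (dramp_at c d).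
Proof.
have := C1_comp ramp_C1 (C1_affine d^-1 (- c / d)).
by congr C1; apply/funext => x; rewrite /ramp_at /dramp_at;
  have -> : (x - c) / d = d^-1 * x + - c / d by ring.
Qed.

Lemma ramp_at_le c d x : 0 < d -> x <= c -> ramp_at c d x = 0.
Proof. by move=> d0 xc; apply: ramp_le0; rewrite ler_pdivrMr// mul0r; lra. Qed.

Lemma ramp_at_ge c d x : 0 < d -> c + d <= x -> ramp_at c d x = 1.
Proof. by move=> d0 xc; apply: ramp_ge1; rewrite ler_pdivlMr// mul1r; lra. Qed.

Lemma dramp_at_out c d x : 0 < d -> x <= c \/ c + d <= x -> dramp_at c d x = 0.
Proof.
move=> d0 [xc|xc]; rewrite /dramp_at.
  by rewrite dramp_le0 ?mul0r// ler_pdivrMr// mul0r; lra.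
by rewrite dramp_ge1 ?mul0r// ler_pdivlMr// mul1r; lra.
Qed.

Lemma dramp_at_ge0 c d x : 0 < d -> 0 <= dramp_at c d x.
Proof. by move=> d0; rewrite mulr_ge0 ?dramp_ge0// invr_ge0 ltW. Qed.

Lemma dramp_at_le c d x : 0 < d -> dramp_at c d x <= 2 / d.
Proof. by move=> d0; rewrite ler_pM2r ?invr_gt0// dramp_le2. Qed.

(** A test function close to the indicator of the interval from [c] to [e]. *)
Definition plateau (c e d x : R) : R := ramp_at c d x - ramp_at e d x.

Lemma plateau_C1 c e d : C1 (plateau c e d) (fun x => dramp_at c d x - dramp_at e d x).
Proof. exact: C1B (ramp_at_C1 c d) (ramp_at_C1 e d). Qed.

Lemma plateau_test_fun a b c e d : 0 < d -> a < c -> c <= e -> e + d < b ->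
  test_fun a b (plateau c e d).
Proof.
move=> d0 ac ce eb; have CP := plateau_C1 c e d; split.
- exact: (C1_derivable CP).
- by rewrite (C1_derive1 CP); case: CP.
- exists c, (e + d); split => // x; rewrite in_itv/= negb_and -!ltNge => /orP[xc|xe].
  + by rewrite /plateau !ramp_at_le ?subrr//; lra.
  + by rewrite /plateau !ramp_at_ge ?subrr//; lra.
Qed.

Lemma test_fun_sub a b phi psi : test_fun a b phi -> test_fun a b psi ->
  test_fun a b (phi \- psi).
Proof.
move=> tphi tpsi.
have CB := C1B (test_fun_C1 tphi) (test_fun_C1 tpsi); split.
- exact: (C1_derivable CB).
- by rewrite (C1_derive1 CB); case: CB.
- case: tphi => _ _ [c [d [ac db phi0]]]; case: tpsi => _ _ [c' [d' [ac' db' psi0]]].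
  exists (Num.min c c'), (Num.max d d'); split.
  + by rewrite lt_min ac ac'.
  + by rewrite gt_max db db'.
  + move=> x; rewrite in_itv/= ge_min le_max => /negP nx /=.
    rewrite phi0 ?psi0 ?subrr// in_itv/=; apply/negP => /andP[? ?];
      by apply: nx; apply/andP; split; apply/orP; tauto.
Qed.

End ContinuouslyDifferentiable.

(** * Weak derivatives in one variable *)

Section WeakDerivatives.
Variable R : realType.
Local Notation leb := (@lebesgue_measure R).
Local Notation I01 := (`]0%R, 1%R[%classic : set R).
Implicit Types (f g h z F G : R -> R) (a b c d : R).

Lemma cvg_eventually_cst (u : nat -> R) (l : R) :
  (\forall n \near \oo, u n = l) -> u n @[n --> \oo] --> l.
Proof.
move=> ul; apply/cvgrPdist_le => e e0; near=> n.
have -> : u n = l by near: n.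
by rewrite subrr normr0 ltW.
Unshelve. all: by end_near. Qed.

Lemma cvg_div_nat c (k : nat) : c / (n + k.+1)%:R @[n --> \oo] --> (0 : R).
Proof.
rewrite -(mulr0 c); apply: cvgM; first exact: cvg_cst.
apply: (@eq_cvg_seq _ _ (fun n => harmonic (n + k)%N)) => [n|].
  by rewrite /harmonic /= addnS.
by rewrite cvg_shiftn; exact: cvg_harmonic.
Qed.

(** The derivatives of steeper and steeper ramps are an approximate identity
    concentrated on the right of [c]. *)
Lemma ramp_average a b z c (d_ : nat -> R) : a <= c -> c < b ->
  leb.-integrable `]a, b[ (EFin \o z) -> {for c, continuous z} ->
  (forall n, 0 < d_ n) -> (forall n, c + d_ n <= b) ->
  d_ n @[n --> \oo] --> (0 : R) ->
  \int[leb]_(x in `]a, b[) (z x * dramp_at c (d_ n) x) @[n --> \oo] --> z c.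
Proof.
move=> ac cb zi cz d0 db cd; have mz := integrable_measurable_fun zi; apply/cvgrPdist_le => e e0.
move/cvgrPdist_le : cz => /(_ _ e0) [eta /= eta0 zc].
have : \forall n \near \oo, d_ n < eta.
  move/cvgrPdist_lt : cd => /(_ _ eta0); apply: filterS => n.
  by rewrite distrC subr0 gtr0_norm.
apply: filterS => n dn.
have CR := ramp_at_C1 c (d_ n).
have ir : leb.-integrable `]a, b[ (EFin \o dramp_at c (d_ n)).
  by apply: continuous_integrable_itvoo; case: CR.
have r1 : \int[leb]_(x in `]a, b[) dramp_at c (d_ n) x = 1.
  rewrite (C1_FTC _ CR); last by lra.
  by rewrite ramp_at_ge// ramp_at_le// subr0.
have mr : measurable_fun `]a, b[ (dramp_at c (d_ n)).
  by apply: continuous_measurable => //; case: CR.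
have mzr : measurable_fun `]a, b[ (fun x => z x * dramp_at c (d_ n) x).
  exact: measurable_funM.
have bound x : `|z x * dramp_at c (d_ n) x - z c * dramp_at c (d_ n) x|
    <= e * dramp_at c (d_ n) x.
  rewrite -mulrBl normrM (ger0_norm (dramp_at_ge0 _ _ (d0 n))).
  have [xc|cx] := leP x c.
    by rewrite (dramp_at_out (d0 n)) ?mulr0//; left.
  have [xd|dx] := leP (c + d_ n) x.
    by rewrite (dramp_at_out (d0 n)) ?mulr0//; right.
  rewrite ler_wpM2r ?dramp_at_ge0// distrC; apply: zc.
  by rewrite /ball_ /= ltr_norml; apply/andP; split; lra.
have izr : leb.-integrable `]a, b[ (EFin \o (fun x => z x * dramp_at c (d_ n) x)).
  apply: (@integrable_bddM _ _ _ _ (2 / d_ n)) => // x _.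
  by rewrite ger0_norm ?dramp_at_ge0 ?dramp_at_le.
have izc : leb.-integrable `]a, b[ (EFin \o (fun x => z c * dramp_at c (d_ n) x)).
  exact: integrable_scale.
rewrite distrC -[z c]mulr1 -r1 -RintegralZl// -RintegralB//.
apply: (le_trans (le_normr_Rintegral _ _)) => //; first exact: integrable_sub.
have -> : e = \int[leb]_(x in `]a, b[) (e * dramp_at c (d_ n) x).
  by rewrite RintegralZl// r1 mulr1.
apply: le_Rintegral => //; last exact: integrable_scale.
by apply: integrable_norm; exact: integrable_sub.
Qed.

Lemma ramp_at_cvg c (d_ : nat -> R) x : (forall n, 0 < d_ n) ->
  d_ n @[n --> \oo] --> (0 : R) ->
  ramp_at c (d_ n) x @[n --> \oo] --> (if x <= c then 0 else 1 : R).
Proof.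
move=> d0 cd; apply: cvg_eventually_cst; have [xc|cx] := leP x c.
  by apply: nearW => n; exact: ramp_at_le.
have xc0 : 0 < x - c by lra.
move/cvgrPdist_lt : cd => /(_ _ xc0); apply: filterS => n.
by rewrite distrC subr0 gtr0_norm// => dn; apply: ramp_at_ge => //; lra.
Qed.

(** Test functions close to the indicator of an interval turn the weak equation
    z' = g into the integral equation; this is the du Bois-Reymond lemma when
    g = 0. *)
Lemma weak_primitive a b z g : leb.-integrable `]a, b[ (EFin \o z) ->
  (forall x, a < x < b -> {for x, continuous z}) ->
  leb.-integrable `]a, b[ (EFin \o g) ->
  (forall th, test_fun a b th ->
    \int[leb]_(x in `]a, b[) (z x * derive1 th x) =
    - \int[leb]_(x in `]a, b[) (g x * th x)) ->
  forall c d, a < c -> c <= d -> d < b ->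
  z d - z c = \int[leb]_(x in `]c, d[) g x.
Proof.
move=> zi cz gi weak c d ac cd db.
(* widths small enough for the second ramp to end before b *)
pose d_ n := (b - d) / (n + 2)%:R.
have d0 n : 0 < d_ n by rewrite divr_gt0 ?subr_gt0// ltr0n addn2.
have dle n : d + d_ n < b.
  have : d_ n < b - d; last by lra.
  rewrite ltr_pdivrMr ?ltr0n ?addn2// ltr_pMr ?subr_gt0//.
  by rewrite ltr1n.
have dcv : d_ n @[n --> \oo] --> (0 : R) by exact: cvg_div_nat.
have mg := integrable_measurable_fun gi.
have tP n := @plateau_test_fun _ a b c d (d_ n) (d0 n) ac cd (dle n).
have lim1 : \int[leb]_(x in `]a, b[) (z x * derive1 (plateau c d (d_ n)) x)
    @[n --> \oo] --> z c - z d.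
  apply: (@eq_cvg_seq _ _ (fun n =>
    \int[leb]_(x in `]a, b[) (z x * dramp_at c (d_ n) x) -
    \int[leb]_(x in `]a, b[) (z x * dramp_at d (d_ n) x))); last first.
    apply: cvgB; apply: ramp_average => //; try lra.
    - by apply: cz; apply/andP; split; lra.
    - by move=> n; have := dle n; lra.
    - by apply: cz; apply/andP; split; lra.
    - by move=> n; have := dle n; lra.
  move=> n; have ir e : leb.-integrable `]a, b[
      (EFin \o (fun x => z x * dramp_at e (d_ n) x)).
    apply: (@integrable_bddM _ _ _ _ (2 / d_ n)) => //.
      by apply: continuous_measurable => //; case: (ramp_at_C1 e (d_ n)).
    by move=> x _; rewrite ger0_norm ?dramp_at_ge0 ?dramp_at_le.
  rewrite -RintegralB//; apply: eq_Rintegral => x _.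
  by rewrite (C1_derive1 (plateau_C1 c d (d_ n))) mulrBr.
have mplateau n : measurable_fun `]a, b[ (plateau c d (d_ n)).
  by apply: continuous_measurable => //; apply: C1_continuous (plateau_C1 _ _ _).
have lim2 : \int[leb]_(x in `]a, b[) (g x * plateau c d (d_ n) x)
    @[n --> \oo] --> \int[leb]_(x in `]a, b[) (g \_ `]c, d]) x.
  have cdab : `]a, b[%classic `&` `]c, d]%classic = `]c, d]%classic.
    apply: setIidr => x /=; rewrite !in_itv/= => /andP[? ?]; apply/andP; split; lra.
  apply: (@Rdominated_cvg _ _ _ _ (fun x => `|g x|)) => //.
  - by move=> n; apply: measurable_funM.
  - apply/measurable_restrict => //; rewrite cdab.
    apply: measurable_funS mg => // x /=; rewrite !in_itv/= => /andP[? ?].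
    by apply/andP; split; lra.
  - move=> x _; rewrite patchE.
    have -> : (if x \in `]c, d]%classic then g x else point) =
        g x * ((if x <= c then 0 else 1) - (if x <= d then 0 else 1)).
      rewrite mem_setE in_itv/= /point/=.
      by case: (leP x c) => xc; case: (leP x d) => xd /=; lra.
    apply: cvgM; first exact: cvg_cst.
    by apply: cvgB; exact: ramp_at_cvg.
  - exact: (integrable_norm gi).
  - move=> n x _; rewrite normrM ler_piMr// ler_norml /plateau.
    have := ramp_ge0 ((x - c) / d_ n); have := ramp_le1 ((x - c) / d_ n).
    have := ramp_ge0 ((x - d) / d_ n); have := ramp_le1 ((x - d) / d_ n).
    by rewrite /ramp_at => *; apply/andP; split; lra.
have lim3 : \int[leb]_(x in `]a, b[) (z x * derive1 (plateau c d (d_ n)) x)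
    @[n --> \oo] --> - \int[leb]_(x in `]a, b[) (g \_ `]c, d]) x.
  by apply: (eq_cvg_seq (fun n => weak _ (tP n))); apply: cvgN.
have := cvg_unique _ lim1 lim3.
rewrite -Rintegral_mkcondr.
have -> : `]a, b[%classic `&` `]c, d]%classic = `]c, d]%classic.
  apply: setIidr => x /=; rewrite !in_itv/= => /andP[? ?]; apply/andP; split; lra.
rewrite -Rintegral_itv_bndo_bndc; last first.
  apply: (integrableS _ _ _ gi) => // x /=; rewrite !in_itv/= => /andP[? ?].
  by apply/andP; split; lra.
by move=> /(_ (@Rhausdorff R) _) zcd; rewrite -[LHS]opprK opprB zcd opprK.
Qed.

(** The fundamental lemma of the calculus of variations: all integrals of [g]
    over intervals vanish, and [g] is almost everywhere the derivative of its
    integral. *)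
Lemma weak_zero g : leb.-integrable I01 (EFin \o g) ->
  (forall th, test_fun 0 1 th -> \int[leb]_(x in I01) (g x * th x) = 0) ->
  {ae leb, forall x, x \in `]0, 1[ -> g x = 0}.
Proof.
move=> gi g0.
have prim c d : 0 < c -> c <= d -> d < 1 -> \int[leb]_(x in `]c, d[) g x = 0.
  move=> c0 cd d1; have := @weak_primitive 0 1 (fun=> 0) g _ _ gi _ c d c0 cd d1.
  rewrite subrr => <- //; first exact: integrable_cst.
    by move=> x _; exact: cst_continuous.
  move=> th tth; rewrite g0// oppr0.
  by under eq_Rintegral do rewrite mul0r; rewrite Rintegral_cst ?mul0r.
pose h : R -> R := g \_ I01.
have hi (D : set R) : measurable D -> leb.-integrable D (EFin \o h).
  move=> mD; apply: (@integrableS _ _ _ leb setT D) => //.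
  have -> : EFin \o h = (EFin \o g) \_ I01 by rewrite /h restrict_EFin.
  exact: (@integrable_mkcond _ _ _ leb I01 (EFin \o g) (measurable_itv _)).1 gi.
have loc : locally_integrable [set: R] h.
  apply: integrable_locally => //; exact: hi.
have := FTC1Ny (fun y => hi _ (measurable_itv _)) loc.
apply: aeS => x [dH H'] /[dup] xI; rewrite in_itv/= => /andP[x0 x1].
have <- : h x = g x by rewrite /h patchE mem_setE xI.
rewrite -H' derive1E.
have nx : \forall y \near x, \int[leb]_(t in `]-oo, y]) h t = \int[leb]_(t in `]-oo, x]) h t.
  near=> y.
  have y0 : 0 < y by near: y; exact: lt_nbhsr.
  have y1 : y < 1 by near: y; exact: lt_nbhsl.
  have key c d : 0 < c -> c <= d -> d < 1 ->
      \int[leb]_(t in `]-oo, d]) h t = \int[leb]_(t in `]-oo, c]) h t.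
    move=> c0 cd d1; apply/eqP; rewrite -subr_eq0; apply/eqP.
    rewrite Rintegral_itvB//; last exact: hi.
    rewrite -Rintegral_itv_bndo_bndc; last exact: hi.
    rewrite -(prim c d)//; apply: eq_Rintegral => t; rewrite mem_setE in_itv/= => /andP[? ?].
    by rewrite /h patchE mem_setE in_itv/= ifT//; apply/andP; split; lra.
  by have [xy|yx] := leP x y; [apply: key|symmetry; apply: key => //; lra].
rewrite (@near_eq_derive _ _ _ _ _ x (1 : R) nx) derive_cst//.
Unshelve. all: by end_near. Qed.

Lemma L2_integrable f : L2 f -> leb.-integrable I01 (EFin \o f).
Proof.
move=> Lf; have := L2_integrableM Lf (continuous_L2 (@cst_continuous _ _ (1 : R))).
by congr (leb.-integrable _ _); apply/funext => x /=; rewrite mulr1.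
Qed.

Lemma weak_deriv_unique f g1 g2 : L2 g1 -> L2 g2 -> weak_deriv f g1 -> weak_deriv f g2 ->
  {ae leb, forall x, x \in `]0, 1[ -> g1 x = g2 x}.
Proof.
move=> L1 L2' w1 w2.
have : {ae leb, forall x, x \in `]0, 1[ -> (g1 \- g2) x = 0}.
  apply: weak_zero; first by apply: L2_integrable; exact: L2B.
  move=> th tth; rewrite -[LHS]/(ip (g1 \- g2) th) ipBl//; last exact: (test_fun_L2 tth).
  apply/eqP; rewrite subr_eq0 -eqr_opp; apply/eqP.
  by rewrite -(w1 _ tth) -(w2 _ tth).
by apply: aeS => x h xI; apply/eqP; rewrite -subr_eq0; apply/eqP; exact: h.
Qed.

Lemma H1_dx f : H1 f -> L2 (dx f) /\ weak_deriv f (dx f).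
Proof.
by move=> [Lf [g Hg]]; exact: (@xgetPex _ _ [set g | L2 g /\ weak_deriv f g]
  (ex_intro _ g Hg)).
Qed.

(** [f] belongs to H^1_0 with derivative [g]; unlike [H01 f], this
    does not involve the choice of a representative made by [dx]. *)
Definition H01_pair f g := [/\ L2 f, L2 g & exists phi_ : nat -> R -> R,
  [/\ forall n, test_fun 0 1 (phi_ n),
      l2norm (f \- phi_ n) @[n --> \oo] --> (0 : R) &
      l2norm (g \- derive1 (phi_ n)) @[n --> \oo] --> (0 : R)]].

Lemma H01_to_pair f : H01 f -> H01_pair f (dx f).
Proof.
move=> [H1f approx]; have [Ldx _] := H1_dx H1f; split => //; first by case: H1f.
have pos n : 0 < (n.+1%:R : R)^-1 by rewrite invr_gt0 ltr0n.
pose phi_ n := sval (cid (approx _ (pos n))).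
have phiP n := svalP (cid (approx _ (pos n))).
exists phi_; split => [n|  |]; first by case: (phiP n).
- apply: (@squeeze_cvgr _ _ _ _ (fun=> 0) harmonic).
  + by apply: nearW => n; rewrite l2norm_ge0 /= ltW//; case: (phiP n).
  + exact: cvg_cst.
  + exact: cvg_harmonic.
- apply: (@squeeze_cvgr _ _ _ _ (fun=> 0) harmonic).
  + by apply: nearW => n; rewrite l2norm_ge0 /= ltW//; case: (phiP n).
  + exact: cvg_cst.
  + exact: cvg_harmonic.
Qed.

(** Integration by parts: the boundary terms vanish because one factor is a
    limit of compactly supported functions. *)
Lemma H01_pair_IBP f g h k : H01_pair f g -> L2 h -> L2 k -> weak_deriv h k ->
  ip f k = - ip g h.
Proof.
move=> [Lf Lg [phi_ [tphi cf cg]]] Lh Lk hk.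
have c1 := ip_cvgl (fun n => test_fun_L2 (tphi n)) Lf Lk cf.
have c2 := ip_cvgl (fun n => test_fun_derive_L2 (tphi n)) Lg Lh cg.
have c3 : ip (phi_ n) k @[n --> \oo] --> - ip g h.
  apply: (@eq_cvg_seq _ _ (fun n => - ip (derive1 (phi_ n)) h)); last exact: cvgN.
  by move=> n; rewrite ipC (ipC _ h) [in RHS]/ip hk// opprK.
exact: (cvg_unique (@Rhausdorff R) c1 c3).
Qed.

Lemma H01_pair_weak_deriv f g : H01_pair f g -> weak_deriv f g.
Proof.
move=> Hfg phi tphi; have CP := test_fun_C1 tphi.
apply: (H01_pair_IBP Hfg (test_fun_L2 tphi) (test_fun_derive_L2 tphi)).
exact: C1_weak_deriv.
Qed.

Lemma H01_pairB f g f' g' : H01_pair f g -> H01_pair f' g' ->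
  H01_pair (f \- f') (g \- g').
Proof.
move=> [Lf Lg [phi_ [tphi cf cg]]] [Lf' Lg' [psi_ [tpsi cf' cg']]].
split; [exact: L2B|exact: L2B|].
have sq u v u_ v_ : L2 u -> L2 v -> (forall n, L2 (u_ n)) -> (forall n, L2 (v_ n)) ->
    l2norm (u \- u_ n) @[n --> \oo] --> (0 : R) ->
    l2norm (v \- v_ n) @[n --> \oo] --> (0 : R) ->
    l2norm ((u \- v) \- (u_ n \- v_ n)) @[n --> \oo] --> (0 : R).
  move=> Lu Lv Lu_ Lv_ cu cv.
  apply: (@squeeze_cvgr _ _ _ _ (fun=> 0)
    (fun n => l2norm (u \- u_ n) + l2norm (v \- v_ n))).
  - apply: nearW => n; rewrite l2norm_ge0 /=.
    have -> : (u \- v) \- (u_ n \- v_ n) = (u \- u_ n) \- (v \- v_ n).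
      by apply/funext => x /=; ring.
    by apply: l2normB; exact: L2B.
  - exact: cvg_cst.
  - by rewrite -(addr0 0); exact: cvgD.
exists (fun n => phi_ n \- psi_ n); split.
- by move=> n; exact: test_fun_sub.
- by apply: sq => // n; [exact: (test_fun_L2 (tphi n))|exact: (test_fun_L2 (tpsi n))].
- apply: (@eq_cvg_seq _ _ (fun n => l2norm ((g \- g') \- (derive1 (phi_ n) \- derive1 (psi_ n))))).
    move=> n; congr l2norm; apply/funext => x /=.
    by rewrite (C1_derive1 (C1B (test_fun_C1 (tphi n)) (test_fun_C1 (tpsi n)))).
  by apply: sq => // n;
    [exact: (test_fun_derive_L2 (tphi n))|exact: (test_fun_derive_L2 (tpsi n))].
Qed.

Lemma H01_pair_H01 f g : H01_pair f g -> H01 f.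
Proof.
move=> Hfg; have [Lf Lg [phi_ [tphi cf cg]]] := Hfg.
have wfg := H01_pair_weak_deriv Hfg.
have H1f : H1 f by split => //; exists g.
split => // e e0; have [Ldx wdx] := H1_dx H1f.
have gdx := weak_deriv_unique Ldx Lg wdx wfg.
move/cvgrPdist_lt : cf => /(_ _ e0) nf; move/cvgrPdist_lt : cg => /(_ _ e0) ng.
near \oo => n; exists (phi_ n); split => //.
  have : `|0 - l2norm (f \- phi_ n)| < e by near: n.
  by rewrite sub0r normrN ger0_norm ?l2norm_ge0.
have : `|0 - l2norm (g \- derive1 (phi_ n))| < e by near: n.
rewrite sub0r normrN ger0_norm ?l2norm_ge0//; congr (_ < _).
have Ld := test_fun_derive_L2 (tphi n).
apply: l2norm_eq_ae; [exact: L2B|exact: L2B|].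
by apply: aeS gdx => x h xI /=; rewrite h.
Unshelve. all: by end_near. Qed.

Lemma H01_pair_dx f g : H01_pair f g ->
  {ae leb, forall x, x \in `]0, 1[ -> dx f x = g x}.
Proof.
move=> Hfg; have [_ Lg _] := Hfg.
have [Ldx wdx] := H1_dx (H01_pair_H01 Hfg).1.
exact: (weak_deriv_unique Ldx Lg wdx (H01_pair_weak_deriv Hfg)).
Qed.

(** Near the end points [F] is of the order of the width of the cutoff, which
    compensates the size of the derivative of the cutoff. *)
Lemma C1_H01_pair F f : C1 F f -> F 0 = 0 -> F 1 = 0 -> H01_pair F f.
Proof.
move=> CF F0 F1; have cF := C1_continuous CF; have [dF cf] := CF.
split; [exact: continuous_L2|exact: continuous_L2|].
have [K K0 fK] := continuous_bounded 0 1 cf.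
have [L L0 FL] := continuous_bounded 0 1 cF.
have lip x y : 0 <= x -> x <= y -> y <= 1 -> `|F y - F x| <= K * (y - x).
  move=> x0 xy y1.
  have [|c] := @MVT_segment R F f x y xy (fun t _ => dF t).
    exact: continuous_subspaceT.
  rewrite in_itv/= => /andP[xc cy] ->.
  rewrite normrM (ger0_norm (_ : 0 <= y - x)) ?subr_ge0// ler_wpM2r ?subr_ge0//.
  by apply: fK; apply/andP; split; lra.
(* with widths at most 1/5 the two ramps of the cutoff do not overlap *)
pose d_ n : R := 1 / (n + 5)%:R.
have d0 n : 0 < d_ n by rewrite divr_gt0// ltr0n addnS.
have d5 n : 5 * d_ n <= 1.
  rewrite /d_ mul1r ler_pdivrMr ?ltr0n ?addnS// mul1r.
  by rewrite ler_nat !ltnS.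
have dcv : d_ n @[n --> \oo] --> (0 : R) by exact: cvg_div_nat.
pose chi n := plateau (d_ n) (1 - 2 * d_ n) (d_ n).
pose dchi n x := dramp_at (d_ n) (d_ n) x - dramp_at (1 - 2 * d_ n) (d_ n) x.
have Cchi n : C1 (chi n) (dchi n) by exact: plateau_C1.
have tchi n : test_fun 0 1 (chi n).
  by apply: plateau_test_fun => //; have := d0 n; have := d5 n; lra.
have CP n := C1M CF (Cchi n).
have chi1 n x : 2 * d_ n <= x -> x <= 1 - 2 * d_ n -> chi n x = 1.
  by move=> xl xr; rewrite /chi /plateau ramp_at_ge ?ramp_at_le ?subr0//; lra.
have dchi0 n x : 2 * d_ n <= x -> x <= 1 - 2 * d_ n -> dchi n x = 0.
  by move=> xl xr; rewrite /dchi !dramp_at_out ?subr0//; [left|right]; lra.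
have chi01 n x : 0 <= chi n x <= 1.
  rewrite /chi /plateau; have [xl|xl] := leP x (1 - 2 * d_ n).
    by rewrite [X in _ - X]ramp_at_le ?subr0// /ramp_at ramp_ge0 ramp_le1.
  rewrite ramp_at_ge//; last by have := d5 n; lra.
  by rewrite /ramp_at subr_ge0 ramp_le1/= lerBlDr lerDl ramp_ge0.
have Fdramp n c x : `|F x| <= K * (2 * d_ n) ->
    `|F x| * `|dramp_at c (d_ n) x| <= 4 * K.
  move=> Fx; have dn := d0 n.
  rewrite (ger0_norm (dramp_at_ge0 c x dn)).
  apply: (le_trans (ler_pM _ _ Fx (dramp_at_le _ _ dn))) => //.
    exact: dramp_at_ge0.
  by rewrite le_eqVlt; apply/orP; left; apply/eqP; field; exact: lt0r_neq0.
have Fdchi n x : 0 < x < 1 -> `|F x * dchi n x| <= 4 * K.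
  move=> /andP[x0 x1]; rewrite normrM.
  have dn := d0 n; have dn5 := d5 n.
  have [xl|xl] := leP x (2 * d_ n).
    rewrite /dchi [X in _ - X]dramp_at_out//; last by left; lra.
    rewrite subr0; apply: Fdramp.
    have := lip 0 x (lexx _) (ltW x0) (ltW x1); rewrite F0 !subr0 => /le_trans -> //.
    by rewrite ler_wpM2l.
  have [xr|xr] := leP x (1 - 2 * d_ n).
    by rewrite dchi0 ?normr0 ?mulr0//; [lra|exact: ltW].
  rewrite /dchi dramp_at_out//; last by right; lra.
  rewrite sub0r normrN; apply: Fdramp.
  have := lip x 1 (ltW x0) (ltW x1) (lexx _); rewrite F1 sub0r normrN => /le_trans -> //.
  by rewrite ler_wpM2l//; lra.
have near_in x : 0 < x < 1 -> \forall n \near \oo, 2 * d_ n <= x /\ x <= 1 - 2 * d_ n.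
  move=> /andP[x0 x1].
  have e0 : 0 < Num.min x (1 - x) / 2 by rewrite divr_gt0// lt_min x0 subr_gt0.
  move/cvgrPdist_lt : dcv => /(_ _ e0); apply: filterS => n.
  rewrite sub0r normrN gtr0_norm// ltr_pdivlMr// lt_min => /andP[? ?].
  by split; lra.
exists (fun n x => F x * chi n x); split.
- move=> n; split.
  + exact: (C1_derivable (CP n)).
  + by rewrite (C1_derive1 (CP n)); case: (CP n).
  + case: (tchi n) => _ _ [c [d [c0 d1 chi0]]].
    by exists c, d; split => // x /chi0 ->; rewrite mulr0.
- apply: (@l2norm_cvg0_bounded _ _ L) => [n|n x|x].
  + apply: continuous_measurable => //; apply: C1_continuous (C1B CF (CP n)).
  + rewrite /= in_itv/= => /andP[x0 x1].
    have Fx : `|F x| <= L by apply: FL; rewrite !ltW.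
    rewrite -{1}[F x]mulr1 -mulrBr normrM -[L]mulr1 ler_pM//.
    by have /andP[? ?] := chi01 n x; rewrite ler_norml; apply/andP; split; lra.
  + rewrite /= in_itv/= => /near_in xn; apply: cvg_eventually_cst.
    by apply: filterS xn => n [xl xr]; rewrite chi1// mulr1 subrr.
- apply: (@eq_cvg_seq _ _ (fun n => l2norm (f \- (fun x => f x * chi n x + F x * dchi n x)))).
    by move=> n; rewrite (C1_derive1 (CP n)).
  apply: (@l2norm_cvg0_bounded _ _ (K + 4 * K)) => [n|n x|x].
  + apply: continuous_measurable => // x.
    by apply: cvgB; [exact: cf|case: (CP n) => _; apply].
  + rewrite /= in_itv/= => xI.
    have -> : f x - (f x * chi n x + F x * dchi n x) = f x * (1 - chi n x) - F x * dchi n x.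
      by ring.
    apply: (le_trans (ler_normB _ _)); apply: lerD; last exact: Fdchi.
    have fx : `|f x| <= K by apply: fK; case/andP: xI => ? ?; rewrite !ltW.
    rewrite normrM -[K]mulr1 ler_pM//.
    by have /andP[? ?] := chi01 n x; rewrite ler_norml; apply/andP; split; lra.
  + rewrite /= in_itv/= => /near_in xn; apply: cvg_eventually_cst.
    by apply: filterS xn => n [xl xr]; rewrite chi1// dchi0//; ring.
Qed.

End WeakDerivatives.

(** * The sharp Poincare inequality for functions with prescribed zeros *)

Section PoincareZeros.
Variable R : realType.
Local Notation leb := (@lebesgue_measure R).
Implicit Types (f g h F G : R -> R) (a b c d : R).

Lemma local_FTC F f a b : a < b -> (forall x, a <= x <= b -> is_derive x (1 : R) F (f x)) ->
  {within `[a, b], continuous f} -> \int[leb]_(x in `]a, b[) f x = F b - F a.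
Proof.
move=> ab dF cf.
have cF x : a <= x <= b -> {for x, continuous F}.
  move=> xab; apply: differentiable_continuous; apply/derivable1_diffP.
  exact: (@ex_derive _ _ _ _ _ _ _ (dF x xab)).
rewrite Rintegral_itvoo_cc; last first.
  by apply: continuous_compact_integrable => //; exact: segment_compact.
rewrite /Rintegral (@continuous_FTC2 _ f F)//.
- split.
  + move=> x; rewrite in_itv/= => /andP[? ?].
    by apply: (@ex_derive _ _ _ _ _ _ _ (dF x _)); apply/andP; split; lra.
  + by apply: cvg_at_right_filter; apply: cF; rewrite lexx ltW.
  + by apply: cvg_at_left_filter; apply: cF; rewrite lexx ltW.
- move=> x; rewrite in_itv/= => /andP[? ?]; rewrite derive1E.
  by apply: (@derive_val _ _ _ _ _ _ _ (dF x _)); apply/andP; split; lra.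
Qed.

(** Picone's identity with the weight [p = - c tan (c (x - m))], which solves
    [p' = - c^2 - p^2] on an interval shorter than [pi / c]:
    [(F' - p F)^2 = F'^2 - c^2 F^2 - (p F^2)'], and [p F^2] vanishes at both ends. *)
Lemma picone F f a b c : C1 F f -> a < b -> F a = 0 -> F b = 0 -> 0 < c ->
  c * (b - a) < pi ->
  c ^+ 2 * \int[leb]_(x in `]a, b[) (F x ^+ 2) <= \int[leb]_(x in `]a, b[) (f x ^+ 2).
Proof.
move=> CF ab Fa Fb c0 cab; have cF := C1_continuous CF; have [dF cf] := CF.
pose m := (a + b) / 2.
pose T x := tan (c * (x - m)).
have cos0 x : a <= x <= b -> 0 < cos (c * (x - m)).
  move=> /andP[ax xb]; apply: cos_gt0_pihalf; rewrite /m.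
  have h1 : c * (x - a) >= 0 by rewrite mulr_ge0 ?subr_ge0// ltW.
  have h2 : c * (b - x) >= 0 by rewrite mulr_ge0 ?subr_ge0// ltW.
  have -> : c * (x - (a + b) / 2) = (c * (x - a) - c * (b - x)) / 2 by field.
  have e : c * (x - a) + c * (b - x) = c * (b - a) by ring.
  by apply/andP; split; lra.
pose P x := - c * T x * F x ^+ 2.
pose p x := - c ^+ 2 * (1 + T x ^+ 2) * F x ^+ 2 + - c * T x * (2 * F x * f x).
have dT x : a <= x <= b -> is_derive x (1 : R) T (c * (1 + T x ^+ 2)).
  move=> xab; have cx := cos0 x xab.
  have [dA _] := C1_affine c (- c * m).
  have e : T = tan \o (fun x => c * x + - c * m).
    by apply/funext => y; rewrite /T /=; congr tan; ring.
  have e1 : c * x + - c * m = c * (x - m) by ring.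
  have dt : is_derive (c * x + - c * m) (1 : R) tan ((cos (c * (x - m))) ^- 2).
    by rewrite e1; apply: is_derive_tan; exact: lt0r_neq0.
  have := @is_derive1_comp R tan (fun x => c * x + - c * m) x _ _ dt (dA x).
  rewrite -e => h; apply: (is_derive_eq h) => {h}.
  rewrite /T /tan mulrC; congr (_ * _).
  have := cos2Dsin2 (c * (x - m)); have cn := lt0r_neq0 cx.
  move=> h; apply: (mulIf (expf_neq0 2 cn)); rewrite mulVf ?expf_neq0//.
  by rewrite mulrDl mul1r -exprMn divfK// h.
have dP x : a <= x <= b -> is_derive x (1 : R) P (p x).
  move=> xab.
  have d2 : is_derive x (1 : R) (fun x => F x * F x) (f x * F x + F x * f x).
    by have [] := C1M CF CF; move=> /(_ x).
  have := is_deriveM (is_deriveZ (- c) (dT x xab)) d2.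
  have -> : P = (- c \*: T) * (fun x => F x * F x).
    by apply/funext => y; rewrite /P expr2.
  move=> h; apply: (is_derive_eq h); rewrite /p /=.
  rewrite -![_ *: _]/(_ * _); ring.
have cp : {within `[a, b], continuous p}.
  apply: continuous_in_subspaceT => x; rewrite mem_setE in_itv/= => xab.
  have cT : {for x, continuous T}.
    apply: differentiable_continuous; apply/derivable1_diffP.
    exact: (@ex_derive _ _ _ _ _ _ _ (dT x xab)).
  have cc (k : R) : {for x, continuous (fun=> k)} by exact: cst_continuous.
  rewrite /p; apply: cvgD; apply: cvgM.
  - apply: cvgM; first exact: cvg_cst.
    by apply: cvgD; [exact: cvg_cst|rewrite !expr2; apply: cvgM].
  - by rewrite !expr2; apply: cvgM; exact: cF.
  - by apply: cvgM; [exact: cvg_cst|].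
  - by apply: cvgM; [apply: cvgM; [exact: cvg_cst|exact: cF]|exact: cf].
have := local_FTC ab dP cp; rewrite /P Fa Fb expr0n/= !mulr0 subrr => ip0.
have cF2 : continuous (fun x => F x ^+ 2).
  by under eq_fun do rewrite expr2; exact: continuousM_fun.
have cf2 : continuous (fun x => f x ^+ 2).
  by under eq_fun do rewrite expr2; exact: continuousM_fun.
have iF := continuous_integrable_itvoo a b cF2.
have iF' := continuous_integrable_itvoo a b cf2.
have ip : leb.-integrable `]a, b[ (EFin \o p).
  apply: (@integrableS _ _ _ leb `[a, b]) => //; first exact: subset_itv_oo_cc.
  by apply: continuous_compact_integrable => //; exact: segment_compact.
have -> : \int[leb]_(x in `]a, b[) (f x ^+ 2) =
    \int[leb]_(x in `]a, b[) (f x ^+ 2 - p x) by rewrite RintegralB// ip0 subr0.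
rewrite -RintegralZl//.
apply: le_Rintegral => //; [exact: integrable_scale|exact: integrable_sub|].
move=> x _; rewrite -subr_ge0.
have -> : f x ^+ 2 - p x - c ^+ 2 * F x ^+ 2 = (f x + c * T x * F x) ^+ 2.
  by rewrite /p; ring.
exact: sqr_ge0.
Qed.

(** The limit of Picone's inequality as [c] increases to [pi / (b - a)]. *)
Lemma poincare_interval F f a b : C1 F f -> a < b -> F a = 0 -> F b = 0 ->
  (pi / (b - a)) ^+ 2 * \int[leb]_(x in `]a, b[) (F x ^+ 2) <=
  \int[leb]_(x in `]a, b[) (f x ^+ 2).
Proof.
move=> CF ab Fa Fb.
set A := \int[leb]_(x in _) (F x ^+ 2); set B := \int[leb]_(x in _) (f x ^+ 2).
have B0 : 0 <= B by apply: Rintegral_ge0 => x _; exact: sqr_ge0.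
have l0 : 0 < b - a by rewrite subr_gt0.
set K := _ * A; rewrite leNgt; apply/negP => BK.
have K0 : 0 < K by exact: le_lt_trans BK.
have u1 : B / K < 1 by rewrite ltr_pdivrMr// mul1r.
have u0 : 0 <= B / K by rewrite divr_ge0// ltW.
(* the mean of 1 and the ratio B/K: its square still exceeds the ratio *)
pose t := (1 + B / K) / 2.
have := @picone F f a b (t * (pi / (b - a))) CF ab Fa Fb.
have pi0 := @pi_gt0 R.
have t0 : 0 < t by rewrite /t; lra.
have t1 : t < 1 by rewrite /t; lra.
have c0 : 0 < t * (pi / (b - a)) by rewrite mulr_gt0// divr_gt0.
have cL : t * (pi / (b - a)) * (b - a) < pi.
  by rewrite -mulrA divfK ?lt0r_neq0// gtr_pMl.
move=> /(_ c0 cL); rewrite -/A -/B exprMn -mulrA -/K leNgt => /negP; apply.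
rewrite -ltr_pdivrMr// -subr_gt0.
have -> : t ^+ 2 - B / K = ((1 - B / K) / 2) ^+ 2 by rewrite /t; field; exact: lt0r_neq0.
by rewrite exprn_gt0// divr_gt0// subr_gt0.
Qed.

Lemma Rintegral_split f a b c : a <= b -> b <= c -> leb.-integrable `]a, c[ (EFin \o f) ->
  \int[leb]_(x in `]a, c[) f x = \int[leb]_(x in `]a, b[) f x + \int[leb]_(x in `]b, c[) f x.
Proof.
rewrite le_eqVlt => /predU1P[<- _ _|ab].
  by rewrite set_itvoo0 Rintegral_set0 add0r.
rewrite le_eqVlt => /predU1P[<- _|bc fi].
  by rewrite set_itvoo0 Rintegral_set0 addr0.
have /= := @Rintegral_itvB R f (BRight a) (BLeft c) b fi.
rewrite !bnd_simp => /(_ (ltW ab) bc) <-.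
rewrite -Rintegral_itv_bndo_bndc ?subrKC//; last first.
  apply: (integrableS _ _ _ fi) => // x /=; rewrite !in_itv/= => /andP[? ?].
  by apply/andP; split; lra.
Qed.

(** The inequality on each of the [M.+1] intervals between consecutive zeros has
    the same constant, so the inequalities can be added. *)
Lemma poincare_zeros F f (M : nat) : C1 F f ->
  (forall j, (j <= M.+1)%N -> F (j%:R / M.+1%:R) = 0) ->
  (M.+1%:R * pi) ^+ 2 * ip F F <= ip f f.
Proof.
move=> CF F0; have cF := C1_continuous CF; have [dF cf] := CF.
have M0 : 0 < M.+1%:R :> R by rewrite ltr0n.
have cF2 : continuous (fun x => F x ^+ 2).
  by under eq_fun do rewrite expr2; exact: continuousM_fun.
have cf2 : continuous (fun x => f x ^+ 2).
  by under eq_fun do rewrite expr2; exact: continuousM_fun.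
have key m : (m <= M.+1)%N ->
    (M.+1%:R * pi) ^+ 2 * \int[leb]_(x in `]0, (m%:R / M.+1%:R)[) (F x ^+ 2) <=
    \int[leb]_(x in `]0, (m%:R / M.+1%:R)[) (f x ^+ 2).
  elim: m => [_|m IH mM].
    by rewrite mul0r set_itvoo0// !Rintegral_set0 mulr0.
  have mm : m%:R / M.+1%:R < m.+1%:R / M.+1%:R :> R.
    by rewrite ltr_pM2r ?invr_gt0// ltr_nat.
  have m0 : 0 <= m%:R / M.+1%:R :> R by rewrite divr_ge0.
  have split_at g : continuous g ->
      \int[leb]_(x in `]0, (m.+1%:R / M.+1%:R)[) g x =
      \int[leb]_(x in `]0, (m%:R / M.+1%:R)[) g x +
      \int[leb]_(x in `](m%:R / M.+1%:R), (m.+1%:R / M.+1%:R)[) g x.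
    move=> cg; apply: Rintegral_split => //; first exact: ltW.
    exact: continuous_integrable_itvoo.
  rewrite (split_at _ cF2) (split_at _ cf2) mulrDr lerD ?IH ?(ltnW mM)//.
  have := poincare_interval CF mm (F0 _ (ltnW mM)) (F0 _ mM).
  have -> : pi / (m.+1%:R / M.+1%:R - m%:R / M.+1%:R) = M.+1%:R * pi :> R.
    rewrite -mulrBl -natrB// subSnn div1r invrK mulrC//.
  by [].
by have := key M.+1 (leqnn _); rewrite divff ?lt0r_neq0.
Qed.

End PoincareZeros.

(** * Completeness of the sine system, with sharp constants *)

Section Sines.
Variable R : realType.
Implicit Types (f g h F G : R -> R) (b : nat -> R) (j k M : nat).

(** The modes are numbered from 0 here: mode [k] has [k.+1] half waves. *)
Definition freq k : R := k.+1%:R * pi.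
Definition ev k : R := freq k ^+ 2.
Definition sine k (x : R) : R := Num.sqrt 2 * sin (freq k * x).
Definition dsine k (x : R) : R := Num.sqrt 2 * (freq k * cos (freq k * x)).

Lemma freq_gt0 k : 0 < freq k.
Proof. by rewrite mulr_gt0// ?ltr0n// pi_gt0. Qed.

Lemma ev_gt0 k : 0 < ev k.
Proof. by rewrite exprn_gt0// freq_gt0. Qed.

Lemma ev_lt j k : (j < k)%N -> ev j < ev k.
Proof.
move=> jk; rewrite ltrXn2r// ?nnegrE ?ltW ?freq_gt0//.
by rewrite ltr_pM2r ?pi_gt0// ltr_nat.
Qed.

Lemma ev_le j k : (j <= k)%N -> ev j <= ev k.
Proof. by rewrite leq_eqVlt => /predU1P[->//|/ev_lt/ltW]. Qed.

Lemma ev_inj : injective ev.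
Proof.
move=> j k e; apply/eqP; rewrite eqn_leq.
by apply/andP; split; rewrite leqNgt; apply/negP => /ev_lt; rewrite e ltxx.
Qed.

Lemma ev_ge4 k : 4 <= ev k.
Proof.
rewrite (le_trans _ (ev_le (leq0n k)))// /ev /freq mul1r.
by have := @pi_ge2 R; nra.
Qed.

Lemma ev_ge_nat k : k%:R <= ev k.
Proof.
rewrite /ev /freq exprMn; have p2 := @pi_ge2 R.
have k0 : 0 <= k%:R :> R by [].
have q : 1 <= pi ^+ 2 :> R by rewrite expr_ge1//; lra.
have k1 : k%:R <= k.+1%:R ^+ 2 :> R by rewrite -natr1; nra.
by apply: (le_trans k1); rewrite ler_peMr// sqr_ge0.
Qed.

Lemma sine_C1 k : C1 (sine k) (dsine k).
Proof.
have Csin : C1 (@sin R) cos by split; [exact: is_derive_sin|exact: continuous_cos].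
have := C1Z (Num.sqrt 2) (C1_comp Csin (C1_affine (freq k) 0)).
congr C1; apply/funext => x; rewrite addr0//.
by rewrite /dsine [cos _ * _]mulrC.
Qed.

Lemma dsine_C1 k : C1 (dsine k) (fun x => - ev k * sine k x).
Proof.
have Ccos : C1 (@cos R) (fun x => - sin x).
  split; first exact: is_derive_cos.
  by move=> x; apply: cvgN; exact: continuous_sin.
have := C1Z (Num.sqrt 2) (C1Z (freq k) (C1_comp Ccos (C1_affine (freq k) 0))).
congr C1; apply/funext => x; rewrite addr0// /ev /sine; ring.
Qed.

Lemma sin_natmul_pi (n : nat) : sin (n%:R * pi) = 0 :> R.
Proof.
elim: n => [|n IH]; first by rewrite mul0r sin0.
by rewrite -natr1 mulrDl mul1r sinDpi IH oppr0.
Qed.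

Lemma sine_at0 k : sine k 0 = 0.
Proof. by rewrite /sine mulr0 sin0 mulr0. Qed.

Lemma sine_at1 k : sine k 1 = 0.
Proof. by rewrite /sine mulr1 sin_natmul_pi mulr0. Qed.

Lemma sine_pair k : H01_pair (sine k) (dsine k).
Proof. exact: (C1_H01_pair (sine_C1 k) (sine_at0 k) (sine_at1 k)). Qed.

Lemma sine_L2 k : L2 (sine k).
Proof. by case: (sine_pair k). Qed.

Lemma dsine_L2 k : L2 (dsine k).
Proof. by case: (sine_pair k). Qed.
Hint Resolve sine_L2 dsine_L2 : core.

Lemma ip_dsine f g k : H01_pair f g -> ip g (dsine k) = ev k * ip f (sine k).
Proof.
move=> Hfg; have [Lf Lg _] := Hfg.
have Lk : L2 (fun x => - ev k * sine k x) by exact: L2Z.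
have := H01_pair_IBP Hfg (dsine_L2 k) Lk (C1_weak_deriv (dsine_C1 k)).
by rewrite ipZr// => h; rewrite -[LHS]opprK -h mulNr opprK.
Qed.

Lemma ip_sine_second f g h k : H01_pair f g -> L2 h -> weak_deriv g h ->
  ip h (sine k) = - ev k * ip f (sine k).
Proof.
move=> Hfg Lh gh; have [Lf Lg _] := Hfg.
by rewrite ipC (H01_pair_IBP (sine_pair k) Lg Lh gh) ipC (ip_dsine _ Hfg) mulNr.
Qed.

(** The square of the sine has the antiderivative [x - s s' / (2 freq^2)], by
    [cos^2 + sin^2 = 1]. *)
Lemma sine_norm k : ip (sine k) (sine k) = 1.
Proof.
have Cn : C1 (fun x => x - (2 * freq k ^+ 2)^-1 * (sine k x * dsine k x))
    (fun x => sine k x * sine k x).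
  have Cid : C1 (fun x : R => x) (fun=> 1).
    have := C1_affine (1 : R) 0.
    by congr C1; apply/funext => x; rewrite mul1r addr0.
  have := C1B Cid (C1Z (2 * freq k ^+ 2)^-1 (C1M (sine_C1 k) (dsine_C1 k))).
  congr C1; apply/funext => x; rewrite /sine /dsine /ev.
  have s2 : Num.sqrt 2 ^+ 2 = 2 :> R by rewrite sqr_sqrtr.
  have cs := cos2Dsin2 (freq k * x); have f0 := lt0r_neq0 (freq_gt0 k).
  set s := sin _ in cs *; set c := cos _ in cs *; set q := Num.sqrt 2 in s2 *.
  have -> : 1 - (2 * freq k ^+ 2)^-1 * (q * (freq k * c) * (q * (freq k * c)) +
      q * s * (- freq k ^+ 2 * (q * s))) = 1 - 2^-1 * q ^+ 2 * (c ^+ 2 - s ^+ 2).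
    by field.
  have -> : q * s * (q * s) = q ^+ 2 * s ^+ 2 by ring.
  by rewrite s2 (_ : c ^+ 2 = 1 - s ^+ 2); [field|rewrite -cs addrK].
rewrite /ip (C1_FTC ler01 Cn) sine_at0 sine_at1; ring.
Qed.

Lemma sine_orthonormal j k : ip (sine j) (sine k) = (j == k)%:R.
Proof.
have [->|jk] := eqVneq j k; first exact: sine_norm.
have h1 := ip_dsine k (sine_pair j); have h2 := ip_dsine j (sine_pair k).
rewrite ipC h1 ipC in h2.
have : (ev k - ev j) * ip (sine j) (sine k) = 0.
  by rewrite mulrBl (ipC (sine j)) h2 subrr.
move/eqP; rewrite mulf_eq0 subr_eq0 => /orP[/eqP/ev_inj e|/eqP//].
by rewrite e eqxx in jk.
Qed.

Lemma dsine_orthogonal j k : ip (dsine j) (dsine k) = ev k * (j == k)%:R.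
Proof. by rewrite (ip_dsine k (sine_pair j)) sine_orthonormal. Qed.

Definition sine_sum M (b : nat -> R) (x : R) : R := \sum_(k < M) b k * sine k x.
Definition dsine_sum M (b : nat -> R) (x : R) : R := \sum_(k < M) b k * dsine k x.

Lemma sine_sum_C1 M b : C1 (sine_sum M b) (dsine_sum M b).
Proof. by apply: C1_sum => k; apply: C1Z; exact: sine_C1. Qed.

Lemma sine_sum_L2 M b : L2 (sine_sum M b).
Proof. by apply: L2_sum => k; exact: L2Z. Qed.

Lemma dsine_sum_L2 M b : L2 (dsine_sum M b).
Proof. by apply: L2_sum => k; exact: L2Z. Qed.
Hint Resolve sine_sum_L2 dsine_sum_L2 : core.

Lemma ip_sine_sum M b f : L2 f -> ip f (sine_sum M b) = \sum_(k < M) b k * ip f (sine k).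
Proof.
move=> Lf; rewrite ip_sumr//; last by move=> k; exact: L2Z.
by apply: eq_bigr => k _; rewrite ipZr.
Qed.

Lemma ip_dsine_sum M b f : L2 f -> ip f (dsine_sum M b) = \sum_(k < M) b k * ip f (dsine k).
Proof.
move=> Lf; rewrite ip_sumr//; last by move=> k; exact: L2Z.
by apply: eq_bigr => k _; rewrite ipZr.
Qed.

Lemma sum_kronecker M (b : nat -> R) (k : 'I_M) : \sum_(j < M) b j * (k == j :> nat)%:R = b k.
Proof.
rewrite (bigD1 k)//= eqxx mulr1 big1 ?addr0// => j jk.
by rewrite eq_sym -val_eqE in jk; rewrite (negbTE jk) mulr0.
Qed.

Lemma ip_sine_sum_sqr M b : ip (sine_sum M b) (sine_sum M b) = \sum_(k < M) b k ^+ 2.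
Proof.
rewrite ip_sine_sum//; apply: eq_bigr => k _.
rewrite ipC ip_sine_sum// expr2; congr (_ * _).
under eq_bigr do rewrite sine_orthonormal.
exact: sum_kronecker.
Qed.

Lemma ip_dsine_sum_sqr M b :
  ip (dsine_sum M b) (dsine_sum M b) = \sum_(k < M) ev k * b k ^+ 2.
Proof.
rewrite ip_dsine_sum//; apply: eq_bigr => k _.
rewrite ipC ip_dsine_sum//.
under eq_bigr do rewrite dsine_orthogonal mulrA.
have -> : \sum_(j < M) b j * ev j * (k == j :> nat)%:R = b k * ev k.
  exact: (sum_kronecker (fun j => b j * ev j)).
ring.
Qed.

(** A sine sum of [M] modes vanishing at the [M] points [j / M.+1] satisfies the
    Poincare inequality with the constant of mode [M], although all its
    frequencies are lower; hence it vanishes. *)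
Lemma sine_sum_zeros M b : (forall j : 'I_M, sine_sum M b (j.+1%:R / M.+1%:R) = 0) ->
  forall k : 'I_M, b k = 0.
Proof.
move=> b0.
have z0 : sine_sum M b 0 = 0.
  by rewrite /sine_sum big1// => k _; rewrite sine_at0 mulr0.
have z1 : sine_sum M b 1 = 0.
  by rewrite /sine_sum big1// => k _; rewrite sine_at1 mulr0.
have zj j : (j <= M.+1)%N -> sine_sum M b (j%:R / M.+1%:R) = 0.
  case: j => [_|j]; first by rewrite mul0r.
  rewrite leq_eqVlt => /predU1P[[->]|jM]; first by rewrite divff ?pnatr_eq0.
  exact: (b0 (Ordinal (jM : (j < M)%N))).
have := poincare_zeros (sine_sum_C1 M b) zj.
rewrite ip_sine_sum_sqr ip_dsine_sum_sqr -/(freq M) -/(ev M) mulr_sumr -subr_le0 -sumrB => h.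
have pos (k : 'I_M) : true -> 0 <= ev M * b k ^+ 2 - ev k * b k ^+ 2.
  by move=> _; rewrite -mulrBl mulr_ge0 ?sqr_ge0// subr_ge0 ev_le// ltnW.
have s0 : \sum_(k < M) (ev M * b k ^+ 2 - ev k * b k ^+ 2) = 0.
  by apply/eqP; rewrite eq_le h sumr_ge0.
move=> k; have := psumr_eq0P pos s0 (i := k) isT.
move/eqP; rewrite -mulrBl mulf_eq0 subr_eq0 sqrf_eq0 => /orP[/eqP e|/eqP//].
by have := ev_lt (ltn_ord k); rewrite e ltxx.
Qed.

(** A linear map between spaces of equal dimension is onto if it has a trivial
    kernel. *)
Lemma sine_interpolation M (y : nat -> R) : exists b : nat -> R,
  forall j : 'I_M, sine_sum M b (j.+1%:R / M.+1%:R) = y j.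
Proof.
pose A : 'M[R]_M := \matrix_(k, j) sine k (j.+1%:R / M.+1%:R).
pose coef (u : 'rV[R]_M) (k : nat) := if insub k is Some i then u ord0 i else 0.
have coefE (u : 'rV[R]_M) (k : 'I_M) : coef u k = u ord0 k by rewrite /coef valK.
have valA (u : 'rV[R]_M) (j : 'I_M) :
    (u *m A) ord0 j = sine_sum M (coef u) (j.+1%:R / M.+1%:R).
  by rewrite mxE; apply: eq_bigr => k _; rewrite coefE !mxE.
have : A \in unitmx.
  rewrite -row_free_unit -kermx_eq0; apply/eqP/row_matrixP => i; rewrite row0.
  have uA0 : row i (kermx A) *m A = 0 by rewrite -row_mul mulmx_ker row0.
  apply/rowP => k; rewrite [RHS]mxE -coefE.
  by apply: sine_sum_zeros => j; rewrite -valA uA0 mxE.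
move=> uA; pose u := (\row_j y j) *m invmx A.
by exists (coef u) => j; rewrite -valA mulmxKV// mxE.
Qed.

(** Adding an interpolating sine sum [s] makes [F + s] vanish at the points
    [j / M.+1], so that [F + s] satisfies the Poincare inequality with the
    constant [ev M]. Expanding it in the coefficients of [s] and completing the
    squares gives the inequality for [F]. *)
Lemma spectral_gap_C1 M F f : C1 F f -> F 0 = 0 -> F 1 = 0 ->
  ev M * ip F F - \sum_(k < M) (ev M - ev k) * ip F (sine k) ^+ 2 <= ip f f.
Proof.
move=> CF F0 F1; have [b bP] := sine_interpolation M (fun j => - F (j.+1%:R / M.+1%:R)).
have HF := C1_H01_pair CF F0 F1; have [LF Lf _] := HF.
have CS := C1D CF (sine_sum_C1 M b).
have zj j : (j <= M.+1)%N -> F (j%:R / M.+1%:R) + sine_sum M b (j%:R / M.+1%:R) = 0.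
  case: j => [_|j].
    by rewrite mul0r F0 /sine_sum big1 ?addr0// => k _; rewrite sine_at0 mulr0.
  rewrite leq_eqVlt => /predU1P[[->]|jM].
    rewrite divff ?pnatr_eq0// F1 /sine_sum big1 ?addr0// => k _.
    by rewrite sine_at1 mulr0.
  by rewrite (bP (Ordinal (jM : (j < M)%N))) subrr.
have := poincare_zeros CS zj.
rewrite (ip_sqrD LF (sine_sum_L2 M b)) (ip_sqrD Lf (dsine_sum_L2 M b)).
rewrite ip_sine_sum_sqr ip_dsine_sum_sqr ip_sine_sum// ip_dsine_sum//.
rewrite -/(freq M) -/(ev M).
under [X in _ <= _ + 2 * X + _ -> _]eq_bigr do rewrite (ip_dsine _ HF).
move=> main.
have sq : 0 <= \sum_(k < M) (ev M - ev k) * (b k + ip F (sine k)) ^+ 2.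
  apply: sumr_ge0 => k _; rewrite mulr_ge0 ?sqr_ge0// subr_ge0 ev_le// ltnW//.
have e : \sum_(k < M) (ev M - ev k) * (b k + ip F (sine k)) ^+ 2 =
  \sum_(k < M) (ev M - ev k) * ip F (sine k) ^+ 2 +
  2 * (ev M * \sum_(k < M) b k * ip F (sine k) -
       \sum_(k < M) b k * (ev k * ip F (sine k))) +
  (ev M * (\sum_(k < M) b k ^+ 2) - \sum_(k < M) ev k * b k ^+ 2).
  rewrite !mulr_sumr -!sumrB mulr_sumr -!big_split /=.
  by apply: eq_bigr => k _; ring.
rewrite e in sq; lra.
Qed.

Lemma cvg_fin_sum (I : Type) (s : seq I) (u : I -> nat -> R) (l : I -> R) :
  (forall i, u i n @[n --> \oo] --> l i) ->
  \sum_(i <- s) u i n @[n --> \oo] --> \sum_(i <- s) l i.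
Proof.
move=> ul; elim: s => [|i s IH].
  by apply: (@eq_cvg_seq _ _ (fun=> 0)) => [n|]; rewrite big_nil//; exact: cvg_cst.
rewrite big_cons; apply: (@eq_cvg_seq _ _ (fun n => u i n + \sum_(j <- s) u j n)).
  by move=> n; rewrite big_cons.
exact: cvgD.
Qed.

Lemma spectral_gap M f g : H01_pair f g ->
  ev M * ip f f - \sum_(k < M) (ev M - ev k) * ip f (sine k) ^+ 2 <= ip g g.
Proof.
move=> [Lf Lg [phi_ [tphi cf cg]]].
have Lphi n := test_fun_L2 (tphi n); have Ldphi n := test_fun_derive_L2 (tphi n).
apply: (@ler_cvg_to nat \oo _ R
  (fun n => ev M * ip (phi_ n) (phi_ n) -
    \sum_(k < M) (ev M - ev k) * ip (phi_ n) (sine k) ^+ 2)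
  (fun n => ip (derive1 (phi_ n)) (derive1 (phi_ n)))).
- apply: cvgB; first by apply: cvgM; [exact: cvg_cst|exact: ip_sqr_cvg].
  apply: cvg_fin_sum => k; apply: cvgM; first exact: cvg_cst.
  by apply: cvgM; exact: ip_cvgl.
- exact: ip_sqr_cvg.
- apply: nearW => n; apply: spectral_gap_C1; first exact: (test_fun_C1 (tphi n)).
    by apply: (test_fun_out (tphi n)); left.
  by apply: (test_fun_out (tphi n)); right.
Qed.

Lemma poincare f g : H01_pair f g -> ev 0 * ip f f <= ip g g.
Proof. by move=> /(spectral_gap 0); rewrite big_ord0 subr0. Qed.

Lemma ip_residual M f : L2 f ->
  ip (f \- sine_sum M (fun k => ip f (sine k))) (f \- sine_sum M (fun k => ip f (sine k))) =
  ip f f - \sum_(k < M) ip f (sine k) ^+ 2.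
Proof.
move=> Lf; set s := sine_sum _ _.
have Ls : L2 s by exact: sine_sum_L2.
rewrite ipBl ?ipBr//; last exact: L2B.
rewrite (ipC s f) ip_sine_sum_sqr ip_sine_sum//.
under [X in _ - X - _]eq_bigr do rewrite -expr2.
ring.
Qed.

(** The terms of [spectral_gap] with the factor [ev M] combine to the squared
    norm of the component of [f] in the high modes. *)
Lemma bessel_derivative M f g : H01_pair f g ->
  \sum_(k < M) ev k * ip f (sine k) ^+ 2 <= ip g g.
Proof.
move=> Hfg; have [Lf _ _] := Hfg; apply: le_trans (spectral_gap M Hfg).
have := ip_ge0 (f \- sine_sum M (fun k => ip f (sine k))); rewrite ip_residual// => r0.
have -> : \sum_(k < M) (ev M - ev k) * ip f (sine k) ^+ 2 =
    ev M * (\sum_(k < M) ip f (sine k) ^+ 2) - \sum_(k < M) ev k * ip f (sine k) ^+ 2.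
  by rewrite mulr_sumr -sumrB; apply: eq_bigr => k _; ring.
by have := mulr_ge0 (ltW (ev_gt0 M)) r0; rewrite mulrBr; lra.
Qed.

(** Let [r] be the component of [f] in the high modes and [D] the left-hand side.
    Then [ev M * |r|^2 <= D] by the spectral gap, and [D = - (r, h)] by
    integration by parts; the Cauchy-Schwarz inequality concludes. *)
Lemma energy_tail M f g h : H01_pair f g -> L2 h -> weak_deriv g h ->
  ip g g - \sum_(k < M) ev k * ip f (sine k) ^+ 2 <= ip h h / ev M.
Proof.
move=> Hfg Lh gh; have [Lf Lg _] := Hfg.
set D := _ - _; pose r := f \- sine_sum M (fun k => ip f (sine k)).
have Lr : L2 r by apply: L2B.
have rr : ip r r = ip f f - \sum_(k < M) ip f (sine k) ^+ 2 by exact: ip_residual.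
have gap : ev M * ip r r <= D.
  have := spectral_gap M Hfg; rewrite rr /D.
  have -> : \sum_(k < M) (ev M - ev k) * ip f (sine k) ^+ 2 =
      ev M * (\sum_(k < M) ip f (sine k) ^+ 2) - \sum_(k < M) ev k * ip f (sine k) ^+ 2.
    by rewrite mulr_sumr -sumrB; apply: eq_bigr => k _; ring.
  lra.
have Dr : D = - ip r h.
  rewrite /r ipBl// (H01_pair_IBP Hfg Lg Lh gh) (ipC _ h) ip_sine_sum//.
  rewrite opprB opprK addrC /D; congr (_ + _).
  rewrite -sumrN; apply: eq_bigr => k _.
  by rewrite (ip_sine_second k Hfg Lh gh); ring.
have cs := ip_CS_sqr Lr Lh.
have e0 := ev_gt0 M; have r0 := ip_ge0 r; have h0 := ip_ge0 h.
rewrite ler_pdivlMr//.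
have D0 : 0 <= D by apply: le_trans gap; rewrite mulr_ge0// ltW.
have D2 : D ^+ 2 <= ip r r * ip h h by rewrite Dr sqrrN.
have [->|Dn] := eqVneq D 0; first by rewrite mul0r.
have Dp : 0 < D by rewrite lt_neqAle eq_sym Dn.
rewrite -(ler_pM2l Dp) mulrA -expr2.
apply: (@le_trans _ _ (ev M * ip r r * ip h h)).
  by rewrite mulrC -mulrA ler_wpM2l// ltW.
by rewrite ler_wpM2r.
Qed.

End Sines.

Section Completeness.
Variable R : realType.
Local Notation leb := (@lebesgue_measure R).
Local Notation ev := (@ev R).
Local Notation sine := (@sine R).
Local Notation dsine := (@dsine R).
Local Notation L2_sine := (@sine_L2 R).
Implicit Types (f g h F G : R -> R) (b : nat -> R) (j k M : nat).

Definition sine_energy M f : R := \sum_(k < M) ev k * ip f (sine k) ^+ 2.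

Lemma sine_energy_ge0 M f : 0 <= sine_energy M f.
Proof. by apply: sumr_ge0 => k _; rewrite mulr_ge0 ?sqr_ge0// ltW// ev_gt0. Qed.

Lemma sine_energy_le f M M' : (M <= M')%N -> sine_energy M f <= sine_energy M' f.
Proof.
elim: M' => [|M' IH]; first by rewrite leqn0 => /eqP ->.
rewrite leq_eqVlt => /predU1P[->//|]; rewrite ltnS => /IH/le_trans; apply.
rewrite /sine_energy big_ord_recr /= lerDl mulr_ge0 ?sqr_ge0//.
Qed.

(** How estimates with a truncation error are passed to the limit. *)
Lemma le_of_div_ev (x y C : R) : 0 <= C -> (forall M, x <= y + C / ev M) -> x <= y.
Proof.
move=> C0 xy; apply/ler_addgt0Pr => e e0.
have Ce : 0 <= C / e by rewrite divr_ge0// ltW.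
pose M := Num.bound (C / e).
apply: (le_trans (xy M)); rewrite lerD2l ler_pdivrMr ?ev_gt0//.
rewrite mulrC -ler_pdivrMr//; apply: le_trans (ev_ge_nat R M).
by apply: ltW; exact: archi_boundP.
Qed.

Lemma continuous_antiderivative f : continuous f ->
  (forall x, x \notin `[0, 1] -> f x = 0) -> exists F, C1 F f.
Proof.
move=> cf f0.
have fi (D : set R) : measurable D -> leb.-integrable D (EFin \o f).
  move=> mD; apply: (@integrableS _ _ _ leb setT D) => //.
  have -> : EFin \o f = (EFin \o f) \_ `[0, 1].
    apply/funext => x; rewrite patchE mem_setE; case: ifPn => // xn.
    by rewrite /= f0.
  by apply: (@integrable_mkcond _ _ _ leb _ (EFin \o f) (measurable_itv _)).1;
    exact: continuous_integrable_itv.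
exists (fun x => \int[leb]_(t in `]-oo, x]) f t); split=> [x|//].
have x1 : x < x + 1 by rewrite ltrDl.
have [dF F'] := @continuous_FTC1 R f -oo%O x _ x1 (fi _ (measurable_itv _)) (ltNyr x) (cf x).
by apply: DeriveDef; [exact: dF|rewrite -derive1E].
Qed.

(** Averaging a test function over short intervals (Steklov) makes it twice
    differentiable and hardly changes its derivative. *)
Lemma steklov_approx phi (e : R) : test_fun 0 1 phi -> 0 < e ->
  exists F G H, [/\ H01_pair F G, L2 H, weak_deriv G H & l2norm (derive1 phi \- G) < e].
Proof.
move=> tphi e0; have CP := test_fun_C1 tphi; have [dphi cdphi] := CP.
have cphi := C1_continuous CP.
have [_ _ [c [d [c0 d1 phi0]]]] := tphi.
have [Phi CT] : exists F, C1 F phi.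
  apply: continuous_antiderivative => // x xn; apply: phi0.
  by apply: contra xn; rewrite !in_itv/= => /andP[? ?]; apply/andP; split; lra.
pose c' := Num.min c 1.
have c'0 : 0 < c' by rewrite lt_min c0 ltr01.
have c'c : c' <= c by rewrite ge_min lexx.
have c'1 : c' <= 1 by rewrite ge_min lexx orbT.
pose h_ n : R := c' / (n + 2)%:R.
have h0 n : 0 < h_ n by rewrite divr_gt0// ltr0n addn2.
have hc n : h_ n < c' by rewrite ltr_pdivrMr ?ltr0n ?addn2// ltr_pMr// ltr1n.
have hcv : h_ n @[n --> \oo] --> (0 : R) by exact: cvg_div_nat.
have steklov F f n : C1 F f ->
    C1 (fun x => (h_ n)^-1 * (F (x + h_ n) - F x)) (fun x => (h_ n)^-1 * (f (x + h_ n) - f x)).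
  move=> CF; apply: C1Z; apply: C1B => //.
  have := C1_comp CF (C1_affine 1 (h_ n)).
  by congr C1; apply/funext => x; rewrite mul1r ?mulr1.
pose F_ n x := (h_ n)^-1 * (Phi (x + h_ n) - Phi x).
pose G_ n x := (h_ n)^-1 * (phi (x + h_ n) - phi x).
pose H_ n x := (h_ n)^-1 * (derive1 phi (x + h_ n) - derive1 phi x).
have CF n : C1 (F_ n) (G_ n) by exact: steklov.
have CG n : C1 (G_ n) (H_ n) by exact: steklov.
have vanish n x : (x = 0 \/ x = 1) -> F_ n x = 0.
  move=> x01; have xh : x <= x + h_ n by rewrite lerDl ltW.
  rewrite /F_ -(C1_FTC xh CT); apply/eqP; rewrite mulf_eq0; apply/orP; right.
  have -> : \int[leb]_(t in `]x, (x + h_ n)[) phi t = \int[leb]_(t in `]x, (x + h_ n)[) (0 : R).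
    apply: eq_Rintegral => t; rewrite mem_setE in_itv/= => /andP[xt tx].
    apply: phi0; rewrite in_itv/=; apply/negP => /andP[? ?].
    by have := hc n; case: x01 => ?; subst x; lra.
  by rewrite Rintegral_cst// mul0r.
have cv : l2norm (derive1 phi \- G_ n) @[n --> \oo] --> (0 : R).
  have [K K0 phiK] := continuous_bounded 0 2 cdphi.
  have d0 : 0 < 1 - d by rewrite subr_gt0.
  apply: (@l2norm_cvg0_bounded _ _ (K + K)) => [n|n x|x].
  - apply: continuous_measurable => // x.
    by apply: cvgB; [exact: cdphi|exact: (C1_continuous (CG n))].
  - rewrite /= in_itv/= => /andP[x0 x1].
    apply: (le_trans (ler_normB _ _)); apply: lerD.
      by apply: phiK; apply/andP; split; lra.
    have xh : x <= x + h_ n by rewrite lerDl ltW.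
    have [|t] := @MVT_segment R phi (derive1 phi) x (x + h_ n) xh (fun t _ => dphi t).
      exact: continuous_subspaceT.
    rewrite in_itv/= => /andP[xt tx]; rewrite /G_ => ->.
    rewrite [x + h_ n - x](_ : _ = h_ n); last by ring.
    rewrite mulrC mulfK ?lt0r_neq0//; apply: phiK; apply/andP; split; first lra.
    by have := hc n; lra.
  - move=> _; apply/cvgrPdist_le => eps eps0.
    have /cvgrPdist_le/(_ _ eps0) [eta /= eta0 near0] :
        {for x, continuous (derive1 phi)} by exact: cdphi.
    have : \forall n \near \oo, h_ n < eta.
      move/cvgrPdist_lt : hcv => /(_ _ eta0); apply: filterS => n.
      by rewrite distrC subr0 gtr0_norm.
    apply: filterS => n hn; rewrite sub0r normrN /=.
    have xh : x <= x + h_ n by rewrite lerDl ltW.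
    have [|t] := @MVT_segment R phi (derive1 phi) x (x + h_ n) xh (fun t _ => dphi t).
      exact: continuous_subspaceT.
    rewrite in_itv/= => /andP[xt tx]; rewrite /G_ => ->.
    rewrite [x + h_ n - x](_ : _ = h_ n); last by ring.
    rewrite [(h_ n)^-1 * _]mulrC mulfK ?lt0r_neq0//; apply: near0.
    by rewrite /ball_ /= ltr_norml; apply/andP; split; have := h0 n; lra.
move/cvgrPdist_lt : cv => /(_ _ e0) [n _ /(_ n (leqnn n)) en].
exists (F_ n), (G_ n), (H_ n); split.
- by apply: C1_H01_pair => //; apply: vanish; [left|right].
- by apply: continuous_L2; case: (CG n).
- exact: C1_weak_deriv.
- by move: en; rewrite /= sub0r normrN ger0_norm ?l2norm_ge0.
Qed.

Lemma sine_energy_norm M f : sine_energy M f =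
  l2norm (dsine_sum M (fun k => ip f (sine k))) ^+ 2.
Proof. by rewrite l2norm_sqr ip_dsine_sum_sqr. Qed.

(** For a function with a second derivative, [energy_tail] gives Parseval's
    identity for the derivative. A general [f] is close to such a function
    [F], whose truncated energies are bounded by those of [f] and, by Bessel's
    inequality, of the small difference [F - f]. *)
Lemma H01_pair_complete f g (K : R) : 0 <= K -> H01_pair f g ->
  (forall M, sine_energy M f <= K) -> ip g g <= K.
Proof.
move=> K0 Hfg fK; have [Lf Lg [phi_ [tphi _ cg]]] := Hfg.
have : l2norm g <= Num.sqrt K.
  apply/ler_addgt0Pr => e e0.
  have e4 : 0 < e / 4 by rewrite divr_gt0.
  move/cvgrPdist_lt : cg => /(_ _ e4) [n _ /(_ n (leqnn n))].
  rewrite /= sub0r normrN ger0_norm ?l2norm_ge0// => gphi.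
  have [F [G [H [HFG LH GH phiG]]]] := steklov_approx (tphi n) e4.
  have [LF LG _] := HFG; have Lphi := test_fun_derive_L2 (tphi n).
  have gG : l2norm (G \- g) <= e / 2.
    have -> : G \- g = (derive1 (phi_ n) \- g) \- (derive1 (phi_ n) \- G).
      by apply/funext => x /=; ring.
    apply: (le_trans (l2normB (L2B Lphi Lg) (L2B Lphi LG))).
    by rewrite (l2norm_subC _ g); lra.
  have s0 := sqrtr_ge0 K.
  have PF M : l2norm (dsine_sum M (fun k => ip F (sine k))) <= Num.sqrt K + e / 2.
    have -> : dsine_sum M (fun k => ip F (sine k)) =
      dsine_sum M (fun k => ip f (sine k)) \+ dsine_sum M (fun k => ip (F \- f) (sine k)).
      apply/funext => x; rewrite /dsine_sum /= -big_split; apply: eq_bigr => k _ /=.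
      by rewrite -mulrDl ipBl//; [congr (_ * _); ring|exact: L2_sine].
    apply: (le_trans (l2normD (dsine_sum_L2 _ _) (dsine_sum_L2 _ _))); apply: lerD.
      rewrite -(@ler_pXn2r _ 2)// ?nnegrE ?l2norm_ge0// -sine_energy_norm sqr_sqrtr//.
    apply: le_trans gG; rewrite -(@ler_pXn2r _ 2)// ?nnegrE ?l2norm_ge0//.
    rewrite -sine_energy_norm l2norm_sqr; exact: (bessel_derivative M (H01_pairB HFG Hfg)).
  have Gle : ip G G <= (Num.sqrt K + e / 2) ^+ 2.
    apply: (@le_of_div_ev _ _ (ip H H)); first exact: ip_ge0.
    move=> M; have := energy_tail M HFG LH GH.
    rewrite -/(sine_energy M F) sine_energy_norm.
    have : l2norm (dsine_sum M (fun k => ip F (sine k))) ^+ 2 <= (Num.sqrt K + e / 2) ^+ 2.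
      by rewrite lerXn2r ?nnegrE ?l2norm_ge0// addr_ge0// divr_ge0// ltW.
    lra.
  have GN : l2norm G <= Num.sqrt K + e / 2.
    by rewrite -(@ler_pXn2r _ 2)// ?nnegrE ?l2norm_ge0 ?l2norm_sqr// addr_ge0// divr_ge0// ltW.
  have := l2norm_le_dist Lg LG; rewrite l2norm_subC; lra.
move=> h; rewrite -l2norm_sqr -(sqr_sqrtr K0) lerXn2r ?nnegrE ?l2norm_ge0 ?sqrtr_ge0//.
Qed.

Lemma sine_total f g : H01_pair f g -> (forall k, ip f (sine k) = 0) -> ip f f = 0.
Proof.
move=> Hfg f0; apply/eqP; rewrite eq_le ip_ge0 andbT.
apply: (@le_of_div_ev _ _ (ip g g)) => [|M]; first exact: ip_ge0.
rewrite add0r ler_pdivlMr ?ev_gt0// mulrC.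
have := spectral_gap M Hfg; rewrite big1 ?subr0// => k _.
by rewrite f0 expr0n mulr0.
Qed.

(** * Identification of the Dirichlet spectrum *)

Lemma weak_deriv_ae f f' g : L2 f -> L2 f' ->
  {ae leb, forall x, x \in `]0, 1[ -> f x = f' x} -> weak_deriv f g -> weak_deriv f' g.
Proof.
move=> Lf Lf' ff' w phi tphi; rewrite -(w phi tphi).
by symmetry; apply: (ip_eq_ae Lf Lf' (test_fun_derive_L2 tphi)).
Qed.

Lemma sine_eigenfun k : dirichlet_eigenfun (ev k) (sine k).
Proof.
have Hk := sine_pair R k; have H01k := H01_pair_H01 Hk.
have [H1k _] := H01k; have [Ldx wdx] := H1_dx H1k.
have dxk := H01_pair_dx Hk.
have Ls := L2_sine k; have Ld := dsine_L2 R k.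
have Lds : L2 (fun x => - ev k * sine k x) by exact: L2Z.
have w2 : weak_deriv (dx (sine k)) (fun x => - ev k * sine k x).
  apply: (weak_deriv_ae Ld Ldx _ (C1_weak_deriv (dsine_C1 R k))).
  by apply: aeS dxk => x h xI; rewrite h.
have H1d : H1 (dx (sine k)) by split => //; exists (fun x => - ev k * sine k x).
split => //.
- by rewrite /l2norm sine_norm sqrtr1.
- have [Lddx wddx] := H1_dx H1d.
  apply: aeS (weak_deriv_unique Lddx Lds wddx w2) => x h xI.
  by rewrite h// mulNr opprK.
Qed.

(** Testing the eigenvalue equation with each sine leaves a single nonzero
    coefficient. *)
Lemma eigenfun_is_sine (l : R) f : dirichlet_eigenfun l f ->
  exists2 k, l = ev k &
    {ae leb, forall x, x \in `]0, 1[ -> f x = ip f (sine k) * sine k x}.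
Proof.
move=> [[H1f H1df] H01f f0 feq].
have Hf := H01_to_pair H01f; have [Lf Ldx _] := Hf.
have [Lddx wddx] := H1_dx H1df.
have mode k : (l - ev k) * ip f (sine k) = 0.
  have h1 := ip_sine_second k Hf Lddx wddx.
  have h2 : ip (dx (dx f)) (sine k) = - l * ip f (sine k).
    rewrite -ipZl//; last exact: L2_sine.
    apply: ip_eq_ae => //; [exact: L2Z|exact: L2_sine|].
    by apply: aeS feq => x h xI; rewrite -[LHS]opprK h// mulNr.
  rewrite mulrBl; have := h1; rewrite h2 => h; lra.
have [k fk] : exists k, ip f (sine k) != 0.
  apply: contrapT => /forallNP nk.
  have /(sine_total Hf) ff0 : forall k, ip f (sine k) = 0.
    by move=> k; apply/eqP/negPn/negP; exact: nk.
  by move: f0; rewrite /l2norm ff0 sqrtr0 ltxx.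
have lk : l = ev k.
  by have /eqP := mode k; rewrite mulf_eq0 (negbTE fk) orbF subr_eq0 => /eqP.
exists k => //.
pose c := ip f (sine k).
have Hcs : H01_pair (fun x => c * sine k x) (fun x => c * dsine k x).
  apply: C1_H01_pair; first by apply: C1Z; exact: sine_C1.
    by rewrite sine_at0 mulr0.
  by rewrite sine_at1 mulr0.
have [Lcs _ _] := Hcs.
have r0 : ip (f \- (fun x => c * sine k x)) (f \- (fun x => c * sine k x)) = 0.
  apply: (sine_total (H01_pairB Hf Hcs)) => j.
  rewrite ipBl//; last exact: L2_sine.
  rewrite [X in _ - X]ipZl; [|exact: L2_sine|exact: L2_sine].
  rewrite sine_orthonormal; have [<-|kj] := eqVneq k j.
    by rewrite mulr1 subrr.
  rewrite mulr0 subr0; have /eqP := mode j; rewrite mulf_eq0 => /orP[|/eqP//].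
  by rewrite lk subr_eq0 => /eqP/ev_inj e; rewrite e eqxx in kj.
have : l2norm (f \- (fun x => c * sine k x)) = 0 by rewrite /l2norm r0 sqrtr0.
move/(l2norm_eq0_ae (L2B Lf Lcs)).
by apply: aeS => x h xI; apply/eqP; rewrite -subr_eq0; apply/eqP; exact: h.
Qed.

Lemma increasing_surjective_id (m : nat -> nat) :
  (forall j k, (j < k)%N -> (m j < m k)%N) -> (forall k, exists j, m j = k) ->
  forall k, m k = k.
Proof.
move=> mono surj.
have ge k : (k <= m k)%N.
  by elim: k => // k IH; rewrite (leq_ltn_trans IH)// mono.
move=> k; have [n] := ubnP k; elim: n k => // n IH k; rewrite ltnS => kn.
apply/eqP; rewrite eqn_leq ge andbT.
have [j jk] := surj k.
have [kj|jk'] := leqP k j.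
  rewrite -[X in (_ <= X)%N]jk; move: kj; rewrite leq_eqVlt => /predU1P[->//|/mono/ltnW//].
by move: (jk'); rewrite -jk IH ?ltnn// (leq_trans jk').
Qed.

(** The given eigenvalues are an increasing sequence of numbers [ev k] in which
    none of them is missing. *)
Lemma spectrum_eigenvalue (lam : nat -> R) (w : nat -> R -> R) :
  dirichlet_spectrum lam w -> forall k, lam k.+1 = ev k.
Proof.
move=> hw.
have ex k : exists m, lam k.+1 = ev m.
  by have [m] := eigenfun_is_sine (ds_eigen hw (ltn0Sn k)); exists m.
pose m k := sval (cid (ex k)).
have mP k : lam k.+1 = ev (m k) := svalP (cid (ex k)).
have mid : forall k, m k = k.
  apply: increasing_surjective_id => [j k jk|k].
  - have := ds_increasing hw (ltn0Sn j) (jk : (j.+1 < k.+1)%N).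
    by rewrite !mP; apply: contraTT; rewrite -leqNgt -leNgt; exact: ev_le.
  - have [[//|j] _ ] := ds_all hw (sine_eigenfun k).
    by rewrite mP => /ev_inj e; exists j.
by move=> k; rewrite mP mid.
Qed.

Lemma spectrum_eigenfun (lam : nat -> R) (w : nat -> R -> R) :
  dirichlet_spectrum lam w -> forall k, exists2 c : R, c ^+ 2 = 1 &
    {ae leb, forall x, x \in `]0, 1[ -> w k.+1 x = c * sine k x}.
Proof.
move=> hw k; have eig := ds_eigen hw (ltn0Sn k).
have [j] := eigenfun_is_sine eig.
rewrite (spectrum_eigenvalue hw) => ekj.
rewrite -(ev_inj ekj).
set c := ip _ _ => wc; exists c => //.
have [[[Lw _] _] _ _ _] := eig.
have Ls := L2_sine k; have Lcs : L2 (fun x => c * sine k x) by exact: L2Z.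
have := ds_orthonormal hw (ltn0Sn k) (ltn0Sn k).
rewrite eqxx (ip_eq_ae Lw Lcs Lw wc) ipC (ip_eq_ae Lw Lcs Lcs wc).
by rewrite ip_sqrZ// sine_norm mulr1.
Qed.

(** The feedback term acts on the sine modes, whatever the signs of the given
    eigenfunctions. *)
Lemma spectrum_projection (lam : nat -> R) (w : nat -> R -> R) N f :
  dirichlet_spectrum lam w -> L2 f ->
  {ae leb, forall x, x \in `]0, 1[ ->
    \sum_(1 <= k < N.+1) ip f (w k) * w k x = sine_sum N (fun k => ip f (sine k)) x}.
Proof.
move=> hw Lf.
have term k : {ae leb, forall x, x \in `]0, 1[ ->
    ip f (w k.+1) * w k.+1 x = ip f (sine k) * sine k x}.
  have [c c2 wc] := spectrum_eigenfun hw k.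
  have [[[Lw _] _] _ _ _] := ds_eigen hw (ltn0Sn k).
  have Ls := L2_sine k; have Lcs : L2 (fun x => c * sine k x) by exact: L2Z.
  have e := ip_eq_ae Lw Lcs Lf wc.
  apply: aeS wc => x h xI; rewrite h// ipC e ipZl//.
  by rewrite mulrACA -expr2 c2 mul1r ipC.
elim: N => [|N IH].
  by apply: ae_all => x _; rewrite big_geq// /sine_sum big_ord0.
apply: (aeS2 _ IH (term N)) => x h1 h2 xI.
by rewrite big_nat_recr//= h1// h2// /sine_sum big_ord_recr.
Qed.

End Completeness.

(** * The chain rule for squares of integral functions *)

Section Evolution.
Variable R : realType.
Local Notation leb := (@lebesgue_measure R).
Implicit Types (f g h z s : R -> R) (v : R -> R -> R) (a b c d T K : R).

Lemma uniform_continuity_itv z a b (e : R) : 0 < e ->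
  (forall x, a <= x <= b -> {for x, continuous z}) ->
  exists2 d : R, 0 < d & forall x y, a <= x <= b -> `|y - x| < d -> `|z y - z x| <= e.
Proof.
move=> e0 cz.
have /compact_near_coveringP cov := @segment_compact R a b.
pose P (d x : R) := forall y, `|y - x| < d -> `|z y - z x| <= e.
have : \forall d \near (0 : R)^'+, (`[a, b]%classic `<=` P d)%classic.
  apply: cov => x; rewrite /= in_itv/= => xab.
  have e2 : 0 < e / 2 by rewrite divr_gt0.
  have /cvgrPdist_le/(_ _ e2) [eta /= eta0 near0] := cz x xab.
  exists ([set y | `|x - y| < eta / 2], [set d | d < eta / 2]).
    split => /=.
    - by exists (eta / 2) => //=; rewrite divr_gt0.
    - by apply: nbhs_right_lt; rewrite divr_gt0.
  move=> [x' d] [/= xx' dd] y yx'.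
  have h1 : `|z x - z y| <= e / 2.
    apply: near0; rewrite /ball_ /=.
    have := ler_distD x' x y; rewrite (distrC x' y); lra.
  have h2 : `|z x - z x'| <= e / 2 by apply: near0; rewrite /ball_ /=; lra.
  have := ler_distD (z x) (z y) (z x'); rewrite (distrC (z y) (z x)); lra.
move=> nd; near (0 : R)^'+ => d; exists d; first by near: d; exact: nbhs_right_gt.
move=> x y xab yx.
have h : (`[a, b]%classic `<=` P d)%classic by near: d.
by apply: (h x) => //=; rewrite in_itv.
Unshelve. all: by end_near. Qed.

(** As [g] is only integrable, [z] is differentiable at no prescribed point. The
    formula is exact up to the oscillation of [z] on the intervals of a fine
    subdivision. *)
Lemma integral_primitive_continuous_square a b z g : a <= b ->
  (forall x, a <= x <= b -> {for x, continuous z}) ->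
  leb.-integrable `]a, b[ (EFin \o g) ->
  (forall c d, a <= c -> c <= d -> d <= b -> z d - z c = \int[leb]_(x in `]c, d[) g x) ->
  leb.-integrable `]a, b[ (EFin \o (fun x => z x * g x)) /\
  z b ^+ 2 - z a ^+ 2 = \int[leb]_(x in `]a, b[) (2 * (z x * g x)).
Proof.
move=> ab cz gi prim.
have mg := integrable_measurable_fun gi.
have mz : measurable_fun `]a, b[ z.
  apply: open_continuous_measurable_fun; first exact: interval_open.
  by move=> x; rewrite mem_setE in_itv/= => /andP[? ?]; apply: cz; rewrite !ltW.
have [K zK] : exists K : R, forall x, a <= x <= b -> `|z x| <= K.
  have cn : {within `[a, b], continuous (fun x => `|z x|)}.
    apply: continuous_in_subspaceT => x; rewrite mem_setE in_itv/= => xab.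
    by apply: cvg_norm; exact: cz.
  have [c _ cmax] := EVT_max ab cn.
  by exists `|z c| => x xab; apply: cmax; rewrite in_itv.
have zgi : leb.-integrable `]a, b[ (EFin \o (fun x => z x * g x)).
  have := @integrable_bddM _ `]a, b[%classic g z K _ gi mz.
  have -> : (fun x => g x * z x) = (fun x => z x * g x) by apply/funext => x; rewrite mulrC.
  apply => // x; rewrite /= in_itv/= => /andP[? ?]; apply: zK; rewrite !ltW//.
split => //.
have sub c d : a <= c -> d <= b -> (`]c, d[ `<=` `]a, b[)%classic.
  by move=> ac db x /=; rewrite !in_itv/= => /andP[? ?]; apply/andP; split; lra.
have iS f c d : a <= c -> d <= b -> leb.-integrable `]a, b[ (EFin \o f) ->
    leb.-integrable `]c, d[ (EFin \o f).
  by move=> ac db fi; apply: (@integrableS _ _ _ leb `]a, b[) => //; exact: sub.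
have ni : leb.-integrable `]a, b[ (EFin \o (fun x => `|g x|)) by exact: (integrable_norm gi).
have i2 : leb.-integrable `]a, b[ (EFin \o (fun x => 2 * (z x * g x))).
  exact: integrable_scale.
apply/eqP; rewrite -subr_eq0 -normr_le0; apply/ler_addgt0Pr => e e0; rewrite add0r.
set V := \int[leb]_(x in `]a, b[) `|g x|.
have V0 : 0 <= V by apply: Rintegral_ge0.
pose eta := e / (2 * (V + 1)).
have eta0 : 0 < eta by rewrite divr_gt0// mulr_gt0//; lra.
have [dl dl0 unif] := uniform_continuity_itv eta0 cz.
(* on a short interval z varies by at most eta, so the defect is at most
   2 eta times the integral of |g| *)
have small c d : a <= c -> c <= d -> d <= b -> d - c < dl ->
    `|z d ^+ 2 - z c ^+ 2 - \int[leb]_(x in `]c, d[) (2 * (z x * g x))| <=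
    2 * eta * \int[leb]_(x in `]c, d[) `|g x|.
  move=> ac cd db dc.
  have gc := iS _ c d ac db gi.
  have e1 : z d ^+ 2 - z c ^+ 2 = \int[leb]_(x in `]c, d[) ((z d + z c) * g x).
    by rewrite RintegralZl// -prim//; ring.
  have i1 : leb.-integrable `]c, d[ (EFin \o (fun x => (z d + z c) * g x)).
    exact: integrable_scale.
  have i3 := iS _ c d ac db i2.
  rewrite e1 -RintegralB//.
  apply: (le_trans (le_normr_Rintegral _ _)) => //; first exact: integrable_sub.
  rewrite -RintegralZl//; last exact: (integrable_norm gc).
  apply: le_Rintegral => //.
  - by apply: integrable_norm; exact: integrable_sub.
  - by apply: integrable_scale => //; exact: (integrable_norm gc).
  - move=> x; rewrite /= in_itv/= => /andP[cx xd].
    have -> : (z d + z c) * g x - 2 * (z x * g x) = ((z d - z x) + (z c - z x)) * g x by ring.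
    rewrite normrM ler_wpM2r//; apply: (le_trans (ler_normD _ _)).
    have xab : a <= x <= b by apply/andP; split; lra.
    have := unif x d xab; have := unif x c xab.
    rewrite !ltr_norml => h1 h2.
    have -> : 2 * eta = eta + eta by ring.
    by apply: lerD; [apply: h2|apply: h1]; apply/andP; split; lra.
have [n [nb n0]] : exists n : nat, (b - a) / n.+1%:R < dl /\ True.
  pose n := Num.bound ((b - a) / dl); exists n; split => //.
  rewrite ltr_pdivrMr ?ltr0n// mulrC -ltr_pdivrMr//.
  apply: (lt_trans (archi_boundP _)); first by rewrite divr_ge0 ?subr_ge0// ltW.
  by rewrite ltr_nat.
pose x_ i : R := a + (b - a) / n.+1%:R * i%:R.
have xS i : x_ i.+1 = x_ i + (b - a) / n.+1%:R by rewrite /x_ -natr1; ring.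
have st0 : 0 <= (b - a) / n.+1%:R by rewrite divr_ge0// subr_ge0.
have xa i : a <= x_ i by rewrite /x_ lerDl mulr_ge0.
have xb i : (i <= n.+1)%N -> x_ i <= b.
  move=> ni'; rewrite /x_ -lerBrDl -mulrA ler_piMr ?subr_ge0//.
  by rewrite mulrC ler_pdivrMr ?ltr0n// mul1r ler_nat.
have key i : (i <= n.+1)%N ->
    `|z (x_ i) ^+ 2 - z a ^+ 2 - \int[leb]_(x in `]a, (x_ i)[) (2 * (z x * g x))| <=
    2 * eta * \int[leb]_(x in `]a, (x_ i)[) `|g x|.
  elim: i => [_|i IH iN].
    by rewrite /x_ mulr0 addr0 set_itvoo0// !Rintegral_set0 subrr subr0 normr0 mulr0.
  have xi : x_ i <= x_ i.+1 by rewrite xS lerDl.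
  have xSb := xb _ iN.
  have xSa := le_trans (xa i) xi.
  rewrite (Rintegral_split (xa i) xi (iS _ _ _ (lexx a) xSb i2)).
  rewrite (Rintegral_split (xa i) xi (iS _ _ _ (lexx a) xSb ni)).
  have := IH (ltnW iN).
  have : x_ i.+1 - x_ i < dl by rewrite xS addrC addKr.
  move=> /(small _ _ (xa i) xi xSb) h1 h2; rewrite mulrDr.
  apply: le_trans (lerD h2 h1); apply: le_trans (ler_normD _ _).
  by rewrite le_eqVlt; apply/orP; left; apply/eqP; congr (`|_|); ring.
have := key n.+1 (leqnn _).
have -> : x_ n.+1 = b by rewrite /x_ divfK ?pnatr_eq0//; ring.
move/le_trans; apply; rewrite -/V /eta.
have -> : 2 * (e / (2 * (V + 1))) * V = e * (V / (V + 1)).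
  by field; apply: lt0r_neq0; lra.
rewrite ler_piMr ?ltW// ltr_pdivrMr; lra.
Qed.

(** * Iterated integrals of real functions *)

Lemma measurable_section (A B : set R) v t : measurable A -> measurable B ->
  measurable_fun (A `*` B) (fun p : R * R => v p.1 p.2) -> A t -> measurable_fun B (v t).
Proof.
move=> mA mB mv At.
apply: (@measurable_comp _ _ _ _ _ _ (A `*` B) (fun p : R * R => v p.1 p.2) B (pair t)) => //.
- exact: measurableX.
- by move=> _ [x Bx <-].
- by apply: measurable_funTS; exact: pair1_measurable.
Qed.

Lemma integrable_fine (D : set R) (H : R -> \bar R) : measurable D ->
  measurable_fun D H -> {ae leb, forall x, D x -> H x \is a fin_num} ->
  measurable_fun D (fine \o H) /\
  (\int[leb]_(x in D) (fine (H x))%:E = \int[leb]_(x in D) H x)%E.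
Proof.
move=> mD mH fH.
have mf : measurable_fun D (fine \o H) by apply: measurableT_comp.
split => //; apply: ae_eq_integral => //; first exact/measurable_EFinP.
by apply: aeS fH => x h Dx /=; rewrite fineK// h.
Qed.

(** The inner integrals are finite only almost everywhere; [fine] sends the
    exceptional infinite values to 0. *)
Lemma Rfubini (A B : set R) v : measurable A -> measurable B ->
  (leb \x leb)%E.-integrable (A `*` B) (fun p : R * R => (v p.1 p.2)%:E) ->
  [/\ leb.-integrable A (EFin \o (fun t => \int[leb]_(x in B) v t x)),
      measurable_fun B (fun x => \int[leb]_(t in A) v t x),
      {ae leb, forall t, A t -> leb.-integrable B (EFin \o v t)},
      {ae leb, forall x, B x -> leb.-integrable A (EFin \o (v^~ x))} &
      \int[leb]_(t in A) \int[leb]_(x in B) v t x =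
      \int[leb]_(x in B) \int[leb]_(t in A) v t x].
Proof.
move=> mA mB vi.
have mAB : measurable (A `*` B) by exact: measurableX.
pose V : R * R -> \bar R := (fun p : R * R => (v p.1 p.2)%:E) \_ (A `*` B).
have Vi : (leb \x leb)%E.-integrable setT V.
  exact: (@integrable_mkcond _ _ _ (leb \x leb)%E (A `*` B) (fun p : R * R => (v p.1 p.2)%:E) mAB).1 vi.
have VE t x : V (t, x) = if (t \in A) && (x \in B) then (v t x)%:E else 0%E.
  rewrite /V patchE; congr (if _ then _ else _).
  by apply/idP/andP => [/set_mem[/= /mem_set ? /mem_set ?]|[/set_mem ? /set_mem ?]] //;
    apply/mem_set.
have FE t : fubini_F leb V t = ((fun t => \int[leb]_(x in B) (v t x)%:E) \_ A)%E t.
  rewrite /fubini_F patchE; case: ifPn => tA.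
    rewrite [RHS]integral_mkcond; apply: eq_integral => x _.
    by rewrite VE tA patchE.
  under eq_integral do rewrite VE (negbTE tA).
  exact: integral0.
have GE x : fubini_G leb V x = ((fun x => \int[leb]_(t in A) (v t x)%:E) \_ B)%E x.
  rewrite /fubini_G patchE; case: ifPn => xB.
    rewrite [RHS]integral_mkcond; apply: eq_integral => t _.
    by rewrite VE xB andbT patchE.
  under eq_integral do rewrite VE (negbTE xB) andbF.
  exact: integral0.
have Fi : leb.-integrable setT (fubini_F leb V) := integrable_fubini_F Vi.
have FAi : leb.-integrable A (fun t => \int[leb]_(x in B) (v t x)%:E)%E.
  by apply/(@integrable_mkcond _ _ _ leb A _ mA); apply: eq_integrable Fi => // t _.
have mG : measurable_fun B (fun x => \int[leb]_(t in A) (v t x)%:E)%E.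
  have : measurable_fun setT (fubini_G leb V) := measurable_fubini_G Vi.
  have -> : fubini_G leb V = (fun x => \int[leb]_(t in A) (v t x)%:E)%E \_ B.
    by apply/funext => x; exact: GE.
  by move/(@measurable_restrict _ _ _ _ B setT _ mB measurableT).2; rewrite setTI.
have finF : {ae leb, forall t, A t -> (\int[leb]_(x in B) (v t x)%:E)%E \is a fin_num}.
  exact: integrable_ae FAi.
have finG : {ae leb, forall x, B x -> (\int[leb]_(t in A) (v t x)%:E)%E \is a fin_num}.
  apply: aeS (ae_integrable2 Vi) => x ix Bx.
  have : fubini_G leb V x \is a fin_num := integrable_fin_num measurableT ix.
  by rewrite GE patchE mem_set.
have mF : measurable_fun A (fun t => \int[leb]_(x in B) (v t x)%:E)%E.
  by case/integrableP : FAi.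
have [mfF iF] := integrable_fine mA mF finF.
have [mfG iG] := integrable_fine mB mG finG.
split => //.
- apply/integrableP; split; first exact/measurable_EFinP.
  case/integrableP : FAi => _; apply: le_lt_trans.
  have mfF' : measurable_fun A (fun t => (fine (\int[leb]_(x in B) (v t x)%:E))%:E)%E.
    exact/measurable_EFinP.
  apply: ae_ge0_le_integral => //.
  - exact: measurableT_comp.
  - exact: measurableT_comp.
  - by apply: aeS finF => t h At; rewrite /= -[X in (_ <= `|X|)%E]fineK ?h.
- apply: aeS (ae_integrable1 Vi) => t it At.
  apply/(@integrable_mkcond _ _ _ leb B _ mB); apply: eq_integrable it => // x _.
  by rewrite VE patchE mem_set.
- apply: aeS (ae_integrable2 Vi) => x ix Bx.
  apply/(@integrable_mkcond _ _ _ leb A _ mA); apply: eq_integrable ix => // t _.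
  by rewrite VE patchE (mem_set Bx) andbT.
rewrite /Rintegral; congr fine; rewrite iF iG.
rewrite [LHS]integral_mkcond [RHS]integral_mkcond.
transitivity (\int[leb]_t fubini_F leb V t)%E.
  by apply: eq_integral => t _; rewrite FE.
transitivity (\int[leb]_x fubini_G leb V x)%E; last first.
  by apply: eq_integral => x _; rewrite GE.
transitivity (\int[leb \x leb]_p V p)%E.
  exact: integral12_prod_meas1 Vi.
by symmetry; exact: integral21_prod_meas1 Vi.
Qed.

End Evolution.

(** * Evolution of a Fourier coefficient *)

Section Coefficients.
Variable R : realType.
Local Notation leb := (@lebesgue_measure R).
Local Notation I01 := (`]0%R, 1%R[%classic : set R).
Local Notation Q T := (`]0%R, T[%classic `*` I01 : set (R * R)).
Implicit Types (s : R -> R) (v g : R -> R -> R) (a b c d T K : R).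

Let mI : measurable I01. Proof. exact: measurable_itv. Qed.

Lemma L2L2_integrable_sqr T v : L2L2 T v ->
  (leb \x leb)%E.-integrable (Q T) (fun p : R * R => ((v p.1 p.2) ^+ 2)%:E).
Proof.
move=> [mv iv]; apply/integrableP; split.
  by apply/measurable_EFinP; apply: measurable_funX.
move: iv; congr (_ < _)%E.
by apply: eq_integral => p _; rewrite gee0_abs// lee_fin sqr_ge0.
Qed.

Lemma L2L2_section T v : L2L2 T v -> {ae leb, forall t, t \in `]0, T[ -> L2 (v t)}.
Proof.
move=> Lv; have [mv _] := Lv.
have mT : measurable (`]0, T[%classic : set R) by exact: measurable_itv.
have [_ _ h _ _] := @Rfubini R _ _ (fun t x => v t x ^+ 2) mT mI (L2L2_integrable_sqr Lv).
apply: aeS h => t it tT; apply: L2_from_integrable; last exact: it.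
exact: (measurable_section mT mI mv).
Qed.

(** On a bounded rectangle square integrable functions are integrable. The
    product form of the bounded factor serves the integrals in each variable. *)
Lemma L2L2_integrableM T v (th s : R -> R) (K1 K2 : R) : L2L2 T v ->
  measurable_fun `]0, T[ th -> (forall t, 0 < t < T -> `|th t| <= K1) ->
  measurable_fun I01 s -> (forall x, I01 x -> `|s x| <= K2) ->
  (leb \x leb)%E.-integrable (Q T) (fun p : R * R => (v p.1 p.2 * (th p.1 * s p.2))%:E).
Proof.
move=> Lv mth thK ms sK; have [mv _] := Lv; have iv := L2L2_integrable_sqr Lv.
have mT : measurable (`]0, T[%classic : set R) by exact: measurable_itv.
have mQ : measurable (Q T) by exact: measurableX.
have mth' : measurable_fun (Q T) (fun p : R * R => th p.1).
  apply: (@measurable_comp _ _ _ _ _ _ `]0, T[%classic th (Q T) fst) => //.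
    by move=> _ [p [? _] <-].
  by apply: measurable_funTS; exact: measurable_fst.
have ms' : measurable_fun (Q T) (fun p : R * R => s p.2).
  apply: (@measurable_comp _ _ _ _ _ _ I01 s (Q T) snd) => //.
    by move=> _ [p [_ ?] <-].
  by apply: measurable_funTS; exact: measurable_snd.
have mts : measurable_fun (Q T) (fun p : R * R => th p.1 * s p.2) by exact: measurable_funM.
have muQ : ((leb \x leb)%E (Q T) < +oo)%E.
  have fin a b : (leb `]a, b[%classic) \is a fin_num.
    by rewrite lebesgue_measure_itv /=; case: ifP => // _.
  rewrite product_measure1E// -[X in (X * _)%E](fineK (fin 0 T)).
  by rewrite -[X in (_ * X)%E](fineK (fin 0 1)) -EFinM ltry.
have i1 : (leb \x leb)%E.-integrable (Q T)
    (EFin \o (fun p : R * R => v p.1 p.2 ^+ 2 + (`|K1 * K2| ^+ 2))).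
  apply: (@integrableD _ _ _ (leb \x leb)%E (Q T) mQ
    (fun p : R * R => (v p.1 p.2 ^+ 2)%:E) (EFin \o cst (`|K1 * K2| ^+ 2))) => //.
  apply: measurable_bounded_integrable => //.
  by exists (`|K1 * K2| ^+ 2); split => // y yK p _ /=; rewrite ger0_norm ?sqr_ge0// ltW.
apply: le_integrable i1 => //.
  by apply/measurable_EFinP; exact: measurable_funM.
move=> p [/= p1 p2]; rewrite lee_fin.
have b : `|th p.1 * s p.2| <= `|K1 * K2|.
  rewrite normrM (le_trans _ (ler_norm _))// ler_pM// ?sK//.
  by apply: thK; move: p1; rewrite in_itv.
rewrite normrM [leRHS]ger0_norm ?addr_ge0 ?sqr_ge0//.
rewrite -(real_normK (num_real (v p.1 p.2))).
have := normr_ge0 (v p.1 p.2); have := normr_ge0 (th p.1 * s p.2).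
have := sqr_ge0 (`|v p.1 p.2| - `|K1 * K2|).
by nra.
Qed.

Lemma L2L2_slices T v : L2L2 T v ->
  {ae leb, forall x, I01 x -> leb.-integrable `]0, T[ (EFin \o (v^~ x))}.
Proof.
move=> Lv; have mT : measurable (`]0, T[%classic : set R) by exact: measurable_itv.
have i1 := @L2L2_integrableM T v (fun=> 1) (fun=> 1) 1 1 Lv (@measurable_cst _ _ _ _ _ _)
  (fun t _ => ltac:(by rewrite normr1)) (@measurable_cst _ _ _ _ _ _)
  (fun t _ => ltac:(by rewrite normr1)).
have [_ _ _ iu _] := @Rfubini R _ _ (fun t x => v t x * (1 * 1)) mT mI i1.
apply: aeS iu => x h Ix; move: (h Ix); congr (leb.-integrable _ _).
by apply/funext => t /=; rewrite !mulr1.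
Qed.

Lemma continuousL2_ip v s t : continuousL2 v -> L2 s -> 0 < t ->
  {for t, continuous (fun t => ip (v t) s)}.
Proof.
move=> [Lv cv] Ls t0; apply/cvgrPdist_le => e e0.
have d0 : 0 < e / (l2norm s + 1) by rewrite divr_gt0// ltr_wpDl// l2norm_ge0.
have /cvgrPdist_lt/(_ _ d0) := cv t (ltW t0).
rewrite near_withinE /= => near_t.
near=> u.
have u0 : 0 <= u by apply: ltW; near: u; exact: lt_nbhsr.
have : `|0 - l2norm (v u \- v t)| < e / (l2norm s + 1).
  suff : 0 <= u -> `|0 - l2norm (v u \- v t)| < e / (l2norm s + 1) by apply.
  by near: u.
rewrite sub0r normrN ger0_norm ?l2norm_ge0// => h.
have Lu := Lv u u0; have Lt := Lv t (ltW t0).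
rewrite distrC -ipBl//; apply: (le_trans (ip_CS (L2B Lu Lt) Ls)).
have s0 := l2norm_ge0 s; have n0 := l2norm_ge0 (v u \- v t).
rewrite ltr_pdivlMr in h; last by lra.
by nra.
Unshelve. all: by end_near. Qed.

(** The weak equation in time holds for almost every [x]. Integrated against [s],
    it becomes the weak equation of a scalar function, which is continuous and
    is therefore recovered at every time by [weak_primitive]. *)
Lemma coefficient_evolution T v g s : 0 < T -> L2L2 T v -> time_deriv T v g ->
  continuousL2 v -> continuous s ->
  leb.-integrable `]0, T[ (EFin \o (fun t => ip (g t) s)) /\
  forall c d, 0 < c -> c <= d -> d < T ->
    ip (v d) s - ip (v c) s = \int[leb]_(t in `]c, d[) ip (g t) s.
Proof.
move=> T0 Lv [Lg weak] cv cs; have [K _ sK0] := continuous_bounded 0 1 cs.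
have sK x : I01 x -> `|s x| <= K.
  by rewrite /= in_itv/= => /andP[? ?]; apply: sK0; rewrite !ltW.
have ms : measurable_fun I01 s by exact: continuous_measurable.
have Ls : L2 s by exact: continuous_L2.
have mT : measurable (`]0, T[%classic : set R) by exact: measurable_itv.
have coef u : L2L2 T u -> leb.-integrable `]0, T[ (EFin \o (fun t => ip (u t) s)).
  move=> Lu; have i1 := @L2L2_integrableM T u (fun=> 1) s 1 K Lu (@measurable_cst _ _ _ _ _ _)
    (fun t _ => ltac:(by rewrite normr1)) ms sK.
  have [h _ _ _ _] := @Rfubini R _ _ (fun t x => u t x * (1 * s x)) mT mI i1.
  move: h; congr (leb.-integrable _ _); apply/funext => t /=; congr EFin.
  by apply: eq_Rintegral => x _; rewrite mul1r.
have zi := coef v Lv; have gi := coef g Lg.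
split=> // c d c0 cd dT.
have czt t : 0 < t < T -> {for t, continuous (fun t => ip (v t) s)}.
  by move=> /andP[t0 _]; exact: continuousL2_ip.
apply: (@weak_primitive R 0 T (fun t => ip (v t) s) _ zi czt gi) => //.
move=> th tth; have CT := test_fun_C1 tth; have [_ cth'] := CT; have cth := C1_continuous CT.
have [Ka _ tha] := continuous_bounded 0 T cth; have [Kb _ thb] := continuous_bounded 0 T cth'.
have bd u f (Kf : R) : leb.-integrable `]0, T[ (EFin \o u) -> continuous f ->
    (forall t, 0 <= t <= T -> `|f t| <= Kf) ->
    leb.-integrable `]0, T[ (EFin \o (fun t => u t * f t)).
  move=> iu cf fK.
  apply: (integrable_bddM mT iu (continuous_measurable mT cf) (K := Kf)).
  by move=> t /=; rewrite in_itv/= => /andP[? ?]; apply: fK; rewrite !ltW.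
have igth := bd _ _ _ gi cth tha.
have ia := L2L2_integrableM Lg (continuous_measurable mT (fun t => @continuousN _ _ _ th t (cth t))) (K1 := Ka)
  (fun t (h : 0 < t < T) => ltac:(by rewrite /= normrN; apply: tha; case/andP: h => ? ?; rewrite !ltW)) ms sK.
have ib := L2L2_integrableM Lv (continuous_measurable mT cth')
  (fun t (h : 0 < t < T) => thb t ltac:(by case/andP: h => ? ?; rewrite !ltW)) ms sK.
have [ga1 ma _ _ ga5] := @Rfubini R _ _ (fun t x => g t x * (- th t * s x)) mT mI ia.
have [_ mb _ _ gb5] := @Rfubini R _ _ (fun t x => v t x * (derive1 th t * s x)) mT mI ib.
transitivity (\int[leb]_(t in `]0, T[) \int[leb]_(x in I01) (v t x * (derive1 th t * s x))).
  apply: eq_Rintegral => t; rewrite mem_setE in_itv/= => /andP[t0 _].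
  have Lvt : L2 (v t) by case: cv => h _; exact: h (ltW t0).
  rewrite -(Rint_mulr _ mI (L2_integrableM Lvt Ls)).
  by apply: eq_Rintegral => x _; ring.
rewrite gb5.
transitivity (\int[leb]_(t in `]0, T[) \int[leb]_(x in I01) (g t x * (- th t * s x))).
  rewrite ga5; apply: (ae_eq_Rintegral mI mb ma).
  apply: (aeS2 _ (weak th tth)); last first.
    apply: (aeS2 _ (L2L2_slices Lv) (L2L2_slices Lg)) => x h1 h2; exact: (conj h1 h2).
  move=> x wx [ivx igx] xI; have {wx}wx := wx xI.
  have e1 : \int[leb]_(t in `]0, T[) (v t x * (derive1 th t * s x)) =
      \int[leb]_(t in `]0, T[) (v t x * derive1 th t) * s x.
    rewrite -(Rint_mulr _ mT (bd (v^~ x) _ Kb (ivx xI) cth' thb)).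
    by apply: eq_Rintegral => t _; ring.
  have e2 : \int[leb]_(t in `]0, T[) (g t x * (- th t * s x)) =
      \int[leb]_(t in `]0, T[) (g t x * th t) * - s x.
    rewrite -(Rint_mulr _ mT (bd (g^~ x) _ Ka (igx xI) cth tha)).
    by apply: eq_Rintegral => t _; ring.
  by rewrite e1 e2 wx; ring.
rewrite -mulN1r -(Rint_mull _ mT igth).
apply: (ae_eq_Rintegral mT (integrable_measurable_fun ga1)).
- by apply: measurable_funM; [exact: measurable_cst|exact: integrable_measurable_fun igth].
- apply: aeS (L2L2_section Lg) => t Lgt tT.
  transitivity (ip (g t) s * - th t); last by ring.
  rewrite -(Rint_mulr _ mI (L2_integrableM (Lgt tT) Ls)).
  by apply: eq_Rintegral => x _; ring.
Qed.

End Coefficients.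

(** * Scalar inequalities in time *)

Section Decay.
Variable R : realType.
Local Notation leb := (@lebesgue_measure R).
Local Notation ev := (@ev R).

Lemma le_of_div_ev_large (x y C : R) M0 : 0 <= C ->
  (forall M, (M0 <= M)%N -> x <= y + C / ev M) -> x <= y.
Proof.
move=> C0 xy; apply: (le_of_div_ev C0) => M.
apply: (le_trans (xy (maxn M0 M) (leq_maxl _ _))).
by rewrite lerD2l ler_wpM2l// lef_pV2 ?posrE ?ev_gt0// ev_le// leq_maxr.
Qed.

(** A perturbed dissipation inequality for truncated energies, with an error
    that disappears as the truncation is removed. Over one unit of time the
    limit energy is divided by at least [1 + alpha]. *)
Lemma truncated_decay (E : nat -> R -> R) (alpha t0 B : R) (N : nat) :
  0 < alpha -> (forall M t, 0 <= E M t) ->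
  (forall M M' t, (M <= M')%N -> E M t <= E M' t) ->
  (forall M, E M t0 <= B) ->
  (forall s, t0 <= s -> exists2 C : R, 0 <= C & forall M a b, (N <= M)%N ->
    s <= a -> a <= b -> b <= s + 1 ->
    leb.-integrable `]a, b[ (EFin \o E M) /\
    E M b - E M a <= - alpha * \int[leb]_(x in `]a, b[) E M x + C / ev M) ->
  exists C gamma : R, [/\ 0 <= C, 0 < gamma &
    forall M t, t0 <= t -> E M t <= C * expR (- gamma * t)].
Proof.
move=> al0 E0 Emono Et0 step.
have B0 : 0 <= B by exact: le_trans (E0 0%N t0) (Et0 0%N).
have stay s B' : t0 <= s -> (forall M, E M s <= B') ->
    forall M t, s <= t -> t <= s + 1 -> E M t <= B'.
  move=> s0 EB M t st t1; have [C C0 st'] := step s s0.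
  apply: (@le_of_div_ev_large _ _ C (maxn N M)) => // M'.
  rewrite geq_max => /andP[NM MM].
  have [_] := st' M' s t NM (lexx _) st t1.
  have : 0 <= \int[leb]_(x in `]s, t[) E M' x by apply: Rintegral_ge0 => x _; exact: E0.
  move=> i0; have := mulr_ge0 (ltW al0) i0.
  have := EB M'; have := Emono _ _ t MM; rewrite mulNr.
  move: (C / ev M') (alpha * _) => w I; lra.
have drop s B' : t0 <= s -> (forall M, E M s <= B') ->
    forall M, E M (s + 1) <= B' / (1 + alpha).
  move=> s0 EB M; have [C C0 st'] := step s s0.
  have a1 : 0 < 1 + alpha by lra.
  rewrite ler_pdivlMr//.
  apply: (@le_of_div_ev_large _ _ ((1 + alpha) * C) (maxn N M)) => [|M'].
    by rewrite mulr_ge0// ltW.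
  rewrite geq_max => /andP[NM MM].
  have ss : s <= s + 1 by rewrite lerDl.
  have [iE hE] := st' M' s (s + 1) NM (lexx _) ss (lexx _).
  have low : E M' (s + 1) - C / ev M' <= \int[leb]_(x in `]s, (s + 1)[) E M' x.
    have -> : E M' (s + 1) - C / ev M' =
        \int[leb]_(x in `]s, (s + 1)[) (E M' (s + 1) - C / ev M').
      by rewrite Rintegral_itvoo_cst// addrAC subrr add0r mulr1.
    apply: le_Rintegral => //; first exact: integrable_cst.
    move=> x; rewrite /= in_itv/= => /andP[sx xs].
    have [_] := st' M' x (s + 1) NM (ltW sx) (ltW xs) (lexx _).
    have i0 : 0 <= \int[leb]_(x in `]x, (s + 1)[) E M' x.
      by apply: Rintegral_ge0 => y _; exact: E0.
    have := mulr_ge0 (ltW al0) i0; rewrite mulNr.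
    move: (C / ev M') (alpha * _) => w I; lra.
  have low' := ler_wpM2l (ltW al0) low.
  have e1 := EB M'; have e2 := Emono _ _ (s + 1) MM.
  have e3 := ler_wpM2l (ltW a1) e2.
  rewrite mulrC -mulrA; move: hE low' e3; move: (C / ev M') (Rintegral _ _ _) => w I.
  rewrite mulNr mulrBr !mulrDl !mul1r; lra.
pose q := (1 + alpha)^-1; pose gamma := ln (1 + alpha).
have a1 : 1 < 1 + alpha by lra.
have g0 : 0 < gamma by exact: ln_gt0.
have q_exp : q = expR (- gamma).
  by rewrite expRN lnK// posrE; lra.
have at_n n M : E M (t0 + n%:R) <= B * q ^+ n.
  elim: n M => [|n IH] M; first by rewrite addr0 mulr1.
  rewrite -natr1 addrA exprSr mulrA; apply: drop => //.
  by rewrite lerDl.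
exists (B * (1 + alpha) * expR (gamma * t0)), gamma; split => //.
  by rewrite !mulr_ge0 ?expR_ge0//; lra.
move=> M t tt; have t0t : 0 <= t - t0 by rewrite subr_ge0.
have /andP[nl nr] := truncn_itv t0t.
set n := Num.truncn _ in nl nr.
have : E M t <= B * q ^+ n.
  apply: (stay (t0 + n%:R)) => //; first by rewrite lerDl.
  - lra.
  - by rewrite -natr1 in nr; lra.
move/le_trans; apply.
have -> : q ^+ n = (1 + alpha) * q ^+ n.+1.
  by rewrite exprS mulrA mulfV ?mul1r//; apply: lt0r_neq0; lra.
rewrite -!mulrA ler_wpM2l// ler_wpM2l//; first by lra.
rewrite -expRD q_exp -expRM_natl ler_expR.
have -> : n.+1%:R * - gamma = - (gamma * n.+1%:R) by ring.
have -> : gamma * t0 + - gamma * t = - (gamma * (t - t0)) by ring.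
by rewrite lerN2 ler_pM2l// ltW.
Qed.

(** The function [expR (nu * t) * (U t - r / nu)] is nonincreasing. *)
Lemma linear_ode_upper (nu r e : R) (U : R -> R) : 0 < nu -> 0 < e ->
  (forall t : R, 0 < t -> derivable U t 1) ->
  (forall t : R, 0 < t -> derive1 U t <= r - nu * U t) ->
  exists2 t1 : R, 0 < t1 & forall t, t1 <= t -> U t <= r / nu + e.
Proof.
move=> nu0 e0 dU U'.
pose G t := expR (nu * t) * (U t - r / nu).
have dexp (t : R) : is_derive t (1 : R) (fun t => expR (nu * t)) (expR (nu * t) * nu).
  have [dA _] := C1_affine nu 0.
  have := @is_derive1_comp R expR (fun t => nu * t + 0) t _ _ (is_derive_expR _) (dA t).
  by rewrite addr0; congr is_derive; apply/funext => u; rewrite /= addr0.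
have dG (t : R) : 0 < t -> is_derive t (1 : R) G
    (expR (nu * t) * derive1 U t + (U t - r / nu) * (expR (nu * t) * nu)).
  move=> t0; have dUt : is_derive t (1 : R) U (derive1 U t).
    by apply: DeriveDef; [exact: dU|rewrite derive1E].
  have dUr := is_deriveD dUt (is_derive_cst (- (r / nu)) t (1 : R)).
  by apply: (is_derive_eq (is_deriveM (dexp t) dUr)); rewrite addr0.
have G' (t : R) : 0 < t -> derive1 G t <= 0.
  move=> t0; rewrite derive1E (@derive_val _ _ _ _ _ _ _ (dG t t0)).
  have -> : expR (nu * t) * derive1 U t + (U t - r / nu) * (expR (nu * t) * nu) =
      expR (nu * t) * (derive1 U t - (r - nu * U t)) by field; exact: lt0r_neq0.
  by rewrite mulr_ge0_le0 ?expR_ge0// subr_le0 U'.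
have derG (t : R) : 0 < t -> derivable G t 1.
  by move=> t0; exact: (@ex_derive _ _ _ _ _ _ _ (dG t t0)).
have Gle t : 1 <= t -> G t <= G 1.
  move=> t1; apply: (@ler0_derive1_nincry R G 1) => //.
  - by move=> x; rewrite in_itv/= andbT => x1; apply: derG; lra.
  - by move=> x; rewrite in_itv/= andbT => x1; apply: G'; lra.
  - apply: derivable_within_continuous => x; rewrite in_itv/= andbT => x1.
    by apply: derG; lra.
pose t1 := Num.max 1 (`|G 1| / (nu * e)).
exists t1; first by rewrite lt_max ltr01.
move=> t; rewrite ge_max => /andP[t1' tG].
(* this crude bound on the exponential is what makes t1 explicit *)
have ex : 1 + nu * t <= expR (nu * t) by exact: expR_ge1Dx.
have ep : 0 < expR (nu * t) := expR_gt0 _.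
rewrite -lerBlDl -(ler_pM2l ep) -/(G t).
apply: (le_trans (Gle t t1')); apply: (le_trans (ler_norm _)).
rewrite ler_pdivrMr ?mulr_gt0// in tG; nra.
Qed.

End Decay.

(** * The energy inequality at a fixed time *)

Section EnergyRate.
Variable R : realType.
Local Notation leb := (@lebesgue_measure R).
Local Notation ev := (@ev R).
Local Notation sine := (@sine R).

Lemma gain_ge0 (nu c0 M2 M4 S : R) : 0 < nu -> 0 <= M2 -> 0 <= M4 -> 0 <= S ->
  0 <= 4 * c0 ^+ 2 / nu * M4 + (4 * c0 ^+ 2 / nu + 1 / (2 * nu)) * M2 + S.
Proof.
move=> /ltW nu0 M20 M40 S0.
have c2 : 0 <= 4 * c0 ^+ 2 / nu by rewrite divr_ge0// mulr_ge0// sqr_ge0.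
have h : 0 <= 1 / (2 * nu) by rewrite divr_ge0// mulr_ge0.
by rewrite addr_ge0// addr_ge0// mulr_ge0// addr_ge0.
Qed.

(** Young's inequalities: the transport terms use two thirds of the dissipation,
    the projection error a quarter, and the coupling with the scalar unknown
    three quarters of its damping. What remains of the dissipation is
    [nu / 12] and [nu / 4]. *)
Lemma energy_rate_scalar (nu mu c0 m2 m4 S Q a z x2 x y Y Ym Yn A B1 B2 D kk eN : R) :
  0 < nu -> 0 <= c0 -> 0 <= m2 -> 0 <= m4 -> 0 <= S -> 0 <= y ->
  0 <= x -> x2 = x ^+ 2 -> Y = y ^+ 2 -> 0 <= Ym -> 0 <= Yn -> Ym <= Y ->
  4 * Ym <= x2 -> Ym - Yn <= x2 / eN -> Y - Ym <= kk ->
  a <= S -> Q = 4 * c0 ^+ 2 / nu * m4 ^+ 2 +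
    (4 * c0 ^+ 2 / nu + 1 / (2 * nu)) * m2 ^+ 2 + S ->
  Q <= mu -> eN^-1 * Q <= nu / 4 ->
  `|A| <= m2 * y -> `|B1| <= c0 * m4 * y * x -> `|B2| <= c0 * y * m2 * x ->
  `|D| <= y / 2 * (c0 * m4 + c0 * m2) ->
  a * Ym + z * A - nu * x2 - 2 * B1 - 2 * B2 - mu * Yn + (- nu * z ^+ 2 - z * D) <=
  - (nu / 4) * (Ym + z ^+ 2) + Q * kk.
Proof.
move=> nu0 c00 m20 m40 S0 y0 x0 -> -> Ym0 Yn0 YmY X4 YmYn Ykk aS QE Qmu QeN A1 hB1 hB2 hD.
have Q0 : 0 <= Q by rewrite QE; apply: gain_ge0 => //; exact: sqr_ge0.
have n0 := lt0r_neq0 nu0.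
have b1 : - 2 * B1 <= nu / 3 * x ^+ 2 + 3 / nu * c0 ^+ 2 * m4 ^+ 2 * y ^+ 2.
  have h : 0 <= nu / 3 * (x - 3 / nu * (c0 * m4 * y)) ^+ 2.
    by rewrite mulr_ge0 ?sqr_ge0// divr_ge0// ltW.
  have -> : 3 / nu * c0 ^+ 2 * m4 ^+ 2 * y ^+ 2 =
    nu / 3 * (x - 3 / nu * (c0 * m4 * y)) ^+ 2 - nu / 3 * x ^+ 2 + 2 * (c0 * m4 * y * x).
    by field.
  by move: hB1; rewrite ler_norml => /andP[? ?]; lra.
have b2 : - 2 * B2 <= nu / 3 * x ^+ 2 + 3 / nu * c0 ^+ 2 * m2 ^+ 2 * y ^+ 2.
  have h : 0 <= nu / 3 * (x - 3 / nu * (c0 * m2 * y)) ^+ 2.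
    by rewrite mulr_ge0 ?sqr_ge0// divr_ge0// ltW.
  have -> : 3 / nu * c0 ^+ 2 * m2 ^+ 2 * y ^+ 2 =
    nu / 3 * (x - 3 / nu * (c0 * m2 * y)) ^+ 2 - nu / 3 * x ^+ 2 + 2 * (c0 * y * m2 * x).
    by field.
  by move: hB2; rewrite ler_norml => /andP[? ?]; lra.
pose W := m2 * y + y / 2 * (c0 * m4 + c0 * m2).
have W2 : W ^+ 2 <= 3 / 2 * (m2 * y) ^+ 2 + 3 * c0 ^+ 2 * (m2 ^+ 2 + m4 ^+ 2) * y ^+ 2.
  have -> : W = m2 * y + c0 * y / 2 * (m4 + m2) by rewrite /W; ring.
  rewrite -subr_ge0.
  set lhs := (X in 0 <= X).
  have -> : lhs = 1 / 2 * (m2 * y - c0 * y * (m4 + m2)) ^+ 2 +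
      3 / 4 * (c0 * y * (m4 - m2)) ^+ 2 +
      3 / 2 * ((c0 * y * m2) ^+ 2 + (c0 * y * m4) ^+ 2) by rewrite /lhs; field.
  by rewrite !addr_ge0// mulr_ge0// ?addr_ge0 ?sqr_ge0.
have zw : z * A - z * D <= 3 * nu / 4 * z ^+ 2 + W ^+ 2 / (3 * nu).
  have AD : `|A - D| <= W by apply: (le_trans (ler_normB _ _)); exact: lerD.
  have h : 0 <= 3 * nu / 4 * (`|z| - 2 / (3 * nu) * W) ^+ 2.
    by rewrite mulr_ge0 ?sqr_ge0// divr_ge0// mulr_ge0// ltW.
  have -> : W ^+ 2 / (3 * nu) = 3 * nu / 4 * (`|z| - 2 / (3 * nu) * W) ^+ 2 -
      3 * nu / 4 * `|z| ^+ 2 + `|z| * W.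
    by field.
  rewrite real_normK ?num_real//.
  have : z * (A - D) <= `|z| * W.
    by rewrite (le_trans (ler_norm _))// normrM ler_wpM2l.
  lra.
have W3 : W ^+ 2 / (3 * nu) <= 1 / (2 * nu) * m2 ^+ 2 * y ^+ 2 +
    c0 ^+ 2 / nu * (m2 ^+ 2 + m4 ^+ 2) * y ^+ 2.
  rewrite ler_pdivrMr ?mulr_gt0//; apply: (le_trans W2).
  by rewrite le_eqVlt; apply/orP; left; apply/eqP; field.
have aYm : a * Ym <= S * y ^+ 2.
  by rewrite (le_trans (ler_wpM2r Ym0 aS))// ler_wpM2l.
have QY : Q * y ^+ 2 = 4 * c0 ^+ 2 / nu * m4 ^+ 2 * y ^+ 2 +
    (4 * c0 ^+ 2 / nu + 1 / (2 * nu)) * m2 ^+ 2 * y ^+ 2 + S * y ^+ 2.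
  by rewrite QE; ring.
have sum1 : 3 / nu * c0 ^+ 2 * m4 ^+ 2 * y ^+ 2 + 3 / nu * c0 ^+ 2 * m2 ^+ 2 * y ^+ 2 +
   (1 / (2 * nu) * m2 ^+ 2 * y ^+ 2 + c0 ^+ 2 / nu * (m2 ^+ 2 + m4 ^+ 2) * y ^+ 2) =
   4 * c0 ^+ 2 / nu * m4 ^+ 2 * y ^+ 2 +
    (4 * c0 ^+ 2 / nu + 1 / (2 * nu)) * m2 ^+ 2 * y ^+ 2 by field.
have QYm : Q * Ym <= mu * Yn + nu / 4 * x ^+ 2.
  have h1 : Q * (Ym - Yn) <= Q * (x ^+ 2 / eN) by exact: ler_wpM2l.
  have h2 : eN^-1 * Q * x ^+ 2 <= nu / 4 * x ^+ 2 by rewrite ler_wpM2r ?sqr_ge0.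
  have h3 : Q * Yn <= mu * Yn by exact: ler_wpM2r.
  have -> : Q * Ym = Q * (Ym - Yn) + Q * Yn by ring.
  have h4 : Q * (x ^+ 2 / eN) = eN^-1 * Q * x ^+ 2 by ring.
  lra.
have Qk : Q * (y ^+ 2 - Ym) <= Q * kk by exact: ler_wpM2l.
rewrite mulrBr in Qk.
have X4' : nu / 12 * (4 * Ym) <= nu / 12 * x ^+ 2.
  by rewrite ler_wpM2l// divr_ge0// ltW.
have nYm : 0 <= nu * Ym by rewrite mulr_ge0// ltW.
lra.
Qed.

Lemma l2norm_le_bound p (K : R) : L2 p -> 0 <= K ->
  {ae leb, forall x, x \in `]0, 1[ -> `|p x| <= K} -> l2norm p <= K.
Proof.
move=> Lp K0 pK; have L1 : L2 (fun=> 1 : R) by exact: (continuous_L2 (@cst_continuous _ _ (1 : R))).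
have [_ /(_ K0)] := L2_ae_boundedM (L2_measurable Lp) pK L1.
have -> : (fun x => p x * 1) = p by apply/funext => x; rewrite mulr1.
have -> : l2norm (fun=> 1 : R) = 1; last by rewrite mulr1.
rewrite /l2norm /ip; under eq_Rintegral do rewrite mulr1.
by rewrite Rintegral_itvoo_cst// subr0 mulr1 sqrtr1.
Qed.

Let rate_difference (a b nu mu p0 q0 p1 q1 p2 q2 f : R) :
  a * p0 + nu * p2 - 2 * p0 * p1 - mu * f - (b * q0 + nu * q2 - 2 * q0 * q1) =
  a * (p0 - q0) + (a - b) * q0 + nu * (p2 - q2) - 2 * (p0 * (p1 - q1)) -
    2 * ((p0 - q0) * q1) - mu * f.
Proof. by ring. Qed.

(** The difference [z = p - q] of two states is tested with [- z''], truncated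
    to [M] modes. The linear terms are diagonal in the modes and give exact
    identities; the other terms see the untruncated norm of [z'], whose excess
    is bounded by [energy_tail]. *)
Lemma energy_rate (nu mu c0 M2 M4 S Q a b : R) (N M : nat) (p q G : R -> R) :
  0 < nu -> sobolev_constant c0 -> 0 <= M2 -> 0 <= M4 -> 0 <= S ->
  H01 p -> H01 q -> H2 p -> H2 q -> L2 G ->
  l2norm (dx p) ^+ 2 <= M4 -> l2norm (dx q) ^+ 2 <= M2 ->
  a <= S -> Q = 4 * c0 ^+ 2 / nu * M4 + (4 * c0 ^+ 2 / nu + 1 / (2 * nu)) * M2 + S ->
  Q <= mu -> (ev N)^-1 * Q <= nu / 4 -> (N <= M)%N ->
  {ae leb, forall x, x \in `]0, 1[ ->
    G x = a * p x + nu * dx (dx p) x - 2 * p x * dx p x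
      - mu * sine_sum N (fun k => ip (p \- q) (sine k)) x
      - (b * q x + nu * dx (dx q) x - 2 * q x * dx q x)} ->
  \sum_(k < M) ev k * (ip (p \- q) (sine k) * ip G (sine k)) +
    (a - b) * (- nu * (a - b) - (l2norm p ^+ 2 - l2norm q ^+ 2)) <=
  - (nu / 4) * (sine_energy M (p \- q) + (a - b) ^+ 2) +
    Q * (ip (dx (dx p) \- dx (dx q)) (dx (dx p) \- dx (dx q)) / ev M).
Proof.
move=> nu0 [c00 sob] M20 M40 S0 H01p' H01q' [H1p H1dp] [H1q H1dq] LG pM4 qM2 aS QE Qmu QN NM Geq.
have Hp := H01_to_pair H01p'; have Hq := H01_to_pair H01q'.
have [Lp Lpx _] := Hp; have [Lq Lqx _] := Hq.
have [Lpxx wpxx] := H1_dx H1dp; have [Lqxx wqxx] := H1_dx H1dq.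
have Hz := H01_pairB Hp Hq.
set z := p \- q in Hz Geq *; set zx := dx p \- dx q in Hz.
set k := dx (dx p) \- dx (dx q).
have [Lz Lzx _] := Hz.
have Lk : L2 k by exact: L2B.
have wk : weak_deriv zx k.
  move=> phi tphi; have Lphi := test_fun_L2 tphi; have Ldphi := test_fun_derive_L2 tphi.
  have hp : ip (dx p) (derive1 phi) = - ip (dx (dx p)) phi := wpxx phi tphi.
  have hq : ip (dx q) (derive1 phi) = - ip (dx (dx q)) phi := wqxx phi tphi.
  change (ip zx (derive1 phi) = - ip k phi).
  rewrite /zx /k (ipBl Lpx Lqx Ldphi) (ipBl Lpxx Lqxx Lphi) hp hq.
  by rewrite opprK opprB addrC.
have zinf : {ae leb, forall x, x \in `]0, 1[ -> `|z x| <= c0 * l2norm zx}.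
  have -> : l2norm zx = l2norm (dx z).
    have [Ldz _] := H1_dx (H01_pair_H01 Hz).1.
    by apply: l2norm_eq_ae => //; apply: aeS (H01_pair_dx Hz) => x h xI; rewrite h.
  exact: sob (H01_pair_H01 Hz).
pose m2 : R := Num.sqrt M2; pose m4 : R := Num.sqrt M4.
have m20 : 0 <= m2 := sqrtr_ge0 _; have m40 : 0 <= m4 := sqrtr_ge0 _.
have pxm : l2norm (dx p) <= m4 by exact: le_sqrt_of_sqr (l2norm_ge0 _) pM4.
have qxm : l2norm (dx q) <= m2 by exact: le_sqrt_of_sqr (l2norm_ge0 _) qM2.
have c00' := ltW c00.
have pinf : {ae leb, forall x, x \in `]0, 1[ -> `|p x| <= c0 * m4}.
  by apply: aeS (sob p H01p') => x h xI; rewrite (le_trans (h xI))// ler_wpM2l.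
have qinf : {ae leb, forall x, x \in `]0, 1[ -> `|q x| <= c0 * m2}.
  by apply: aeS (sob q H01q') => x h xI; rewrite (le_trans (h xI))// ler_wpM2l.
have cm4 : 0 <= c0 * m4 by exact: mulr_ge0.
have cm2 : 0 <= c0 * m2 by exact: mulr_ge0.
pose y := l2norm zx; have y0 : 0 <= y := l2norm_ge0 _.
have cy : 0 <= c0 * y by exact: mulr_ge0.
have [Lpz /(_ cm4) npz] := L2_ae_boundedM (L2_measurable Lp) pinf Lzx.
have [Lzq /(_ cy) nzq] := L2_ae_boundedM (L2_measurable Lz) zinf Lqx.
(* the truncation of - z'' *)
pose zc j := ip z (sine j); pose sb j := ev j * zc j.
pose sg := sine_sum M sb; have Lsg : L2 sg by exact: sine_sum_L2.
have Lf := sine_sum_L2 N zc.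
have sumG : \sum_(j < M) ev j * (zc j * ip G (sine j)) = ip G sg.
  by rewrite ip_sine_sum//; apply: eq_bigr => j _; rewrite mulrA.
pose x := l2norm sg; have x0 : 0 <= x := l2norm_ge0 _.
have x2 : x ^+ 2 = \sum_(j < M) sb j ^+ 2 by rewrite l2norm_sqr ip_sine_sum_sqr.
pose Ym := sine_energy M z; pose Yn := sine_energy N z.
have zsg : ip z sg = Ym.
  by rewrite ip_sine_sum//; apply: eq_bigr => j _; rewrite /sb expr2 mulrA.
have ksg : ip k sg = - x ^+ 2.
  rewrite x2 ip_sine_sum// -sumrN; apply: eq_bigr => j _.
  by rewrite (ip_sine_second j Hz Lk wk) /sb /zc; ring.
have qsg : ip q sg = ip (dx q) (dsine_sum M zc).
  rewrite ip_sine_sum// ip_dsine_sum//; apply: eq_bigr => j _.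
  by rewrite (ip_dsine j Hq) /sb; ring.
have Ym0 : 0 <= Ym := sine_energy_ge0 _ _; have Yn0 : 0 <= Yn := sine_energy_ge0 _ _.
have Y2 : ip zx zx = y ^+ 2 by rewrite l2norm_sqr.
have YmY : Ym <= y ^+ 2 by rewrite -Y2; exact: (bessel_derivative M Hz).
have qsg_le : `|ip q sg| <= m2 * y.
  rewrite qsg (le_trans (ip_CS Lqx (dsine_sum_L2 M zc)))//.
  apply: ler_pM; rewrite ?l2norm_ge0//.
  apply: le_of_sqr (l2norm_ge0 _) _.
  by move: YmY; rewrite /Ym sine_energy_norm.
have fsg : ip (sine_sum N zc) sg = Yn.
  rewrite ipC ip_sine_sum//; apply: eq_bigr => j _.
  rewrite ipC (ip_sine_sum _ _ (sine_L2 R j)).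
  under eq_bigr do rewrite sine_orthonormal.
  have jM : (j < M)%N := leq_trans (ltn_ord j) NM.
  by rewrite (sum_kronecker sb (Ordinal jM)) /sb /= /zc; ring.
have LpzZ := L2Z 2 Lpz.
have Geq' : ip G sg = a * Ym + (a - b) * ip q sg - nu * x ^+ 2
    - 2 * ip (fun x => p x * zx x) sg - 2 * ip (fun x => z x * dx q x) sg - mu * Yn.
  pose T1 u := a * z u; pose T2 u := (a - b) * q u; pose T3 u := nu * k u.
  pose T4 u := 2 * (p u * zx u); pose T5 u := 2 * (z u * dx q u).
  pose T6 u := mu * sine_sum N zc u.
  have L1 : L2 T1 by exact: L2Z. have L2' : L2 T2 by exact: L2Z.
  have L3 : L2 T3 by exact: L2Z. have L4 : L2 T4 by exact: L2Z.
  have L5 : L2 T5 by exact: L2Z. have L6 : L2 T6 by exact: L2Z.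
  have L12 := L2D L1 L2'; have L123 := L2D L12 L3; have L1234 := L2B L123 L4.
  have L12345 := L2B L1234 L5; have Lall := L2B L12345 L6.
  rewrite (ip_eq_ae LG Lall Lsg); last first.
    by apply: aeS Geq => u h uI; rewrite (h uI) rate_difference.
  rewrite (ipBl L12345 L6 Lsg) (ipBl L1234 L5 Lsg) (ipBl L123 L4 Lsg).
  rewrite (ipDl L12 L3 Lsg) (ipDl L1 L2' Lsg).
  rewrite (ipZl a Lz Lsg) (ipZl (a - b) Lq Lsg) (ipZl nu Lk Lsg).
  rewrite (ipZl 2 Lpz Lsg) (ipZl 2 Lzq Lsg) (ipZl mu Lf Lsg).
  by rewrite zsg ksg fsg mulrN.
have Dz : l2norm p ^+ 2 - l2norm q ^+ 2 = ip z p + ip z q.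
  by rewrite !l2norm_sqr /z !ipBl// (ipC q p); ring.
have zy : l2norm z <= y / 2.
  apply: le_of_sqr; first by rewrite divr_ge0.
  have := poincare Hz; have := ev_ge4 R 0; have := ip_ge0 z.
  rewrite Y2 l2norm_sqr expr_div_n => z0 e4 h.
  rewrite ler_pdivlMr// mulrC; apply: le_trans h.
  by rewrite expr2 -natrM ler_wpM2r.
have hD : `|l2norm p ^+ 2 - l2norm q ^+ 2| <= y / 2 * (c0 * m4 + c0 * m2).
  rewrite Dz mulrDr (le_trans (ler_normD _ _))//; apply: lerD.
    rewrite (le_trans (ip_CS Lz Lp))//; apply: ler_pM; rewrite ?l2norm_ge0//.
    exact: l2norm_le_bound.
  rewrite (le_trans (ip_CS Lz Lq))//; apply: ler_pM; rewrite ?l2norm_ge0//.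
  exact: l2norm_le_bound.
have hB1 : `|ip (fun x => p x * zx x) sg| <= c0 * m4 * y * x.
  by rewrite (le_trans (ip_CS Lpz Lsg))// ler_wpM2r.
have hB2 : `|ip (fun x => z x * dx q x) sg| <= c0 * y * m2 * x.
  rewrite (le_trans (ip_CS Lzq Lsg))// ler_wpM2r// (le_trans nzq)//.
  by rewrite ler_wpM2l.
have tail : y ^+ 2 - Ym <= ip k k / ev M by rewrite -Y2; exact: (energy_tail M Hz Lk wk).
have X4 : 4 * Ym <= x ^+ 2.
  rewrite x2 mulr_sumr; apply: ler_sum => j _; rewrite /sb exprMn.
  have -> : ev j ^+ 2 * zc j ^+ 2 = ev j * (ev j * zc j ^+ 2) by ring.
  by rewrite ler_wpM2r ?ev_ge4// mulr_ge0 ?sqr_ge0// ltW// ev_gt0.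
have YmYn : Ym - Yn <= x ^+ 2 / ev N.
  rewrite ler_pdivlMr ?ev_gt0// x2 /Ym /Yn /sine_energy.
  rewrite -!(big_mkord predT (fun j => ev j * zc j ^+ 2)).
  rewrite -(big_mkord predT (fun j => sb j ^+ 2)).
  rewrite !(@big_cat_nat _ _ _ N 0 M)//= addrAC subrr add0r mulr_suml.
  rewrite -[leLHS]add0r; apply: lerD; first by apply: sumr_ge0 => j _; exact: sqr_ge0.
  rewrite big_seq [leRHS]big_seq; apply: ler_sum => j.
  rewrite mem_index_iota => /andP[Nj _]; rewrite /sb exprMn.
  have -> : ev j ^+ 2 * zc j ^+ 2 = ev j * zc j ^+ 2 * ev j by ring.
  by rewrite ler_wpM2l ?ev_le// mulr_ge0 ?sqr_ge0// ltW// ev_gt0.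
rewrite sumG Geq'.
have QE' : Q = 4 * c0 ^+ 2 / nu * m4 ^+ 2 + (4 * c0 ^+ 2 / nu + 1 / (2 * nu)) * m2 ^+ 2 + S.
  by rewrite !sqr_sqrtr.
have := @energy_rate_scalar nu mu c0 m2 m4 S Q a (a - b) (x ^+ 2) x y (y ^+ 2) Ym Yn
  (ip q sg) (ip (fun x => p x * zx x) sg) (ip (fun x => z x * dx q x) sg)
  (l2norm p ^+ 2 - l2norm q ^+ 2) (ip k k / ev M) (ev N)
  nu0 c00' m20 m40 S0 y0 x0 erefl erefl Ym0 Yn0 YmY X4 YmYn tail aS QE' Qmu QN
  qsg_le hB1 hB2 hD.
apply: le_trans; rewrite le_eqVlt; apply/orP; left; apply/eqP; ring.
Qed.

End EnergyRate.

(** * The energy balance in time *)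

Section EnergyBalance.
Variable R : realType.
Local Notation leb := (@lebesgue_measure R).
Local Notation I01 := (`]0%R, 1%R[%classic : set R).
Local Notation ev := (@ev R).
Local Notation sine := (@sine R).

Lemma continuous_at_sqr (f : R -> R) (t : R) : {for t, continuous f} ->
  {for t, continuous (fun x => f x ^+ 2)}.
Proof.
move=> cf; have -> : (fun x => f x ^+ 2) = (f \* f) by apply/funext => x; rewrite expr2.
exact: continuousM.
Qed.

(** The squared norms in space are not known to be measurable in time, since
    only the classes of [u t] are; they agree almost everywhere with an
    integrable function. *)
Lemma class_norm_integrable (T : R) (u : R -> R -> R) : L2L2_class T u ->
  exists kap : R -> R, [/\ forall t, 0 <= kap t,
    leb.-integrable `]0, T[ (EFin \o kap) &
    {ae leb, forall t, t \in `]0, T[ -> L2 (u t) -> ip (u t) (u t) = kap t}].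
Proof.
move=> [V [LV uV]]; exists (fun t => ip (V t) (V t)).
have mT : measurable (`]0, T[%classic : set R) by exact: measurable_itv.
have mI : measurable I01 by exact: measurable_itv.
split; first by move=> t; exact: ip_ge0.
  have [h _ _ _ _] := @Rfubini R _ _ (fun t x => V t x ^+ 2) mT mI (L2L2_integrable_sqr LV).
  move: h; congr (leb.-integrable _ _); apply/funext => t /=; congr EFin.
apply: aeS2 uV (L2L2_section LV) => t uVt LVt tT Lu.
by rewrite -!l2norm_sqr (l2norm_eq_ae Lu (LVt tT) (uVt tT)).
Qed.

Lemma continuous_at_integrable (f : R -> R) (a b : R) :
  (forall t, a <= t <= b -> {for t, continuous f}) ->
  leb.-integrable `]a, b[ (EFin \o f).
Proof.
move=> cf; apply: (@integrable_subset R _ `[a, b]); try exact: measurable_itv.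
  exact: subset_itv_oo_cc.
apply: continuous_compact_integrable; first exact: segment_compact.
apply: continuous_in_subspaceT => x; rewrite inE /= in_itv/=; exact: cf.
Qed.

(** Mode by mode, this is [integral_primitive_continuous_square] applied to the
    integral equations of the coefficients. *)
Lemma sine_energy_evolution (T : R) (p q g h : R -> R -> R) (M : nat) (a b : R) :
  L2L2 T p -> L2L2 T q -> time_deriv T p g -> time_deriv T q h ->
  continuousL2 p -> continuousL2 q -> 0 < a -> a <= b -> b < T ->
  let rate t := \sum_(k < M) ev k * (ip (p t \- q t) (sine k) *
                  (ip (g t) (sine k) - ip (h t) (sine k))) in
  [/\ leb.-integrable `]a, b[ (EFin \o (fun t => sine_energy M (p t \- q t))),
      leb.-integrable `]a, b[ (EFin \o rate) &
      sine_energy M (p b \- q b) - sine_energy M (p a \- q a) =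
      2 * \int[leb]_(t in `]a, b[) rate t].
Proof.
move=> Lp Lq dp dq cp cq a0 ab bT rate; rewrite {}/rate.
have mab : measurable (`]a, b[%classic : set R) by exact: measurable_itv.
have T0 : 0 < T by exact: lt_trans (lt_le_trans a0 ab) bT.
have ipE k t : 0 <= t -> ip (p t \- q t) (sine k) = ip (p t) (sine k) - ip (q t) (sine k).
  by move=> t0; apply: ipBl (sine_L2 R k); [exact: cp.1|exact: cq.1].
have csine k : continuous (sine k) by exact: C1_continuous (@sine_C1 R k).
have cont k t : a <= t <= b -> {for t, continuous (fun t => ip (p t \- q t) (sine k))}.
  move=> /andP[at' _]; have t0 : 0 < t by exact: lt_le_trans a0 at'.
  have c1 := continuousL2_ip cp (sine_L2 R k) t0.
  have c2 := continuousL2_ip cq (sine_L2 R k) t0.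
  have c3 := cvgB c1 c2.
  suff : ip (p u \- q u) (sine k) @[u --> t] --> ip (p t \- q t) (sine k) by [].
  rewrite (ipE k t (ltW t0)); apply: cvg_trans (c3 _).
  apply: near_eq_cvg; near=> u; rewrite ipE//; apply: ltW; near: u; exact: lt_nbhsr.
have step k : leb.-integrable `]a, b[ (EFin \o (fun t => ip (p t \- q t) (sine k) *
      (ip (g t) (sine k) - ip (h t) (sine k)))) /\
    ip (p b \- q b) (sine k) ^+ 2 - ip (p a \- q a) (sine k) ^+ 2 =
    2 * \int[leb]_(t in `]a, b[) (ip (p t \- q t) (sine k) *
      (ip (g t) (sine k) - ip (h t) (sine k))).
  have [i1 e1] := coefficient_evolution T0 Lp dp cp (csine k).
  have [i2 e2] := coefficient_evolution T0 Lq dq cq (csine k).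
  have sub c d : a <= c -> d <= b -> `]c, d[ `<=` (`]0, T[%classic : set R).
    move=> ac db x /=; rewrite !in_itv/= => /andP[cx xd].
    by rewrite (lt_trans (lt_le_trans a0 ac) cx) (lt_trans (lt_le_trans xd db) bT).
  have mT : measurable (`]0, T[%classic : set R) by exact: measurable_itv.
  have restr f c d : a <= c -> d <= b -> leb.-integrable `]0, T[ (EFin \o f) ->
      leb.-integrable `]c, d[ (EFin \o f).
    by move=> ac db; apply: integrable_subset (sub c d ac db) => //; exact: measurable_itv.
  have ii := integrable_sub mab (restr _ _ _ (lexx a) (lexx b) i1) (restr _ _ _ (lexx a) (lexx b) i2).
  have incr c d : a <= c -> c <= d -> d <= b ->
      ip (p d \- q d) (sine k) - ip (p c \- q c) (sine k) =
      \int[leb]_(t in `]c, d[) (ip (g t) (sine k) - ip (h t) (sine k)).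
    move=> ac cd db; have c0 := lt_le_trans a0 ac; have dT := le_lt_trans db bT.
    rewrite (ipE k d (ltW (lt_le_trans c0 cd))) (ipE k c (ltW c0)).
    rewrite (Rint_sub _ (restr _ _ _ ac db i1) (restr _ _ _ ac db i2))//.
    rewrite -(e1 c d c0 cd dT) -(e2 c d c0 cd dT) !opprB addrACA [RHS]addrACA.
    by congr (_ + _); rewrite addrC.
  have [I E] := integral_primitive_continuous_square ab (cont k) ii incr.
  by split=> //; rewrite E (Rint_mull 2 mab I).
have csq k : leb.-integrable `]a, b[ (EFin \o (fun t => ev k * ip (p t \- q t) (sine k) ^+ 2)).
  apply: integrable_scale => //.
  by apply: continuous_at_integrable => t tab; apply: continuous_at_sqr; exact: cont.
rewrite /sine_energy; elim: M => [|M [IE IR IB]].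
  split.
  - under [X in EFin \o X]eq_fun do rewrite big_ord0; exact: integrable_cst.
  - under [X in EFin \o X]eq_fun do rewrite big_ord0; exact: integrable_cst.
  - rewrite !big_ord0 subrr; under eq_Rintegral do rewrite big_ord0.
    by rewrite Rintegral_itvoo_cst// !mul0r mulr0.
have [stI stE] := step M.
have stI' := integrable_scale (ev M) mab stI.
split.
- under [X in EFin \o X]eq_fun do rewrite big_ord_recr.
  exact: integrable_add mab IE (csq M).
- under [X in EFin \o X]eq_fun do rewrite big_ord_recr.
  exact: integrable_add mab IR stI'.
- rewrite !big_ord_recr /=; under eq_Rintegral do rewrite big_ord_recr.
  rewrite (Rint_add mab IR stI') (Rint_mull (ev M) mab stI).
  have := congr1 (fun x => ev M * x) stE; move: IB => /=.
  move: (\sum_(k < M) _) (\sum_(k < M) _) (Rintegral _ _ _) (Rintegral _ _ _) => x1 x2 i1 i2.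
  by move=> e1 e2; rewrite mulrDr -e1 [2 * (_ * _)]mulrCA -e2 mulrBr opprD addrACA.
Unshelve. all: by end_near. Qed.

Lemma scalar_sqr_evolution (D d : R -> R) (a b : R) : a <= b ->
  (forall t, a <= t <= b -> is_derive t (1 : R) D (d t)) ->
  (forall t, a <= t <= b -> {for t, continuous d}) ->
  [/\ leb.-integrable `]a, b[ (EFin \o (fun t => D t ^+ 2)),
      leb.-integrable `]a, b[ (EFin \o (fun t => D t * d t)) &
      D b ^+ 2 - D a ^+ 2 = 2 * \int[leb]_(t in `]a, b[) (D t * d t)].
Proof.
move=> ab dD cd.
have cD t : a <= t <= b -> {for t, continuous D}.
  move=> tab; apply: differentiable_continuous; apply/derivable1_diffP.
  exact: (@ex_derive _ _ _ _ _ _ _ (dD t tab)).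
have di : leb.-integrable `]a, b[ (EFin \o d) by exact: continuous_at_integrable.
have FTC c e : a <= c -> c <= e -> e <= b -> D e - D c = \int[leb]_(x in `]c, e[) d x.
  move=> ac; rewrite le_eqVlt => /predU1P[<- _|ce eb].
    by rewrite subrr set_itvoo0 Rintegral_set0.
  have inab x : c <= x <= e -> a <= x <= b.
    by move=> /andP[cx xe]; rewrite (le_trans ac cx) (le_trans xe eb).
  apply/esym; apply: local_FTC ce _ _; first by move=> x /inab; exact: dD.
  by apply: continuous_in_subspaceT => x; rewrite inE /= in_itv/= => /inab; exact: cd.
have [I E] := integral_primitive_continuous_square ab cD di FTC.
split=> //; last by rewrite E Rint_mull.
by apply: continuous_at_integrable => t tab; apply: continuous_at_sqr; exact: cD.
Qed.

End EnergyBalance.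

(** * Decay of the synchronization error *)

Section Synchronization.
Variable R : realType.
Local Notation leb := (@lebesgue_measure R).
Local Notation ev := (@ev R).
Local Notation sine := (@sine R).

Definition error_energy (v : R -> R -> R) (U : R -> R) (vt : R -> R -> R) (Ut : R -> R)
    (M : nat) (t : R) : R :=
  sine_energy M (vt t \- v t) + (Ut t - U t) ^+ 2.

Lemma error_time_derivative (nu mu : R) (N : nat) (lam : nat -> R)
    (w : nat -> R -> R)
    (v : R -> R -> R) (U : R -> R) (vt : R -> R -> R) (Ut : R -> R)
    (g gt : R -> R -> R) (t : R) :
  dirichlet_spectrum lam w -> L2 (vt t \- v t) ->
  {ae leb, forall x, x \in `]0, 1[ -> g t x =
    U t * v t x + nu * dx (dx (v t)) x - 2 * v t x * dx (v t) x + 0} ->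
  {ae leb, forall x, x \in `]0, 1[ -> gt t x =
    Ut t * vt t x + nu * dx (dx (vt t)) x - 2 * vt t x * dx (vt t) x +
    - mu * \sum_(1 <= k < N.+1) ip (vt t \- v t) (w k) * w k x} ->
  {ae leb, forall x, x \in `]0, 1[ -> (gt t \- g t) x =
    Ut t * vt t x + nu * dx (dx (vt t)) x - 2 * vt t x * dx (vt t) x
    - mu * sine_sum N (fun k => ip (vt t \- v t) (sine k)) x
    - (U t * v t x + nu * dx (dx (v t)) x - 2 * v t x * dx (v t) x)}.
Proof.
move=> hw Lz eq_g eq_gt; have proj := spectrum_projection N hw Lz.
apply: aeS2 eq_g (aeS2 (fun x h1 h2 => conj h1 h2) eq_gt proj) => x e1 [e2 e3] xI.
by rewrite /= (e1 xI) (e2 xI) (e3 xI) addr0 mulNr.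
Qed.

(** The inequality [energy_rate] integrated in time. Its error term contains the
    squared second derivatives of the two states, which are integrable over
    ]0, s + 2[; this interval is fixed before the truncation [M]. *)
Lemma error_energy_step (nu r mu c0 M2 M4 S Q t0 : R) (N : nat) (lam : nat -> R)
    (w : nat -> R -> R) (v0 vt0 : R -> R) (U0 Ut0 : R)
    (v : R -> R -> R) (U : R -> R) (vt : R -> R -> R) (Ut : R -> R) :
  0 < nu -> sobolev_constant c0 -> 0 <= M2 -> 0 <= M4 -> 0 <= S ->
  dirichlet_spectrum lam w ->
  uncontrolled_solution nu r v0 U0 v U ->
  feedback_solution nu r mu N w v vt0 Ut0 vt Ut ->
  Q = 4 * c0 ^+ 2 / nu * M4 + (4 * c0 ^+ 2 / nu + 1 / (2 * nu)) * M2 + S ->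
  Q <= mu -> (ev N)^-1 * Q <= nu / 4 -> 0 < t0 ->
  (forall t, t0 <= t -> l2norm (dx (vt t)) ^+ 2 <= M4) ->
  (forall t, t0 <= t -> l2norm (dx (v t)) ^+ 2 <= M2) ->
  (forall t, t0 <= t -> Ut t <= S) ->
  forall s : R, t0 <= s -> exists2 C : R, 0 <= C & forall M a b, (N <= M)%N ->
    s <= a -> a <= b -> b <= s + 1 ->
    leb.-integrable `]a, b[ (EFin \o error_energy v U vt Ut M) /\
    error_energy v U vt Ut M b - error_energy v U vt Ut M a <=
    - (nu / 2) * \int[leb]_(t in `]a, b[) error_energy v U vt Ut M t + C / ev M.
Proof.
move=> nu0 hc0 M20 M40 S0 hw hsol hfb QE Qmu QN t00 bM4 bM2 bS s s0.
have Q0' : 0 <= Q by rewrite QE; exact: gain_ge0.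
pose T : R := s + 2.
have T0 : 0 < T by rewrite /T; lra.
have [Lvt H2vt _ cls_t] := ss_L2H2 hfb T0.
have [Lv H2v _ cls] := ss_L2H2 hsol T0.
have [_ _ H01vt _] := ss_LinfH01 hfb T0.
have [_ _ H01v _] := ss_LinfH01 hsol T0.
have [gt dgt eq_gt] := ss_eqv hfb T0.
have [g dg eq_g] := ss_eqv hsol T0.
have cvt := ss_continuous hfb; have cv := ss_continuous hsol.
have [kt [kt0 kti kte]] := class_norm_integrable cls_t.
have [kv [kv0 kvi kve]] := class_norm_integrable cls.
have mT : measurable (`]0, T[%classic : set R) by exact: measurable_itv.
(* an integrable bound on the squared second derivative of the error *)
pose kap t := 2 * (kt t + kv t).
have kap0 t : 0 <= kap t by rewrite mulr_ge0// addr_ge0.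
have kapi : leb.-integrable `]0, T[ (EFin \o kap).
  by apply: integrable_scale => //; exact: integrable_add.
exists (2 * Q * \int[leb]_(t in `]0, T[) kap t).
  by rewrite !mulr_ge0//; apply: Rintegral_ge0 => t _; exact: kap0.
move=> M a b NM sa ab bs.
have a0 : 0 < a by lra.
have bT : b < T by rewrite /T; lra.
have mab : measurable (`]a, b[%classic : set R) by exact: measurable_itv.
have sub : `]a, b[ `<=` (`]0, T[%classic : set R).
  by move=> x /=; rewrite !in_itv/= => /andP[ax xb]; rewrite (lt_trans a0 ax) (lt_trans xb bT).
pose D t := Ut t - U t; pose d t := derive1 Ut t - derive1 U t.
have dD t : a <= t <= b -> is_derive t (1 : R) D (d t).
  move=> /andP[at' _]; have t1 : 0 < t by exact: lt_le_trans a0 at'.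
  apply: is_deriveB; apply: DeriveDef; rewrite ?derive1E//.
    exact: ss_U_derivable hfb t t1.
  exact: ss_U_derivable hsol t t1.
have cd t : a <= t <= b -> {for t, continuous d}.
  move=> /andP[at' _]; have t1 : 0 < t by exact: lt_le_trans a0 at'.
  by apply: continuousB; [exact: ss_U_C1 hfb t t1|exact: ss_U_C1 hsol t t1].
have [D2i Ddi D2e] := scalar_sqr_evolution ab dD cd.
have [Ei ri Ee] := sine_energy_evolution M Lvt Lv dgt dg cvt cv a0 ab bT.
pose rate t := \sum_(k < M) ev k * (ip (vt t \- v t) (sine k) *
                  (ip (gt t) (sine k) - ip (g t) (sine k))).
have EEi := integrable_add mab Ei D2i.
split; first exact: EEi.
have QM : 0 <= Q / ev M by rewrite divr_ge0// ltW// ev_gt0.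
have key : {ae leb, forall t, `]a, b[%classic t -> rate t + D t * d t <=
    - (nu / 4) * error_energy v U vt Ut M t + Q / ev M * kap t}.
  apply: aeS2 (aeS2 (fun t h1 h2 => conj h1 h2) H2vt H2v)
    (aeS2 (fun t h1 h2 => conj h1 h2) (aeS2 (fun t h1 h2 => conj h1 h2) eq_gt eq_g)
    (aeS2 (fun t h1 h2 => conj h1 h2) (aeS2 (fun t h1 h2 => conj h1 h2) kte kve)
      (aeS2 (fun t h1 h2 => conj h1 h2) (L2L2_section dgt.1) (L2L2_section dg.1)))).
  move=> t [h1 h2] [[h3 h4] [[h5 h6] [h7 h8]]] tab.
  have tT : t \in `]0, T[ by exact: sub tab.
  move: tab; rewrite /= in_itv/= => /andP[at' tb].
  have tt0 : t0 <= t by exact: le_trans s0 (le_trans sa (ltW at')).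
  have t1 : 0 < t by exact: lt_le_trans t00 tt0.
  have t1T : 0 < t < T by move: tT; rewrite in_itv.
  have Lgt := h7 tT; have Lg := h8 tT.
  have Hvt := h1 tT; have Hv := h2 tT.
  have Lvtt := cvt.1 t (ltW t1); have Lvv := cv.1 t (ltW t1).
  have := energy_rate nu0 hc0 M20 M40 S0 (H01vt t t1T) (H01v t t1T) Hvt Hv
    (L2B Lgt Lg) (bM4 t tt0) (bM2 t tt0) (bS t tt0) QE Qmu QN NM
    (error_time_derivative hw (L2B Lvtt Lvv) (h4 tT) (h3 tT)).
  have [Lpxx _] := H1_dx Hvt.2; have [Lqxx _] := H1_dx Hv.2.
  have ek : kap t = 2 * (ip (dx (dx (vt t))) (dx (dx (vt t))) +
      ip (dx (dx (v t))) (dx (dx (v t)))) by rewrite /kap -(h5 tT Lpxx) -(h6 tT Lqxx).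
  have := ip_sqrB_le Lpxx Lqxx; rewrite -ek => kk.
  have -> : \sum_(k < M) ev k * (ip (vt t \- v t) (sine k) * ip (gt t \- g t) (sine k)) = rate t.
    by apply: eq_bigr => k _; rewrite (ipBl Lgt Lg (sine_L2 R k)).
  have -> : (Ut t - U t) * (- nu * (Ut t - U t) - (l2norm (vt t) ^+ 2 - l2norm (v t) ^+ 2)) =
      D t * d t.
    rewrite /d (ss_eqU hfb t1) (ss_eqU hsol t1) /D.
    by move: (l2norm _ ^+ 2) (l2norm _ ^+ 2) (Ut t) (U t) => n1 n2 u1 u2; ring.
  move/le_trans; apply; rewrite lerD2l.
  move: kk; move: (ip _ _) => n kk.
  by rewrite [leLHS](_ : _ = Q / ev M * n) ?ler_wpM2l// mulrA mulrAC.
have kapi' := integrable_subset mab mT sub kapi.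
have nEi := integrable_scale (- (nu / 4)) mab EEi.
have qki := integrable_scale (Q / ev M) mab kapi'.
have := ae_le_Rintegral mab (integrable_add mab ri Ddi) (integrable_add mab nEi qki) key.
rewrite (Rint_add mab ri Ddi) (Rint_add mab nEi qki) (Rint_mull _ mab EEi) (Rint_mull _ mab kapi').
have := Rintegral_subset_le mab mT sub kap0 kapi.
move=> /(ler_wpM2l QM).
have -> : error_energy v U vt Ut M b - error_energy v U vt Ut M a =
    (sine_energy M (vt b \- v b) - sine_energy M (vt a \- v a)) + (D b ^+ 2 - D a ^+ 2).
  by rewrite /error_energy -/(D b) -/(D a); ring.
rewrite Ee D2e.
have -> : 2 * Q * (\int[leb]_(t in `]0, T[) kap t) / ev M =
    2 * (Q / ev M * \int[leb]_(t in `]0, T[) kap t) by ring.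
rewrite /error_energy; move: (Q / ev M * _) (Q / ev M * _) => I1 I2.
move: (Rintegral _ _ _) (Rintegral _ _ _) (Rintegral _ _ _) => I3 I4 I5; lra.
Qed.

End Synchronization.

(** The limit value [r / nu] of the scalar unknown without its quadratic sink
    lies strictly below the square root of the absorbing radius, because of the
    factor 2 in it. *)
Lemma sqrt_M3_gt (R : realType) (nu r mu lam1 : R) : 0 < nu -> 0 < r -> 0 < mu ->
  0 < lam1 -> r / nu < Num.sqrt (M3 nu r mu lam1).
Proof.
move=> nu0 r0 mu0 l0.
have rn : 0 < r / nu by rewrite divr_gt0.
rewrite -(ger0_norm (ltW rn)) -sqrtr_sqr.
pose m := Num.min 1 (2 * lam1).
have m0 : 0 < m by rewrite lt_min ltr01 mulr_gt0.
have m1 : m <= 1 by rewrite ge_min lexx.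
have d0 : 0 < nu * m by rewrite mulr_gt0.
have M1_ge0 : 0 <= M1 nu r lam1.
  by rewrite /M1 -/m divr_ge0 ?mulr_ge0 ?sqr_ge0// ltW.
have lt : (r / nu) ^+ 2 < M3 nu r mu lam1.
  rewrite /M3 -/m; apply: (@lt_le_trans _ _ (2 * r ^+ 2 / (nu * (nu * m)))); last first.
    by rewrite lerDl mulr_ge0// divr_ge0// ltW.
  rewrite ltr_pdivlMr ?mulr_gt0//.
  have -> : (r / nu) ^+ 2 * (nu * (nu * m)) = r ^+ 2 * m by field; exact: lt0r_neq0.
  by rewrite mulrC ltr_pM2r ?exprn_gt0//; lra.
by rewrite ltr_sqrt// (le_lt_trans _ lt)// sqr_ge0.
Qed.

Theorem theorem2p2 (R : realType) (nu r mu : R) (N : nat)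
    (lam : nat -> R) (w : nat -> R -> R) (c0 M2 M4 : R)
    (v0 vt0 : R -> R) (U0 Ut0 : R)
    (v : R -> R -> R) (U : R -> R) (vt : R -> R -> R) (Ut : R -> R)
    (hnu : 0 < nu) (hr : 0 < r) (hmu : 0 < mu) (hN : (0 < N)%N)
    (hw : dirichlet_spectrum lam w)
    (hc0 : sobolev_constant c0)
    (hM2 : M2_bound nu r M2)
    (hM4 : M4_bound nu r mu w M4)
    (hv0 : H01 v0) (hvt0 : H01 vt0)
    (hsol : uncontrolled_solution nu r v0 U0 v U)
    (hfeedback : feedback_solution nu r mu N w v vt0 Ut0 vt Ut)
    (hQmu : 0 <= mu - Q0 nu r mu (lam 1%N) c0 M2 M4)
    (hQN : (lam N.+1)^-1 * Q0 nu r mu (lam 1%N) c0 M2 M4 <= nu / 4) :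
  exists t0 C alpha : R, [/\ 0 < t0, 0 <= C, 0 < alpha &
    forall t : R, t0 <= t ->
      l2norm (dx (vt t) \- dx (v t)) ^+ 2 + `|Ut t - U t| ^+ 2
        <= C * expR (- alpha * t)].
Proof.
set Q := Q0 nu r mu (lam 1%N) c0 M2 M4 in hQmu hQN.
pose S := Num.sqrt (M3 nu r mu (lam 1%N)).
have S0 : 0 <= S := sqrtr_ge0 _.
have Qmu : Q <= mu by rewrite -subr_ge0.
have QN : (ev R N)^-1 * Q <= nu / 4 by rewrite -(spectrum_eigenvalue hw).
have QE : Q = 4 * c0 ^+ 2 / nu * M4 + (4 * c0 ^+ 2 / nu + 1 / (2 * nu)) * M2 + S by [].
have rS : r / nu < S.
  by apply: sqrt_M3_gt => //; rewrite (spectrum_eigenvalue hw 0) ev_gt0.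
have [M20 /(_ v0 U0 v U hv0 hsol) [t2 t20 bM2]] := hM2.
have [M40 /(_ N v0 U0 v U vt0 Ut0 vt Ut hN hv0 hvt0 hsol hfeedback) [t4 t40 bM4]] := hM4.
have Ut' t : 0 < t -> derive1 Ut t <= r - nu * Ut t.
  by move=> t0; rewrite (ss_eqU hfeedback t0) lerBlDr lerDl sqr_ge0.
have rS' : 0 < S - r / nu by rewrite subr_gt0.
have [t1 t10 bS] := linear_ode_upper hnu rS' (ss_U_derivable hfeedback) Ut'.
pose t0 := Num.max t1 (Num.max t2 t4).
have t00 : 0 < t0 by rewrite lt_max t10.
have t01 t : t0 <= t -> t1 <= t by rewrite ge_max => /andP[].
have t02 t : t0 <= t -> t2 <= t by rewrite !ge_max => /and3P[].
have t04 t : t0 <= t -> t4 <= t by rewrite !ge_max => /and3P[].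
have bS' t : t0 <= t -> Ut t <= S.
  by move=> /t01/bS; rewrite addrC subrK.
have step := error_energy_step hnu hc0 (ltW M20) (ltW M40) S0 hw hsol hfeedback
  QE Qmu QN t00 (fun t ht => bM4 t (t04 t ht)) (fun t ht => bM2 t (t02 t ht)) bS'.
have Hz t : 0 < t -> H01_pair (vt t \- v t) (dx (vt t) \- dx (v t)).
  move=> tp; have T0 : 0 < t + 1 by rewrite addr_gt0.
  have tT : 0 < t < t + 1 by rewrite tp ltrDl ltr01.
  apply: H01_pairB; apply: H01_to_pair.
    by have [_ _ /(_ t tT)] := ss_LinfH01 hfeedback T0.
  by have [_ _ /(_ t tT)] := ss_LinfH01 hsol T0.
have E0 M t : 0 <= error_energy v U vt Ut M t.
  by rewrite addr_ge0 ?sqr_ge0 ?sine_energy_ge0.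
have Emono M M' t : (M <= M')%N -> error_energy v U vt Ut M t <= error_energy v U vt Ut M' t.
  by move=> MM; rewrite lerD2r sine_energy_le.
have Et0 M : error_energy v U vt Ut M t0 <=
    ip (dx (vt t0) \- dx (v t0)) (dx (vt t0) \- dx (v t0)) + (Ut t0 - U t0) ^+ 2.
  by rewrite lerD2r; exact: (bessel_derivative M (Hz t0 t00)).
have nu2 : 0 < nu / 2 by rewrite divr_gt0.
have [C [gamma [C0 g0 decay]]] := truncated_decay nu2 E0 Emono Et0 step.
exists t0, (2 * C), gamma; split => //; first exact: mulr_ge0.
move=> t tt; have tp : 0 < t by exact: lt_le_trans t00 tt.
have K0 : 0 <= C * expR (- gamma * t) by rewrite mulr_ge0// expR_ge0.
have sine_part M : sine_energy M (vt t \- v t) <= C * expR (- gamma * t).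
  by apply: le_trans (decay M t tt); rewrite lerDl sqr_ge0.
have scalar_part : (Ut t - U t) ^+ 2 <= C * expR (- gamma * t).
  by apply: le_trans (decay 0%N t tt); rewrite lerDr sine_energy_ge0.
rewrite l2norm_sqr real_normK ?num_real// -mulrA mulrDl mul1r.
by apply: lerD => //; exact: H01_pair_complete (Hz t tp) sine_part.
Qed.
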